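(* Let $\mathbf k$ be an algebraically closed field and $V$ a vertex $\mathbf k$-algebra with an $\mathrm{Aut}\,\mathcal O$-action. Let $C$ be a smooth projective curve over $\mathbf k$ with distinct marked points $P_\bullet=(P_1,\dots,P_n)$, let $D$ be an effective divisor on $C$ not supported at $P_\bullet$, and fix formal coordinates $t_i$ at $P_i$ for all $i$. Suppose that $V$ is of CFT-type and $C_2$-cofinite. Then for any $n$-tuple of $V$-modules $M^\bullet=(M^1,\dots,M^n)$ that are finitely generated by their degree $0$ parts, the space of coinvariants $$M^\bullet_{\mathcal L_{C\setminus P_\bullet}(V,D)}=M^\bullet\big/\big(\mathcal L_{C\setminus P_\bullet}(V,D)\cdot M^\bullet\big)$$ is finite-dimensional over $\mathbf k$.
   Context: **Vertex algebras.** A vertex $\mathbf k$-algebra is a $\mathbf k$-module $V$ with $\mathbf 1\in V$ and a linear map $Y(\cdot,z)\colon V\to\mathrm{End}(V)[[z,z^{-1}]]$, $Y(a,z)=\sum_{n\in\mathbb Z}a_{(n)}z^{-1-n}$, such that $a_{(n)}b=0$ for $n\gg0$; $\mathbf 1_{(n)}a=\delta_{n,-1}a$; $a_{(-1)}\mathbf 1=a$ and $a_{(n)}\mathbf 1=0$ for $n\ge0$; and the Jacobi identity holds, equivalently for all $r,s\in\mathbb Z$: $[a_{(r)},b_{(s)}]=\sum_{j\ge0}\binom rj(a_{(j)}b)_{(r+s-j)}$ and $(a_{(r)}b)_{(s)}=\sum_{j\ge0}(-1)^j\binom rj\big(a_{(r-j)}b_{(s+j)}-(-1)^rb_{(r+s-j)}a_{(j)}\big)$.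 Put $T^{(n)}a=a_{(-1-n)}\mathbf 1$, $e^{zT}=\sum_nz^nT^{(n)}$. $V$ is $\mathbb N$-graded if $V=\bigoplus_{s\ge0}V_s$, $\mathbf 1\in V_0$, and $a_{(n)}$ has degree $\deg a-1-n$; it is of CFT-type if it is $\mathbb N$-graded with $V_0=\mathbf k\mathbf 1$. $C_2(V)$ is the span of $a_{(-m)}b$, $a,b\in V$, $m\ge2$; $V$ is $C_2$-cofinite if $V/C_2(V)$ is finite-dimensional. The $V$-modules here are admissible: $W=\bigoplus_{s\ge0}W_s$ with modes $a^W_{(n)}$ of degree $\deg a-1-n$, $a^W_{(n)}w=0$ for $n\gg0$, $\mathbf 1^W_{(n)}=\delta_{n,-1}\mathrm{id}$, and the same two formulas on $W$. $W$ is finitely generated by its degree $0$ part if it is generated, under the action of all modes (equivalently over the universal enveloping algebra of $V$), by finitely many elements of $W_0$. **$\mathrm{Aut}\,\mathcal O$-actions.** $\mathrm{Aut}\,\mathcal O$ is the group (functor) of continuous automorphisms $\rho(t)=a_1t+a_2t^2+\cdots$ ($a_1$ a unit) of $\mathbf k[[t]]$. An action on $V$ is a representation $\Pi\colon\mathrm{Aut}\,\mathcal O\to GL_{\mathbf k}(V)$ such that, with $\Pi(\rho_z)=e^{-zT}\Pi(\rho)e^{\rho(z)T}$ and $G_pV=\bigoplus_{s\le p}V_s$: (i) all coefficients of $z^n$ in $\Pi(\rho_z)$ preserve $G_\bullet V$; (ii) $\Pi(\rho_z)a-(\rho'(z))^{-\Delta}a\in G_{\Delta-1}V[[z]]$ for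 $a\in V_\Delta$; (iii) $\Pi(t\mapsto xt)a=x^{-\deg a}a$ for $x\in\mathbf k^\times$; (iv) $\Pi(\rho)Y(\Pi(\rho_z)^{-1}a,\rho(z))\Pi(\rho)^{-1}=Y(a,z)$. **Sheaf and Lie algebra.** Let $\pi\colon\mathscr{A}ut_C\to C$ be the $\mathrm{Aut}\,\mathcal O$-torsor of pairs (point, formal coordinate at it); $\mathcal V_C=(V\otimes\pi_*\mathcal O_{\mathscr{A}ut_C})^{\mathrm{Aut}\,\mathcal O}$. A coordinate $t$ on an open $U$ gives $\mathcal V_C|_U\simeq_tV\otimes\mathcal O_U$, trivializations for $t$ and $\rho(t)$ being related by $(P,t,a)\sim(P,\rho(t),\Pi(\rho)^{-1}a)$. $\mathrm{Im}\,\nabla\subset\mathcal V_C\otimes\omega_C$ is generated by the images of $\nabla^{(k)}(a\otimes f\,dt)=\sum_{i=0}^kT^{(i)}a\otimes\partial_t^{(k-i)}f\,dt$, $k>0$ ($\partial_t^{(j)}t^m=\binom mjt^{m-j}$). $\mathcal L_{C\setminus P_\bullet}(V)=H^0(C\setminus P_\bullet,(\mathcal V_C\otimes\omega_C)/\mathrm{Im}\,\nabla)$, and for $D=\sum_jn_jQ_j$, $\mathcal L_{C\setminus P_\bullet}(V,D)=H^0\big(C\setminus P_\bullet,(\mathcal V_C\otimes\omega_C(-D))/\mathrm{Im}\,\nabla\big)$, regarded as the subspace of $\mathcal L_{C\setminus P_\bullet}(V)$ given by sections vanishing to order at least $n_j$ at $Q_j$. **Action.** Expanding $\sigma$ in $t_i$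 gives $\sigma_{P_i}$; the class of $a\otimes t_i^m\,dt_i$ acts on $M^i$ by $a^{M^i}_{(m)}$. On $M^\bullet=M^1\otimes\cdots\otimes M^n$, $\sigma(u^1\otimes\cdots\otimes u^n)=\sum_iu^1\otimes\cdots\otimes\sigma_{P_i}(u^i)\otimes\cdots\otimes u^n$. *)

(* Defs.v *)
From HB Require Import structures.
From mathcomp Require Import all_boot all_order all_algebra.
From mathcomp Require Import mpoly.

Set Implicit Arguments.
Unset Strict Implicit.
Unset Printing Implicit Defensive.

Import GRing.Theory.
Local Open Scope ring_scope.

(* * Linear algebra *)

(* [has_sum u w]: the family [u] has finite support and its sum is [w].  All
   the infinite sums in the theory of vertex algebras are of this kind. *)
Definition has_sum (I : eqType) (W : nmodType) (u : I -> W) (w : W) : Prop :=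
  exists2 s : seq I, uniq s /\ (forall i, i \notin s -> u i = 0)
                   & w = \sum_(i <- s) u i.

Definition in_span (k : fieldType) (W : lmodType k) (S : W -> Prop) (w : W)
    : Prop :=
  exists m (c : 'I_m -> k) (x : 'I_m -> W),
    (forall i, S (x i)) /\ w = \sum_i c i *: x i.

(* W / span S is finite-dimensional: it is spanned by the classes of finitely
   many vectors. *)
Definition fin_dim_quotient (k : fieldType) (W : lmodType k) (S : W -> Prop)
    : Prop :=
  exists m (e : 'I_m -> W), forall w, exists c : 'I_m -> k,
    in_span S (w - \sum_i c i *: e i).

Definition multilinear (k : fieldType) n (M : 'I_n -> lmodType k)
    (T : lmodType k) (f : (forall i, M i) -> T) : Prop :=
  forall (u : forall i, M i) (i : 'I_n) (c : k) (x y : M i),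
    f (dfwith u (c *: x + y)) = c *: f (dfwith u x) + f (dfwith u y).

Record tensor_product (k : fieldType) n (M : 'I_n -> lmodType k) := {
  tens :> lmodType k;
  pure : (forall i, M i) -> tens;
  pure_multilinear : multilinear pure;
  pure_universal : forall (U : lmodType k) (f : (forall i, M i) -> U),
    multilinear f ->
    exists g : {linear tens -> U}, (forall u, g (pure u) = f u) /\
      (forall g' : {linear tens -> U},
         (forall u, g' (pure u) = f u) -> forall x, g' x = g x)
}.

Record GL (k : fieldType) (V : lmodType k) := {
  gl_fun :> {linear V -> V};
  gl_inv : {linear V -> V};
  gl_funK : cancel gl_fun gl_inv;
  gl_invK : cancel gl_inv gl_fun
}.

(* W = \bigoplus_(s >= 0) W_s, where [gr s] is the subspace W_s. *)
Record grading (k : fieldType) (W : lmodType k) := {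
  gr :> nat -> W -> Prop;
  gr0 : forall s, gr s 0;
  gr_lin : forall s c x y, gr s x -> gr s y -> gr s (c *: x + y);
  gr_sum : forall w, exists m (x : nat -> W),
    (forall s, gr s (x s)) /\ w = \sum_(s < m) x s;
  gr_direct : forall m (x : nat -> W), (forall s, gr s (x s)) ->
    \sum_(s < m) x s = 0 -> forall s, (s < m)%N -> x s = 0
}.

(* Homogeneous of degree d for d in Z; the components of negative degree
   vanish. *)
Definition grz (k : fieldType) (W : lmodType k) (G : grading W) (d : int)
    (w : W) : Prop :=
  match d with Posz s => G s w | Negz _ => w = 0 end.

(* [below G p] is \bigoplus_(s < p) W_s, that is G_(p - 1) W. *)
Definition below (k : fieldType) (W : lmodType k) (G : grading W) (p : nat)
    (w : W) : Prop :=
  exists x : nat -> W, (forall s, G s (x s)) /\ w = \sum_(s < p) x s.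

(* * Power series, as sequences of coefficients *)

Section PowerSeries.
Variable k : fieldType.
Implicit Types f g : nat -> k.

Definition fone : nat -> k := fun n => (n == 0%N)%:R.
Definition fmul f g : nat -> k := fun n => \sum_(i < n.+1) f i * g (n - i)%N.
Definition fexp f (j : nat) : nat -> k := iter j (fmul f) fone.
Definition fderiv f : nat -> k := fun n => n.+1%:R * f n.+1.

(* [fcomp f g] is f(g(z)), meaningful when g 0 = 0. *)
Definition fcomp f g : nat -> k :=
  fun n => \sum_(j < n.+1) f j * fexp g j n.

(* 1/f = c^-1 (1 + h + h^2 + ...) with c = f 0 != 0 and h = 1 - f / c. *)
Definition finv f : nat -> k :=
  fun n => (f 0%N)^-1 *
    \sum_(j < n.+1) fexp (fun i => fone i - (f 0%N)^-1 * f i) j n.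

Definition fexpz f (p : int) : nat -> k :=
  match p with Posz m => fexp f m | Negz m => fexp (finv f) m.+1 end.

(* Coefficient of z^N in f(z)^p for p in Z, when f 0 = 0 and f 1 != 0: write
   f(z)^p = z^p (f(z)/z)^p. *)
Definition lexpz f (p N : int) : k :=
  match N - p with
  | Posz m => fexpz (fun i => f i.+1) p m
  | Negz _ => 0
  end.

(* The k-points of Aut O: t |-> a_1 t + a_2 t^2 + ... with a_1 != 0. *)
Record autO := AutO {
  aut_ser :> nat -> k;
  aut_ser0 : aut_ser 0%N = 0;
  aut_ser1 : aut_ser 1%N != 0
}.

Lemma fcomp0 (r s : autO) : fcomp s r 0%N = 0.
Proof. by rewrite /fcomp big_ord1 aut_ser0 mul0r. Qed.

Lemma fcomp1 (r s : autO) : fcomp s r 1%N != 0.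
Proof.
rewrite /fcomp big_ord_recl big_ord1 aut_ser0 mul0r add0r /=.
rewrite /fmul big_ord_recl big_ord1 /= aut_ser0 mul0r add0r.
by rewrite /fone subnn eqxx mulr1 mulf_neq0 ?aut_ser1.
Qed.

(* Composition of automorphisms of k[[t]], where r is the automorphism
   f(t) |-> f(r(t)): the product r s sends t to s(r(t)). *)
Definition aut_mul (r s : autO) : autO := AutO (fcomp0 r s) (fcomp1 r s).

Lemma scale_ser1 (x : k) : x != 0 -> (1%N == 1%N)%:R * x != 0.
Proof. by rewrite eqxx mul1r. Qed.

Definition aut_scale (x : k) (x0 : x != 0) : autO :=
  @AutO (fun n => (n == 1%N)%:R * x) (mul0r x) (scale_ser1 x0).

End PowerSeries.

(* * Vertex algebras and their modules *)

(* The binomial coefficient binom(r, j) for r in Z. *)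
Definition binz (r : int) (j : nat) : int :=
  match r with
  | Posz m => 'C(m, j)%:Z
  | Negz m => (-1) ^+ j * 'C(m + j, j)%:Z
  end.

Definition sgnz (R : pzRingType) (r : int) : R := (-1) ^+ `|r|%N.

(* [Y a n b] is a_(n) b. *)
Record vertex_algebra (k : fieldType) := {
  va :> lmodType k;
  vac : va;
  Y : va -> int -> va -> va;
  Y_linl : forall n b c x y, Y (c *: x + y) n b = c *: Y x n b + Y y n b;
  Y_linr : forall a n c x y, Y a n (c *: x + y) = c *: Y a n x + Y a n y;
  Y_trunc : forall a b, exists N : int, forall n, N <= n -> Y a n b = 0;
  Y_vacl : forall n a, Y vac n a = if n == -1 then a else 0;
  Y_creation : forall a, Y a (-1) vac = a;
  Y_creation0 : forall a n, 0 <= n -> Y a n vac = 0;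
  Y_comm : forall a b c (r s : int),
    has_sum (fun j : nat =>
        (binz r j)%:~R *: Y (Y a j%:Z b) (r + s - j%:Z) c)
      (Y a r (Y b s c) - Y b s (Y a r c));
  Y_assoc : forall a b c (r s : int),
    has_sum (fun j : nat =>
        ((-1) ^+ j * (binz r j)%:~R) *:
          (Y a (r - j%:Z) (Y b (s + j%:Z) c)
           - sgnz k r *: Y b (r + s - j%:Z) (Y a j%:Z c)))
      (Y (Y a r b) s c)
}.

(* T^(n) a *)
Definition Tdiv (k : fieldType) (V : vertex_algebra k) (n : nat) (a : V) : V :=
  Y a (-1 - n%:Z) (vac V).

Record va_grading (k : fieldType) (V : vertex_algebra k) := {
  va_gr :> grading V;
  vac_gr : va_gr 0%N (vac V);
  Y_gr : forall s t (a b : V) (n : int), va_gr s a -> va_gr t b ->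
    grz va_gr (s%:Z + t%:Z - 1 - n) (Y a n b)
}.

Definition cft_type (k : fieldType) (V : vertex_algebra k) (G : va_grading V)
    : Prop :=
  forall v : V, G 0%N v <-> exists c, v = c *: vac V.

Definition C2_cofinite (k : fieldType) (V : vertex_algebra k) : Prop :=
  fin_dim_quotient (fun v : V =>
    exists (a b : V) (m : nat), (2 <= m)%N /\ v = Y a (- m%:Z) b).

Record va_module (k : fieldType) (V : vertex_algebra k) (G : va_grading V) := {
  vm :> lmodType k;
  vm_gr : grading vm;
  YM : V -> int -> vm -> vm;
  YM_linl : forall n w c x y, YM (c *: x + y) n w = c *: YM x n w + YM y n w;
  YM_linr : forall a n c x y, YM a n (c *: x + y) = c *: YM a n x + YM a n y;
  YM_gr : forall s t a w (n : int), G s a -> vm_gr t w ->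
    grz vm_gr (s%:Z + t%:Z - 1 - n) (YM a n w);
  YM_trunc : forall a w, exists N : int, forall n, N <= n -> YM a n w = 0;
  YM_vac : forall n w, YM (vac V) n w = if n == -1 then w else 0;
  YM_comm : forall a b w (r s : int),
    has_sum (fun j : nat =>
        (binz r j)%:~R *: YM (Y a j%:Z b) (r + s - j%:Z) w)
      (YM a r (YM b s w) - YM b s (YM a r w));
  YM_assoc : forall a b w (r s : int),
    has_sum (fun j : nat =>
        ((-1) ^+ j * (binz r j)%:~R) *:
          (YM a (r - j%:Z) (YM b (s + j%:Z) w)
           - sgnz k r *: YM b (r + s - j%:Z) (YM a j%:Z w)))
      (YM (Y a r b) s w)
}.

Definition generated_in_degree0 (k : fieldType) (V : vertex_algebra k)
    (G : va_grading V) (M : va_module G) : Prop :=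
  exists m (e : 'I_m -> M), (forall i, vm_gr M 0%N (e i)) /\
    forall S : M -> Prop,
      S 0 -> (forall c x y, S x -> S y -> S (c *: x + y)) ->
      (forall a n x, S x -> S (YM a n x)) ->
      (forall i, S (e i)) -> forall x, S x.

(* * Aut O-actions *)

Section RhoZ.
Variables (k : fieldType) (V : vertex_algebra k) (p : GL V) (r : autO k).

(* Coefficient of z^n in Pi(r_z) a = e^(-zT) Pi(r) e^(r(z)T) a, [p] = Pi(r). *)
Definition rho_z (n : nat) (a : V) : V :=
  \sum_(i < n.+1) (-1) ^+ i *:
    Tdiv i (p (\sum_(j < (n - i).+1) fexp r j (n - i)%N *: Tdiv j a)).

(* Coefficient of z^n in Pi(r_z)^-1 a = e^(-r(z)T) Pi(r)^-1 e^(zT) a. *)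
Definition rho_z_inv (n : nat) (a : V) : V :=
  \sum_(i < n.+1) \sum_(j < n.+1)
    ((-1) ^+ j * fexp r j (n - i)%N) *: Tdiv j (gl_inv p (Tdiv i a)).

End RhoZ.

(* As k is infinite and the coordinate ring k[a_1^(+-1), a_2, ...] of Aut O is
   reduced, a representation of the group functor Aut O is a homomorphism
   on k-points whose matrix coefficients are polynomials in
   a_1^-1, a_1, a_2, ... ([act_alg]). *)
Record autO_action (k : closedFieldType) (V : vertex_algebra k)
    (G : va_grading V) := {
  act :> autO k -> GL V;
  act_mul : forall r s v, act (aut_mul r s) v = act r (act s v);
  act_alg : forall v, exists m N l (q : 'I_l -> {mpoly k[m]}) (w : 'I_l -> V),
    forall r : autO k,
      act r v = \sum_j (r 1%N ^- N * (q j).@[fun i : 'I_m => r i.+1]) *: w j;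
  act_filt : forall r n d v, below G d v -> below G d (rho_z (act r) r n v);
  act_lead : forall r n d a, G d a ->
    below G d (rho_z (act r) r n a - fexpz (fderiv r) (- d%:Z) n *: a);
  act_scale : forall (x : k) (x0 : x != 0) d a,
    G d a -> act (aut_scale x0) a = x ^- d *: a;
  (* coefficient of z^N in
     Pi(r) Y(Pi(r_z)^-1 a, r(z)) Pi(r)^-1 b = Y(a, z) b *)
  act_Y : forall (r : autO k) a b (N : int),
    has_sum (fun nm : nat * int =>
        lexpz r (-1 - nm.2) (N - nm.1%:Z) *:
          act r (Y (rho_z_inv (act r) r nm.1 a) nm.2 (gl_inv (act r) b)))
      (Y a (-1 - N) b)
}.

(* * Curves *)

(* An integral projective curve over the algebraically closed field k, as the
   locus in P^N of the homogeneous forms vanishing at a generic point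
   (x_0 : ... : x_N) with coordinates in the function field K; the forms
   vanishing at (x_0 : ... : x_N) generate the homogeneous prime ideal of the
   curve, and K = k(x_i / x_j) has transcendence degree 1. *)
Record curve (k : closedFieldType) := {
  ff : fieldType;
  cst : {rmorphism k -> ff};
  pdim : nat;
  gen : 'I_pdim.+1 -> ff;
  gen_neq0 : exists i, gen i != 0;
  gen_ff : forall f : ff, exists d (A B : {mpoly k[pdim.+1]}),
    [/\ A \is d.-homog, B \is d.-homog, mmap cst gen B != 0
      & f = mmap cst gen A / mmap cst gen B];
  trdeg_ge1 : exists f : ff, forall q : {poly k}, q != 0 ->
    (map_poly cst q).[f] != 0;
  trdeg_le1 : forall f : 'I_2 -> ff, exists2 q : {mpoly k[2]}, q != 0
    & mmap cst f q = 0
}.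

(* A closed point, given by its homogeneous coordinates, normalised so that
   the first nonzero one is 1. *)
Record point (k : closedFieldType) (C : curve k) := {
  pcoord :> {ffun 'I_(pdim C).+1 -> k};
  pcoord_norm : exists2 i, pcoord i = 1
    & forall j : 'I_(pdim C).+1, (j < i)%N -> pcoord j = 0;
  on_curve : forall d (A : {mpoly k[(pdim C).+1]}), A \is d.-homog ->
    mmap (cst C) (@gen _ C) A = 0 -> A.@[pcoord] = 0
}.

Section Curve.
Variables (k : closedFieldType) (C : curve k).
Implicit Types (P Q : point C) (U W : point C -> Prop) (f t : ff C).

(* The local ring O_P, as a subring of the function field. *)
Definition local_ring P f : Prop :=
  exists d (A B : {mpoly k[(pdim C).+1]}),
    [/\ A \is d.-homog, B \is d.-homog, B.@[P] != 0
      & f = mmap (cst C) (@gen _ C) A / mmap (cst C) (@gen _ C) B].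

Definition max_ideal P f : Prop :=
  exists d (A B : {mpoly k[(pdim C).+1]}),
    [/\ A \is d.-homog, B \is d.-homog, B.@[P] != 0, A.@[P] = 0
      & f = mmap (cst C) (@gen _ C) A / mmap (cst C) (@gen _ C) B].

Definition uniformizer P u : Prop :=
  max_ideal P u /\
  forall f, max_ideal P f -> exists2 g, local_ring P g & f = u * g.

(* The one-dimensional local rings O_P are regular. *)
Definition smooth : Prop := forall P, exists u, uniformizer P u.

Definition zopen U : Prop :=
  forall P, U P -> exists d (A : {mpoly k[(pdim C).+1]}),
    [/\ A \is d.-homog, A.@[P] != 0 & forall Q, A.@[Q] != 0 -> U Q].

Definition regular U f : Prop := forall Q, U Q -> local_ring Q f.

(* f lies in the n-th power of the (principal) maximal ideal of O_P *)
Definition vanishes n P f : Prop :=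
  exists u g, [/\ max_ideal P u, local_ring P g & f = u ^+ n * g].

(* A coordinate on U: t - t(Q) is a local parameter at every Q in U. *)
Definition chart U t : Prop :=
  zopen U /\ forall Q, U Q -> exists c, uniformizer Q (t - cst C c).

(* A formal coordinate at P, that is, an isomorphism from the completion of
   O_P to k[[t]], given by the expansion K -> k((t)) that it induces; [ex f n]
   is the coefficient of t^n in the expansion of f. *)
Record formal_coord P := {
  ex :> ff C -> int -> k;
  ex_add : forall f g n, ex (f + g) n = ex f n + ex g n;
  ex_cst : forall c n, ex (cst C c) n = if n == 0 then c else 0;
  ex_mul : forall f g (n : int),
    has_sum (fun i : int => ex f i * ex g (n - i)) (ex (f * g) n);
  ex_low : forall f, exists N : int, forall n, n < N -> ex f n = 0;
  ex_local : forall f, local_ring P f -> forall n, n < 0 -> ex f n = 0;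
  ex_max : forall f, max_ideal P f -> ex f 0 = 0;
  ex_param : exists2 f, max_ideal P f & ex f 1 != 0
}.

(* e' = r(e), so that the e-expansion of f is the e'-expansion composed
   with r. *)
Definition coord_change P (r : autO k) (e e' : formal_coord P) : Prop :=
  forall f, local_ring P f ->
    forall n : nat, e f n%:Z = fcomp (fun j => e' f j%:Z) r n.

(* e is the formal coordinate t - t(Q). *)
Definition coord_of Q t (e : formal_coord Q) : Prop :=
  forall n : int, n != 0 -> e t n = (n == 1)%:R.

Section Sheaf.
Variables (V : vertex_algebra k) (G : va_grading V) (Pi : autO_action G).

(* Sections of V_C (x) omega_C over U, as equivariant functions on the
   Aut O-torsor of pairs (Q, e), e a formal coordinate at Q: the fibre of the
   section at Q is [phi Q e] (x) de in the trivialisation given by e. *)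
Definition tfun := forall Q : point C, formal_coord Q -> V.

Definition equivariant U (phi : tfun) : Prop :=
  forall Q (r : autO k) (e e' : formal_coord Q), U Q -> coord_change r e e' ->
    phi Q e' = (r 1%N)^-1 *: gl_inv (Pi r) (phi Q e).

(* In the trivialisation given by t, phi is \sum_j a_j (x) f_j dt on U; note
   that e f 0 is the value f(Q). *)
Definition trivialized U t (phi : tfun) l (a : 'I_l -> V) (f : 'I_l -> ff C)
    : Prop :=
  (forall j, regular U (f j)) /\
  forall Q (e : formal_coord Q), U Q -> coord_of t e ->
    phi Q e = \sum_j e (f j) 0 *: a j.

(* Sections over U of V_C (x) omega_C(-D). *)
Definition omega_section (D : point C -> nat) U (phi : tfun) : Prop :=
  equivariant U phi /\
  forall Q, U Q -> exists U' t l (a : 'I_l -> V) (f : 'I_l -> ff C),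
    [/\ chart U' t, U' Q, (forall R, U' R -> U R),
        trivialized U' t phi a f
      & forall j R, U' R -> vanishes (D R) R (f j)].

(* phi is nabla^(n)(a (x) f dt) over U for some n > 0 and some coordinate t on
   U; the value at Q of the divided derivative of order j of f with respect
   to t is the j-th Taylor coefficient [e f j] of f in t - t(Q). *)
Definition nabla_image U (phi : tfun) : Prop :=
  equivariant U phi /\
  exists (t f : ff C) (a : V) (n : nat),
    [/\ chart U t, regular U f, (0 < n)%N
      & forall Q (e : formal_coord Q), U Q -> coord_of t e ->
          phi Q e = \sum_(i < n.+1) e f (n - i)%N%:Z *: Tdiv i a].

(* Sections over U of the sheaf Im nabla. *)
Definition im_nabla U (phi : tfun) : Prop :=
  forall R, U R -> exists U' m (psi : 'I_m -> tfun),
    [/\ zopen U', U' R, (forall Q, U' Q -> U Q),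
        (forall l, nabla_image U' (psi l))
      & forall Q (e : formal_coord Q), U' Q -> phi Q e = \sum_l psi l Q e].

(* Elements of L_X(V, D): global sections over X of the image of
   V_C (x) omega_C(-D) in the quotient sheaf (V_C (x) omega_C) / Im nabla.  Such
   a section is given by local lifts [phi Q] on neighbourhoods [W Q] of the
   points Q of X, which agree on overlaps up to Im nabla. *)
Record L_section (D : point C -> nat) (X : point C -> Prop) := {
  nbh : point C -> point C -> Prop;
  lift_at : point C -> tfun;
  nbhP : forall Q, X Q ->
    [/\ zopen (nbh Q), nbh Q Q & forall R, nbh Q R -> X R];
  lift_atP : forall Q, X Q -> omega_section D (nbh Q) (lift_at Q);
  lift_agree : forall Q Q', X Q -> X Q' ->
    im_nabla (fun R => nbh Q R /\ nbh Q' R)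
      (fun R e => @lift_at Q R e - @lift_at Q' R e)
}.

Arguments lift_at {D X} _ _ _ _.

(* The V-valued Laurent series v is the expansion at P, in the formal coordinate
   e, of the section phi over W (whose closure contains P): if
   phi = \sum_j a_j (x) f_j ds for a coordinate s on a neighbourhood U of P, and
   s - s(P) = r(e), then the points of the formal disc at P give
     v(z) = r'(z) Pi(r_z) (\sum_j f_j(z) a_j). *)
Definition expansion W (phi : tfun) P (e : formal_coord P) (v : int -> V)
    : Prop :=
  exists U s l (a : 'I_l -> V) (f : 'I_l -> ff C) (r : autO k),
    [/\ chart U s, U P,
        trivialized (fun Q => U Q /\ W Q) s phi a f,
        (forall n, (0 < n)%N -> r n = e s n%:Z)
      & forall m : int,
          has_sum (fun ln : nat * nat => \sum_j
              (fderiv r ln.1 * e (f j) (m - ln.1%:Z - ln.2%:Z)) *: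
                rho_z (Pi r) r ln.2 (a j))
            (v m)].

(* w is the image of u under the action of \sum_m v_m (x) t^m dt. *)
Definition acts (M : va_module G) (v : int -> V) (u w : M) : Prop :=
  has_sum (fun m : int => YM (v m) m u) w.

Definition punctured n (P : 'I_n -> point C) : point C -> Prop :=
  fun Q => forall i, Q <> P i.

(* The vectors sigma (u^1 (x) ... (x) u^n), for sigma in L_(C \ P)(V, D). *)
Definition L_image n (P : 'I_n -> point C) (t : forall i, formal_coord (P i))
    (D : point C -> nat) (M : 'I_n -> va_module G)
    (T : tensor_product (fun i => vm (M i))) (x : T) : Prop :=
  exists (sigma : L_section D (punctured P)) (u w : forall i, vm (M i)),
    (forall i, exists Q v,
       [/\ punctured P Q, expansion (nbh sigma Q) (lift_at sigma Q) (t i) v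
         & acts v (u i) (w i)]) /\
    x = \sum_i pure T (dfwith u (w i)).

End Sheaf.
End Curve.

(* Main.v *)
Require Import Defs.
From HB Require Import structures.
From mathcomp Require Import all_boot all_order all_algebra.
From mathcomp Require Import mpoly zify ring.
From mathcomp Require boolp classical_sets.

(* Let b range over finitely many homogeneous vectors of positive degree that
   span V modulo C_2(V) and the vacuum.  Each M^i is spanned by finitely many
   homogeneous vectors together with the images of the modes b_(m), m <= -N:
   consider words in the modes b_(m) applied to generators of degree 0.  Up to
   words of lower total weight the letters commute, so those with m <= -N can
   be moved to the left and those with m >= deg b to the generator, which they
   kill; a letter that is repeated often can be replaced, because a high power
   of b has large degree and hence lies in C_2(V).

   Conversely, b_(-n) on the i-th factor, n >> 0, is removed by an element of
   L(V, D).  Let s be a local parameter at P_i and f a function with a pole of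
   order n at P_i, regular elsewhere and vanishing to high order at the other
   P_j, on D, and at the points where b (x) ds has a pole.  The section
   b (x) f ds acts on the i-th factor by a nonzero multiple of b_(-n) plus
   operators that raise the degree less, and on the other factors
   by operators that do not raise the degree.  So M is spanned modulo
   L(V, D) M by finitely many pure tensors, by induction on the total degree.

   The functions f exist for n >> 0 by a dimension count: imposing zeros costs
   finitely many dimensions, so only finitely many pole orders at P_i are
   missed.  The count uses that a nonconstant function has a zero; the zero is
   the point defined by a subring of K maximal among those that contain the
   function but not its inverse.  That s is a coordinate outside finitely many
   points, and that its Taylor expansions depend algebraically on the point,
   follows from a separable relation F(s, x) = 0. *)

Set Implicit Arguments.
Unset Strict Implicit.
Unset Printing Implicit Defensive.

Import Order.TTheory GRing.Theory Num.Theory.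
Local Open Scope ring_scope.

(** * Gradings and subspaces *)

(** Quotients are never formed: an arbitrary subspace [S] or [Good] plays the role of the vectors
    already dealt with, and a lemma puts one more vector into it modulo smaller ones. The
    characteristic of [k] is arbitrary. Taylor coefficients are therefore not derivatives divided by
    factorials but solutions of an implicit equation, and separability of K over k(s) has to be
    proved; its source is that s has order 1 at some point. Values, residues, first-order expansions
    and truncated series are treated alike, as subalgebras of a product of two rings ([ring_rel]),
    along which polynomial identities are transported. The element of L(V, D) that acts is one
    section over all of the complement of the marked points: it is b (x) f ds where s is a
    coordinate, and zero at the finitely many bad points. Its regularity near a bad point rests on
    the algebraicity of [Pi]: in a coordinate there, b (x) ds has rational functions as
    coefficients, whose poles a high zero of f cancels. *)

Definition subspace (k : pzRingType) (W : lmodType k) (S : W -> Prop) : Prop :=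
  S 0 /\ forall c x y, S x -> S y -> S (c *: x + y).

Section Subspace.
Variables (k : pzRingType) (W : lmodType k) (S : W -> Prop).
Hypothesis hS : subspace S.

Lemma subspaceZ c x : S x -> S (c *: x).
Proof. by move=> Sx; rewrite -[_ *: _]addr0; apply: hS.2 => //; case: hS. Qed.

Lemma subspaceD x y : S x -> S y -> S (x + y).
Proof. by move=> Sx Sy; rewrite -[x]scale1r; apply: hS.2. Qed.

Lemma subspaceN x : S x -> S (- x).
Proof. by move=> Sx; rewrite -scaleN1r; apply: subspaceZ. Qed.

Lemma subspaceB x y : S x -> S y -> S (x - y).
Proof. by move=> Sx Sy; apply: subspaceD => //; apply: subspaceN. Qed.

Lemma subspace_sum I (r : seq I) (P : pred I) (F : I -> W) :
  (forall i, P i -> S (F i)) -> S (\sum_(i <- r | P i) F i).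
Proof. by move=> h; apply: big_ind => //; [case: hS | exact: subspaceD]. Qed.

Lemma subspace_congr x y : S (x - y) -> S y -> S x.
Proof. by move=> h1 h2; rewrite -[x](subrK y); apply: subspaceD. Qed.

Lemma subspace_trans x y z : S (x - y) -> S (y - z) -> S (x - z).
Proof. by move=> h1 h2; rewrite -[x - z](subrKA y); apply: subspaceD. Qed.

Lemma subspace_sym x y : S (x - y) -> S (y - x).
Proof. by move=> h; rewrite -opprB; apply: subspaceN. Qed.

Lemma has_sum_subspace (I : eqType) (u : I -> W) w :
  (forall i, S (u i)) -> has_sum u w -> S w.
Proof. by move=> h [s _ ->]; apply: subspace_sum. Qed.

Lemma has_sum_subspace1 (I : eqType) (u : I -> W) w i0 :
  (forall i, i != i0 -> S (u i)) -> has_sum u w -> S (w - u i0).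
Proof.
move=> h [s [us hs] ->]; have [i0s|ni0s] := boolP (i0 \in s).
  rewrite (bigD1_seq i0) //= addrAC subrr add0r; exact: subspace_sum.
rewrite (hs _ ni0s) subr0 big_seq; apply: subspace_sum => i /[dup] si _.
by apply: h; apply: contraNneq ni0s => <-.
Qed.

End Subspace.

Section LinearMaps.
Variables (k : pzRingType) (U W : lmodType k) (f : U -> W).
Hypothesis fP : forall c x y, f (c *: x + y) = c *: f x + f y.

Lemma lin0 : f 0 = 0.
Proof. by have /eqP := fP 1 0 0; rewrite !scale1r addr0 -subr_eq subrr => /eqP. Qed.

Lemma linZ c x : f (c *: x) = c *: f x.
Proof. by rewrite -[c *: x]addr0 fP lin0 addr0. Qed.

Lemma linD x y : f (x + y) = f x + f y.
Proof. by rewrite -[x]scale1r fP !scale1r. Qed.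

Lemma linB x y : f (x - y) = f x - f y.
Proof. by rewrite linD -scaleN1r linZ scaleN1r. Qed.

Lemma lin_sum I (r : seq I) (P : pred I) (F : I -> U) :
  f (\sum_(i <- r | P i) F i) = \sum_(i <- r | P i) f (F i).
Proof. by apply: (big_morph f) => [x y|]; [exact: linD | exact: lin0]. Qed.

Lemma has_sum_lin (I : eqType) (u : I -> U) w :
  has_sum u w -> has_sum (f \o u) (f w).
Proof.
move=> [s [us hs] ->]; exists s; last by rewrite lin_sum.
by split=> // i /hs /= ->; rewrite lin0.
Qed.

End LinearMaps.

Section Components.
Variables (k : fieldType) (W : lmodType k) (G : grading W).

Lemma gr_subspace s : subspace (G s).
Proof. by split; [exact: gr0 | exact: gr_lin]. Qed.

Lemma hom_exists w : exists mx : nat * (nat -> W),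
  (forall s, G s (mx.2 s)) /\ w = \sum_(s < mx.1) mx.2 s.
Proof. by have [m [x h]] := gr_sum G w; exists (m, x). Qed.

(** Read off from an arbitrarily chosen decomposition; directness of the sum makes the choice
    immaterial ([hom_part_uniq]). *)
Definition hom_part (s : nat) (w : W) : W :=
  let mx := sval (boolp.cid (hom_exists w)) in
  if (s < mx.1)%N then mx.2 s else 0.

Lemma hom_partP s w : G s (hom_part s w).
Proof.
rewrite /hom_part; case: boolp.cid => -[m x] /= [h _].
by case: ifP => // _; apply: gr0.
Qed.

Lemma sum_trunc (x : nat -> W) m n : (m <= n)%N ->
  \sum_(s < n) (if (s < m)%N then x s else 0) = \sum_(s < m) x s.
Proof.
move=> mn; rewrite -(big_mkord xpredT (fun s => if (s < m)%N then x s else 0)).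
rewrite (big_cat_nat (leq0n m) mn) /= -[RHS](big_mkord xpredT).
rewrite [X in _ + X]big_nat_cond [X in _ + X]big1 ?addr0; last first.
  by move=> i /=; rewrite andbT => /andP[mi _]; rewrite ltnNge mi.
by rewrite big_nat_cond [RHS]big_nat_cond; apply: eq_bigr => i /andP[/andP[_ ->]].
Qed.

Lemma hom_part_uniq m (x : nat -> W) s : (forall s, G s (x s)) ->
  hom_part s (\sum_(i < m) x i) = if (s < m)%N then x s else 0.
Proof.
move=> hx; rewrite /hom_part; case: boolp.cid => -[n y] /= [hy].
rewrite -(sum_trunc x (leq_maxl m n)) -(sum_trunc y (leq_maxr m n)) => /eqP.
rewrite -subr_eq0 -sumrB => /eqP E.
have h := @gr_direct _ _ G _ (fun s => (if (s < m)%N then x s else 0) - (if (s < n)%N then y s else 0)) _ E.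
have [sM|] := ltnP s (maxn m n); last first.
  by rewrite geq_max => /andP[ms ns]; rewrite !ltnNge ms ns.
apply/esym/eqP; rewrite -subr_eq0; apply/eqP; apply: (h _ s sM) => i.
apply: subspaceB; first exact: gr_subspace.
  by case: ifP => _ //; apply: gr0.
by case: ifP => _ //; apply: gr0.
Qed.

Lemma hom_part_sum w : exists m0, forall m, (m0 <= m)%N ->
  w = \sum_(s < m) hom_part s w.
Proof.
have [[n x] /= [hx ->]] := hom_exists w; exists n => m nm.
rewrite -(sum_trunc x nm); apply: eq_bigr => i _.
by rewrite (sum_trunc x nm) hom_part_uniq.
Qed.

Lemma hom_part_id s t w : G t w -> hom_part s w = if s == t then w else 0.
Proof.
move=> Gw; pose x i := if i == t then w else 0.
have hx i : G i (x i) by rewrite /x; case: eqP => [->|_] //; exact: gr0.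
have Ew : w = \sum_(i < t.+1) x i.
  rewrite big_ord_recr /= {2}/x eqxx big1 ?add0r // => i _.
  by rewrite /x ltn_eqF.
rewrite {1}Ew hom_part_uniq // /x ltnS.
by case: eqP => [->|_]; [rewrite leqnn | case: ifP].
Qed.

Lemma hom_part_lin s c x y :
  hom_part s (c *: x + y) = c *: hom_part s x + hom_part s y.
Proof.
have [m0 hm] := hom_part_sum x; have [n0 hn] := hom_part_sum y.
pose N := maxn s.+1 (maxn m0 n0).
rewrite {1}(hm N) /N; last by rewrite !leq_max leqnn orbT.
rewrite {1}(hn N) /N; last by rewrite !leq_max leqnn !orbT.
rewrite scaler_sumr -big_split /=.
rewrite (hom_part_uniq _ (x := fun i => c *: hom_part i x + hom_part i y)).
  by rewrite leq_max ltnS leqnn.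
by move=> i; apply: gr_lin; apply: hom_partP.
Qed.

Lemma hom_part_grz s d w : grz G d w ->
  hom_part s w = if d == s%:Z then w else 0.
Proof.
case: d => [t /(hom_part_id s) ->|n /= ->]; first by rewrite eq_sym eqz_nat.
by rewrite (hom_part_id s (gr0 G s)) eqxx.
Qed.

Lemma below_subspace p : subspace (below G p).
Proof.
split; first by exists (fun=> 0); split=> [s|]; [exact: gr0 | rewrite big1].
move=> c x y [x' [hx ->]] [y' [hy ->]].
exists (fun s => c *: x' s + y' s); split=> [s|]; first exact: gr_lin.
by rewrite big_split /= scaler_sumr.
Qed.

Lemma below_le p q w : (p <= q)%N -> below G p w -> below G q w.
Proof.
move=> pq [x [hx ->]]; exists (fun s => if (s < p)%N then x s else 0).
by split=> [s|]; [case: ifP => // _; exact: gr0 | rewrite sum_trunc].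
Qed.

Lemma gr_below p q w : G p w -> (p < q)%N -> below G q w.
Proof.
move=> Gw pq; apply: (@below_le p.+1) => //.
exists (fun s => if s == p then w else 0); split=> [s|].
  by case: eqP => [->|] // _; exact: gr0.
rewrite big_ord_recr /= eqxx big1 ?add0r // => i _; by rewrite ltn_eqF.
Qed.

Lemma below_exists w : exists p, below G p w.
Proof. by have [m [x h]] := gr_sum G w; exists m, x. Qed.

Lemma below_ind (S : W -> Prop) p : subspace S ->
  (forall s x, (s < p)%N -> G s x -> S x) -> forall w, below G p w -> S w.
Proof.
move=> hS h w [x [hx ->]]; apply: subspace_sum => // i _; exact: (h i).
Qed.

End Components.

Lemma binzN1 j : (-1 : int) ^+ j * binz (-1) j = 1.
Proof. by rewrite /binz /= add0n binn mulr1 -exprD addnn -signr_odd odd_double. Qed.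

Section ModuleModes.
Variables (k : fieldType) (V : vertex_algebra k) (G : va_grading V).

Variable M : va_module G.

Lemma YM_0l n w : YM (0 : V) n (w : M) = 0.
Proof. by apply: (lin0 (f := fun a => YM a n w)) => *; apply: YM_linl. Qed.
Lemma YM_0r a n : YM a n (0 : M) = 0.
Proof. by apply: (lin0 (f := fun b : M => YM a n b)) => *; apply: YM_linr. Qed.

(** For r = -1 all signs cancel. Every integer is the mode of [a] in exactly one summand: the
    negative ones in the first half, the others in the second. *)
Lemma YM_assocN1 a b (w : M) s :
  has_sum (fun j : nat => YM a (-1 - j%:Z) (YM b (s + j%:Z) w)
                          + YM b (s - 1 - j%:Z) (YM a j%:Z w))
    (YM (Y a (-1) b) s w).
Proof.
have [r [ur hr] e] := YM_assoc a b w (-1) s.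
have E j : ((-1) ^+ j * (binz (-1) j)%:~R) *:
          (YM a (-1 - j%:Z) (YM b (s + j%:Z) w)
           - sgnz k (-1) *: YM b (-1 + s - j%:Z) (YM a j%:Z w)) =
    YM a (-1 - j%:Z) (YM b (s + j%:Z) w) + YM b (s - 1 - j%:Z) (YM a j%:Z w).
  have -> : (-1) ^+ j * (binz (-1) j)%:~R = 1 :> k.
    have := congr1 (fun z : int => z%:~R : k) (binzN1 j).
    by rewrite rmorphM rmorphXn rmorphN1.
  by rewrite scale1r /sgnz /= expr1 scaleN1r opprK (addrC (-1) s).
exists r; last by rewrite e; apply: eq_bigr => i _; rewrite E.
by split=> // i /hr; rewrite E.
Qed.

End ModuleModes.

(** * Generators of modules *)

Section Words.
Variables (k : fieldType) (V : vertex_algebra k) (G : va_grading V).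
Variable (M : va_module G).

(** Degree, vector, mode. The degree is recorded because the zero vector has every degree. *)
Local Notation letter := (nat * V * int)%type.
Implicit Types (l : letter) (u v w : seq letter) (x y : M).

Definition wapp w x : M := foldr (fun l y => YM l.1.2 l.2 y) x w.
Definition okl l : Prop := G l.1.1 l.1.2.
Definition okw w : Prop := forall l, l \in w -> okl l.
(** Modes do not enter. Commutators and elements of C_2(V) lower this weight although they leave the
    degree of the resulting vector of [M] unchanged. *)
Definition wt w : nat := \sum_(l <- w) l.1.1.

Lemma wapp_cat u v x : wapp (u ++ v) x = wapp u (wapp v x).
Proof. by rewrite /wapp foldr_cat. Qed.

Lemma wapp_lin w c x y : wapp w (c *: x + y) = c *: wapp w x + wapp w y.
Proof. by elim: w => //= l w ->; rewrite YM_linr. Qed.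

Lemma okw_cat u v : okw (u ++ v) <-> okw u /\ okw v.
Proof.
split=> [h|[h1 h2] l]; last by rewrite mem_cat => /orP[/h1|/h2].
by split=> l lu; apply: h; rewrite mem_cat lu ?orbT.
Qed.

Lemma okw_cons l w : okw (l :: w) <-> okl l /\ okw w.
Proof.
split=> [h|[h1 h2] l']; last by rewrite inE => /orP[/eqP ->|/h2].
by split=> [|l' lw]; apply: h; rewrite inE ?eqxx ?lw ?orbT.
Qed.

Lemma okw_perm u v : perm_eq u v -> okw u -> okw v.
Proof. by move=> /perm_mem uv h l; rewrite -uv => /h. Qed.

Lemma wt_cat u v : wt (u ++ v) = (wt u + wt v)%N.
Proof. by rewrite /wt big_cat. Qed.
Lemma wt_cons l w : wt (l :: w) = (l.1.1 + wt w)%N.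
Proof. by rewrite /wt big_cons. Qed.
Lemma wt_perm u v : perm_eq u v -> wt u = wt v.
Proof. by move=> uv; apply: perm_big. Qed.

Lemma wt_rcons w l : wt (rcons w l) = (wt w + l.1.1)%N.
Proof. by rewrite -cats1 wt_cat wt_cons [wt [::]]big_nil addn0. Qed.

Lemma okw_rcons w l : okw w -> okl l -> okw (rcons w l).
Proof. by move=> h1 h2 l'; rewrite mem_rcons inE => /orP[/eqP ->|/h1]. Qed.

Variables (e : M) (he : vm_gr M 0%N e).

Lemma wapp_hom w : okw w -> exists q, vm_gr M q (wapp w e).
Proof.
elim: w => [|[[d a] m] w IH] /=; first by exists 0%N.
case/okw_cons=> okl /IH[q hq].
have := YM_gr m okl hq => /=.
by case: (_ - m) => [p|p /= ->]; [exists p | exists 0%N; exact: gr0].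
Qed.

Lemma neg_kill d a m : G d a -> d%:Z <= m -> YM a m e = 0.
Proof.
move=> Ga dm; have := YM_gr m Ga he.
by case E: (_ - m) => [p|p] //=; lia.
Qed.

Variables (S : M -> Prop) (hS : subspace S) (s : nat).
Hypothesis IH : forall w, okw w -> (wt w < s)%N -> S (wapp w e).

(** The degree is an integer since [c] will be a product a_(j) b, which is 0 when its degree is
    negative. *)
Lemma low_letter u c (d : int) m w : okw u -> okw w -> grz G d c ->
  (wt u)%:Z + d + (wt w)%:Z < s%:Z -> S (wapp u (YM c m (wapp w e))).
Proof.
move=> oku okv; case: d => [d|d] /= Gc lts; last first.
  by rewrite Gc YM_0l (lin0 (wapp_lin u)); case: hS.
have -> : wapp u (YM c m (wapp w e)) = wapp (u ++ (d, c, m) :: w) e.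
  by rewrite wapp_cat.
apply: IH; last by rewrite wt_cat wt_cons /=; lia.
by apply/okw_cat; split=> //; apply/okw_cons.
Qed.

(** The commutator is a sum of modes of a_(j) b with j >= 0, of degree d + d' - 1 - j < d + d'. *)
Lemma swap_letters u d a m d' b n w : okw u -> okw w -> G d a -> G d' b ->
  (wt u + d + d' + wt w <= s)%N ->
  S (wapp u (YM a m (YM b n (wapp w e))) - wapp u (YM b n (YM a m (wapp w e)))).
Proof.
move=> oku okv Ga Gb les; rewrite -(linB (wapp_lin u)).
apply: (has_sum_subspace hS _ (has_sum_lin (wapp_lin u) (YM_comm _ _ _ _ _))).
move=> j /=; rewrite (linZ (wapp_lin u)); apply: subspaceZ => //.
apply: low_letter => //; first exact: Y_gr Ga Gb.
lia.
Qed.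

Lemma move_front u l v : okw (u ++ l :: v) ->
  forall p, okw p -> (wt p + wt (u ++ l :: v) <= s)%N ->
  S (wapp (p ++ u ++ l :: v) e - wapp (p ++ l :: u ++ v) e).
Proof.
elim: u => [|l' u IHu] /= oku p okp les'; first by rewrite subrr; case: hS.
case/okw_cons: oku => okl' oku.
have /okw_cat[oku' /okw_cons[okl okv]] := oku.
rewrite wt_cons in les'.
have := IHu oku (rcons p l'); rewrite wt_rcons !cat_rcons => h.
have {}h := h (okw_rcons okp okl') ltac:(lia).
apply: (subspace_trans hS h).
rewrite !(wapp_cat p) /=; apply: (@swap_letters p l'.1.1 _ _ l.1.1) => //.
  by apply/okw_cat.
by move: les'; rewrite !wt_cat wt_cons; lia.
Qed.

Lemma perm_word w w' : perm_eq w w' -> okw w -> forall p, okw p ->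
  (wt p + wt w <= s)%N -> S (wapp (p ++ w) e - wapp (p ++ w') e).
Proof.
elim: w w' => [|l w IHw] w' pw okv p okp les.
  by move: pw; rewrite perm_sym => /perm_nilP ->; rewrite subrr; case: hS.
have lw' : l \in w' by rewrite -(perm_mem pw) inE eqxx.
case/okw_cons: (okv) => okl okv'.
have Ew := wt_perm pw; have okw' := okw_perm pw okv.
case/splitPr: lw' pw Ew okw' => u v pw Ew okw'.
have pw1 : perm_eq w (u ++ v).
  by rewrite -(perm_cons l) (permPl pw) -cat1s perm_catCA.
have := IHw _ pw1 okv' (rcons p l); rewrite wt_rcons !cat_rcons => h.
rewrite wt_cons in Ew les.
apply: (subspace_trans hS (h _ _)); first exact: okw_rcons.
  lia.
by apply: (subspace_sym hS); apply: move_front => //; rewrite -Ew.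
Qed.

Lemma perm_good w w' : perm_eq w w' -> okw w -> (wt w <= s)%N ->
  S (wapp w' e) -> S (wapp w e).
Proof.
move=> pw okv les; apply: subspace_congr => //.
by apply: (perm_word pw okv (p := [::])) => //; rewrite /wt big_nil.
Qed.

(** The component of degree d of C_2(V): a_(-m) b has degree p + q + m - 1. *)
Definition C2h (d : nat) (c : V) : Prop :=
  in_span (fun c => exists p a q b m, [/\ G p a, G q b, (2 <= m)%N,
    (p + q + m - 1 = d)%N & c = Y a (- m%:Z) b]) c.

(** Associativity turns a mode of a_(-m) b into two-letter words in a and b, of weight p + q = d + 1
    - m < d because m >= 2. *)
Lemma low_C2 d c u n w : okw u -> okw w -> C2h d c -> (wt u + d + wt w <= s)%N ->
  S (wapp u (YM c n (wapp w e))).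
Proof.
move=> oku okv [m [cs [x [hx ->]]]] les.
have -> : YM (\sum_i cs i *: x i) n (wapp w e) =
    \sum_i cs i *: YM (x i) n (wapp w e).
  rewrite (lin_sum (f := fun a => YM a n (wapp w e))) => [|*]; last exact: YM_linl.
  apply: eq_bigr => i _.
  by rewrite (linZ (f := fun a => YM a n (wapp w e))) => [|*]; last exact: YM_linl.
rewrite (lin_sum (wapp_lin u)); apply: (subspace_sum hS) => i _.
rewrite (linZ (wapp_lin u)); apply: (subspaceZ hS).
have [p [a [q [b [r [Ga Gb le2r Ed ->]]]]]] := hx i.
apply: (has_sum_subspace hS _ (has_sum_lin (wapp_lin u) (YM_assoc _ _ _ _ _))).
move=> j /=; rewrite (linZ (wapp_lin u)); apply: (subspaceZ hS).
rewrite (linB (wapp_lin u)) (linZ (wapp_lin u)).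
have H d1 a1 m1 d2 a2 m2 : G d1 a1 -> G d2 a2 -> (d1 + d2 < d)%N ->
    S (wapp u (YM a1 m1 (YM a2 m2 (wapp w e)))).
  move=> G1 G2 ltd.
  apply: (@low_letter u a1 d1%:Z m1 ((d2, a2, m2) :: w)) => //.
    by apply/okw_cons.
  by rewrite wt_cons /=; lia.
by apply: subspaceB => //; [|apply: (subspaceZ hS)]; [apply: (H p _ _ q)|apply: (H q _ _ p)] => //; lia.
Qed.

End Words.

(** * Words with a repeated letter *)

Section Powers.
Variables (k : fieldType) (V : vertex_algebra k) (G : va_grading V).

(** The l-th power of b for the product that makes V/C_2(V) a commutative algebra. *)
Definition npow (b : V) (l : nat) : V := iter l (fun x => Y b (-1) x) (vac V).

Lemma npow_gr d b l : G d b -> G (l * d)%N (npow b l).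
Proof.
move=> Gb; elim: l => [|l IHl]; first exact: vac_gr.
have /= := Y_gr (-1) Gb IHl.
by rewrite opprK subrK -PoszD -mulSn.
Qed.

Variables (M : va_module G) (e : M) (he : vm_gr M 0%N e).
Variables (S : M -> Prop) (hS : subspace S) (s : nat).
Hypothesis IH : forall w, okw G w -> (wt w < s)%N -> S (wapp w e).
Variables (b : V) (d : nat) (Gb : G d b) (dpos : (0 < d)%N).
Variables (d0 : nat) (C2d0 : forall c j, (d0 < j)%N -> G j c -> C2h G j c).

Local Notation bl m := ((d, b, m) : nat * V * int).

Lemma swap2 d1 a i d2 c q w : okw G w -> G d1 a -> G d2 c ->
  (d1 + d2 + wt w <= s)%N ->
  S (YM a i (YM c q (wapp w e)) - YM c q (YM a i (wapp w e))).
Proof.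
move=> okw' Ga Gc les; apply: (@swap_letters _ _ _ M e S hS s IH [::] d1 _ _ d2) => //.
by rewrite [wt [::]]big_nil add0n.
Qed.

Section PowerMode.
Variables (m : int) (rest : seq (nat * V * int)).
Hypothesis lower_good : forall m' u, m' < m -> okw G u ->
  (d + wt u + wt rest <= s)%N -> S (wapp (bl m' :: u ++ rest) e).
Hypothesis okrest : okw G rest.

(* The coefficient of [z^(-p-1)] in [b(z)^l]: its exponents [m_1,...,m_l]
   satisfy [sum (m_i + 1) = p + 1], so either all are [m] or one is [< m]. *)
Lemma npow_mode l p u : okw G u ->
  (l * d + wt u + wt rest <= s)%N ->
  (p + 1 = l%:Z * (m + 1) ->
    S (YM (npow b l) p (wapp (u ++ rest) e)
       - wapp (nseq l (bl m) ++ u ++ rest) e)) /\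
  (p + 1 < l%:Z * (m + 1) -> S (YM (npow b l) p (wapp (u ++ rest) e))).
Proof.
elim: l p u => [|l IHl] p u oku les.
  rewrite /npow /= YM_vac; split=> [h|h].
    by rewrite (_ : p == -1) ?subrr; [case: hS | lia].
  by rewrite (_ : (p == -1) = false); [case: hS | lia].
have S0 : S 0 by case: hS.
have okbu i : okw G (bl i :: u) by apply/okw_cons.
have oku' : okw G (u ++ rest) by apply/okw_cat.
have wtbu i : wt (bl i :: u) = (d + wt u)%N by rewrite wt_cons.
(* The mode i < m is moved to the front, where [lower_good] applies with the power of b as one
   letter of weight l d. *)
have T i q : (i < m -> S (YM (npow b l) q (YM b i (wapp (u ++ rest) e)))).
  move=> im.
  have h1 := @swap2 _ _ q _ _ i _ oku' (npow_gr l Gb) Gb.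
  apply: (subspace_congr hS (h1 _)); first by rewrite wt_cat; lia.
  have -> : YM b i (YM (npow b l) q (wapp (u ++ rest) e)) =
    wapp (bl i :: ([:: ((l * d)%N, npow b l, q)] ++ u) ++ rest) e by [].
  apply: lower_good => //.
    by apply/okw_cat; split=> // l'; rewrite inE => /eqP -> ; exact: npow_gr.
  by rewrite wt_cat wt_cons [wt [::]]big_nil /=; lia.
(* For i > m the remaining exponent satisfies q + 1 < l (m + 1), the strict case of the induction
   hypothesis. *)
have T2 i q : m < i -> q + i = p - 1 -> p + 1 <= l.+1%:Z * (m + 1) ->
    S (YM (npow b l) q (YM b i (wapp (u ++ rest) e))).
  move=> mi qi le; have [_] := IHl q (bl i :: u) (okbu i) ltac:(rewrite wtbu; lia).
  by apply; lia.
(* the two orders of the product, up to lower weight *)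
have T' i q : S (YM (npow b l) q (YM b i (wapp (u ++ rest) e))) ->
    S (YM b i (YM (npow b l) q (wapp (u ++ rest) e))).
  apply: (subspace_congr hS); apply: (swap2 _ _ oku' Gb (npow_gr l Gb)).
  by rewrite wt_cat; lia.
have Tall i q : p + 1 <= l.+1%:Z * (m + 1) -> q + i = p - 1 -> i != m ->
    S (YM (npow b l) q (YM b i (wapp (u ++ rest) e))).
  move=> le qi im; have [lt|gt|eq] := ltgtP i m; [exact: T|exact: T2|by rewrite eq eqxx in im].
have main : p + 1 <= l.+1%:Z * (m + 1) ->
    S (YM (npow b l.+1) p (wapp (u ++ rest) e)
       - YM (npow b l) (p - 1 - m) (YM b m (wapp (u ++ rest) e))).
  move=> le; have hs := YM_assocN1 b (npow b l) (wapp (u ++ rest) e) p.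
  (* The mode m of b occurs in one half of a single summand [j0]; which half depends on the sign of
     m. All other terms are good by [Tall]. *)
  case: (ltP m 0) => m0.
    pose j0 := `|(-1 - m)%R|%N.
    have := has_sum_subspace1 (i0 := j0) hS _ hs => h.
    apply: (subspace_trans hS (h _)) => [j jj0|].
      by apply: (subspaceD hS); [apply: T'|]; apply: Tall => //; try lia.
    rewrite /= addrAC; apply: (subspaceD hS); last by apply: Tall => //; lia.
    have -> : -1 - j0%:Z = m by lia.
    have -> : p + j0%:Z = p - 1 - m by lia.
    by apply: (swap2 _ _ oku' Gb (npow_gr l Gb)); rewrite wt_cat; lia.
  pose j0 := `|m|%N.
  have := has_sum_subspace1 (i0 := j0) hS _ hs => h.
  apply: (subspace_trans hS (h _)) => [j jj0|].
    by apply: (subspaceD hS); [apply: T'|]; apply: Tall => //; try lia.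
  have -> : j0%:Z = m by lia.
  by rewrite /= addrK; apply: T'; apply: Tall; lia.
split=> h.
  apply: (subspace_trans hS (main _)); first lia.
  have [IH1 _] := IHl (p - 1 - m) (bl m :: u) (okbu m) ltac:(rewrite wtbu; lia).
  have := IH1 ltac:(lia).
  have -> : nseq l.+1 (bl m) ++ u ++ rest = nseq l (bl m) ++ (bl m :: u) ++ rest.
    by elim: (l) => //= n' ->.
  by [].
apply: (subspace_congr hS (main _)); first lia.
have [_ IH1] := IHl (p - 1 - m) (bl m :: u) (okbu m) ltac:(rewrite wtbu; lia).
by apply: IH1; lia.
Qed.

(** The power of b with exponent d0 + 1 has degree above d0, so it lies in C_2(V) and its modes have
    lower weight. Its mode (d0 + 1)(m + 1) - 1 is the repeated letter up to good terms. *)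
Lemma power_good : (d0.+1 * d + wt rest <= s)%N ->
  S (wapp (nseq d0.+1 (bl m) ++ rest) e).
Proof.
move=> les.
have [h _] := @npow_mode d0.+1 (d0.+1%:Z * (m + 1) - 1) [::] (fun _ => ltac:(by []))
  ltac:(rewrite [wt [::]]big_nil; lia).
have {}h := h ltac:(lia).
apply: (subspace_congr hS (subspace_sym hS h)).
apply: (@low_C2 _ _ _ M e S hS s IH (d0.+1 * d)%N _ [::]) => //.
  by apply: C2d0; [rewrite leq_pmulr | exact: npow_gr].
by rewrite [wt [::]]big_nil /=; lia.
Qed.

End PowerMode.

Variable N : int.
Hypothesis big_good : forall m y q, m <= - N -> vm_gr M q y -> S (YM b m y).

(** How many copies of one b_(m), m <= -N + x, make a word good. Replacing d0 + 1 copies of the top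
    letter creates a letter of smaller mode, and x * R + 1 of these, R being the bound for x, either
    include a mode <= -N or repeat one of the x modes in between R times. The last summand makes the
    bound monotone. *)
Fixpoint rep_bound (x : nat) : nat :=
  if x is x'.+1 then (d0.+1 * (x' * rep_bound x' + 1) + rep_bound x')%N else 1%N.

Lemma rep_bound_le x y : (x <= y)%N -> (rep_bound x <= rep_bound y)%N.
Proof.
elim: y => [|y IHy]; first by rewrite leqn0 => /eqP ->.
by rewrite leq_eqVlt => /orP[/eqP ->|/IHy h] //; apply: (leq_trans h); exact: leq_addl.
Qed.

Lemma perm_nseq (T : eqType) (w : seq T) l n : (n <= count_mem l w)%N ->
  exists r, perm_eq w (nseq n l ++ r).
Proof.
elim: n => [|n IHn] h; first by exists w.
have [r pr] := IHn (ltnW h); have lr : l \in r.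
  move: h; rewrite (permP pr) count_cat count_nseq /= eqxx mul1n.
  by rewrite -addn1 leq_add2l -has_count has_pred1.
exists (rem l r); apply: (perm_trans pr); rewrite -[nseq n.+1 l]/(l :: nseq n l) cat_cons.
by rewrite (permPl (perm_cat (perm_refl _) (perm_to_rem lr))) -cat1s perm_catCA.
Qed.

Lemma count_lower (w : seq (nat * V * int)) x :
  (count [pred l : nat * V * int |
      (l.1 == (d, b)) && ((- N < l.2) && (l.2 <= - N + x%:Z))%R] w
   <= \sum_(y < x) count_mem (bl (- N + 1 + y%:Z)%R) w)%N.
Proof.
elim: w => [|[[d1 b1] m1] w IHw] /=; first by [].
rewrite big_split /=; apply: leq_add => //.
case: eqP => //= -[-> ->]; case: ltP => //= lt1; case: leP => //= lt2.
have yx : (`|(m1 + N - 1)%R|%N < x)%N by lia.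
rewrite (bigD1 (Ordinal yx)) //=.
by rewrite (_ : - N + 1 + _ = m1) ?eqxx //; lia.
Qed.

(** The outer induction is on the width x of the window of modes above -N, the inner one on the
    number of letters of lower mode still missing from [Q]. *)
Lemma repeat_good x m w : okw G w -> (wt w <= s)%N -> m <= - N + x%:Z ->
  (rep_bound x <= count_mem (bl m) w)%N -> S (wapp w e).
Proof.
have Sbig m' w' : okw G w' -> (wt w' <= s)%N -> m' <= - N -> bl m' \in w' ->
    S (wapp w' e).
  move=> okw' wtw' m'N inw'; apply: (perm_good hS IH (perm_to_rem inw')) => //=.
  have okr : okw G (rem (bl m') w') by move=> l /mem_rem /okw'.
  by have [q hq] := wapp_hom he okr; apply: big_good hq.
elim: x m w => [|x IHx] m w okw' wtw' mx.
  by rewrite /= -has_count has_pred1; apply: Sbig => //; lia.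
have [mx'|mx'] := leP m (- N + x%:Z).
  move=> h; apply: (IHx m) => //; apply: leq_trans h; exact: rep_bound_le.
move=> h; have {mx mx'} Em : m = - N + x.+1%:Z by lia.
pose low := [pred l : nat * V * int | (l.1 == (d, b)) && (l.2 <= - N + x%:Z)].
pose Q := (x * rep_bound x + 1)%N.
have {h} : (d0.+1 * (Q - count low w) <= count_mem (bl m) w)%N.
  by apply: leq_trans h => /=; rewrite -/Q; nia.
have [r] := ubnP (Q - count low w)%N.
elim: r w okw' wtw' => // r IHr w okw' wtw' ltr h.
have [Qle|Qgt] := leqP Q (count low w).
  have [/hasP[[[d1 b1] m1] lw /= /andP[/eqP[Ed1 Eb1] m1N]]|noN] :=
    boolP (has [pred l : nat * V * int | (l.1 == (d, b)) && (l.2 <= - N)] w).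
    by rewrite Ed1 Eb1 in lw; apply: (Sbig m1).
  have [/existsP[y hy]|/existsPn nex] := boolP [exists y : 'I_x,
      (rep_bound x <= count_mem (bl (- N + 1 + y%:Z)%R) w)%N].
    by apply: (IHx (- N + 1 + y%:Z)) => //; have := ltn_ord y; lia.
  have : (count low w <= x * (rep_bound x).-1)%N.
    have h2 : (\sum_(y < x) count_mem (bl (- N + 1 + y%:Z)%R) w
               <= \sum_(y < x) (rep_bound x).-1)%N.
      by apply: leq_sum => i _; have := nex i; rewrite -ltnNge; case: (rep_bound x).
    rewrite sum_nat_const card_ord in h2; apply: leq_trans h2.
    apply: leq_trans (count_lower w x); rewrite leq_eqVlt; apply/orP; left.
    apply/eqP/eq_in_count => l lw /=; case: eqP => //= El.
    by move/hasPn/(_ l lw): noN; rewrite /= El eqxx /= -ltNge => ->.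
  have : (0 < rep_bound x)%N by exact: (rep_bound_le (leq0n x)).
  by move: Qle; rewrite /Q; case: (rep_bound x) => // R; rewrite /=; nia.
have [rest pw] := @perm_nseq _ w (bl m) d0.+1 ltac:(apply: leq_trans h; nia).
apply: (perm_good hS IH pw) => //.
have := okw_perm pw okw'; rewrite okw_cat => -[okn okr].
have Ew : wt w = (d0.+1 * d + wt rest)%N.
  by rewrite (wt_perm pw) wt_cat /wt big_nseq iter_addn_0 mulnC.
have clow : count low w = count low rest.
  rewrite (permP pw) count_cat count_nseq /= eqxx /=.
  by rewrite (_ : (m <= _) = false) //; lia.
have cm : count_mem (bl m) w = (d0.+1 + count_mem (bl m) rest)%N.
  by rewrite (permP pw) count_cat count_nseq /= eqxx mul1n.
apply: power_good => //; last by rewrite -Ew.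
(* The new word has lost d0 + 1 copies of b_(m) and gained a letter of smaller mode. *)
move=> m' u m'm oku les'; apply: IHr.
- by apply/okw_cons; split=> //; apply/okw_cat.
- by rewrite wt_cons wt_cat /=; lia.
- rewrite /= eqxx /= count_cat (_ : (m' <= _) = true); last lia.
  by rewrite -clow; lia.
- rewrite /= eqxx /= !count_cat (_ : (m' <= _) = true); last lia.
  rewrite cm in h; have {}h : (d0.+1 * (Q - count low w).-1 <= count_mem (bl m) rest)%N.
    have E : (Q - count low w = (Q - count low w).-1.+1)%N by lia.
    by move: h; rewrite {1}E mulnS leq_add2l.
  rewrite [leqRHS]addnA; apply: leq_trans (leq_addl _ _); apply: (leq_trans _ h).
  by rewrite leq_mul2l -clow; apply/orP; right; lia.
Qed.

End Powers.

Section Span.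
Variables (k : fieldType) (W : lmodType k) (S : W -> Prop).

Lemma in_span_min (T : W -> Prop) x :
  subspace T -> (forall y, S y -> T y) -> in_span S x -> T x.
Proof.
move=> hT ST [m [c [y [hy ->]]]]; apply: subspace_sum => // i _.
by apply: subspaceZ => //; apply: ST.
Qed.

Lemma in_span_mem x : S x -> in_span S x.
Proof.
by move=> Sx; exists 1%N, (fun=> 1), (fun=> x); rewrite big_ord1 scale1r.
Qed.

Lemma in_span_subspace : subspace (in_span S).
Proof.
split; first by exists 0%N, (fun=> 0), (fun=> 0); split; [case | rewrite big_ord0].
move=> c x y [m [a [u [hu ->]]]] [n [b [v [hv ->]]]].
exists (m + n)%N, (fun i => match split i with inl i => c * a i | inr i => b i end),
  (fun i => match split i with inl i => u i | inr i => v i end).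
split=> [i|]; first by case: split.
rewrite big_split_ord scaler_sumr; congr (_ + _); apply: eq_bigr => i _.
  by rewrite (unsplitK (inl i)) scalerA.
by rewrite (unsplitK (inr i)).
Qed.

End Span.

(** * Reduction to finitely many words *)

Section FiniteGeneration.
Variables (k : fieldType) (V : vertex_algebra k) (G : va_grading V).
Hypothesis cft : cft_type G.
Variables (I : finType) (bd : I -> nat) (bv : I -> V) (d0 : nat).
Hypothesis bG : forall i, G (bd i) (bv i).
Hypothesis bpos : forall i, (0 < bd i)%N.
Hypothesis bdle : forall i, (bd i <= d0)%N.
Hypothesis C2d0 : forall c j, (d0 < j)%N -> G j c -> C2h G j c.
Hypothesis bspan : forall c d, (0 < d)%N -> G d c -> exists (a : I -> k) c2,
  C2h G d c2 /\ c = \sum_(i | bd i == d) a i *: bv i + c2.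
Variables (M : va_module G) (N : nat).

Local Notation bl i m := ((bd i, bv i, m) : nat * V * int).

(** Modes from -N to d0 - 1: smaller ones give good vectors, and from bd i <= d0 on they kill a
    vector of degree 0. *)
Definition mode_alphabet : seq (nat * V * int) :=
  [seq bl i (x%:Z - N%:Z) | i <- enum I, x <- iota 0 (N + d0)].

(** By the pigeonhole principle a word of this length repeats a letter often enough; N + d0 is the
    width of the window of modes. *)
Definition word_bound : nat :=
  (size mode_alphabet * rep_bound d0 (N + d0)).+1.

Fixpoint words (T : Type) (A : seq T) (n : nat) : seq (seq T) :=
  if n is n'.+1 then [seq l :: w | l <- A, w <- words A n'] else [:: [::]].

Lemma words_mem (T : eqType) (A : seq T) w :
  {subset w <= A} -> w \in words A (size w).
Proof.
elim: w => //= l w IHw h; apply: (allpairs_f cons).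
  by apply: h; rewrite inE eqxx.
by apply: IHw => x xw; apply: h; rewrite inE xw orbT.
Qed.

Lemma pigeonhole (T : eqType) (A w : seq T) R : {subset w <= A} ->
  (size A * R < size w)%N -> exists2 l, l \in A & (R <= count_mem l w)%N.
Proof.
elim: A w => [|l A IHA] w sub.
  by case: w sub => // x w /(_ x); rewrite inE eqxx => /(_ isT).
move=> lts; case: (leqP R (count_mem l w)) => [h|lt].
  by exists l; rewrite ?inE ?eqxx.
have [||l' l'A h] := IHA [seq x <- w | x != l]; last first.
- by exists l'; [rewrite inE l'A orbT | apply: leq_trans h _; rewrite count_filter; apply: sub_count => x /andP[]].
- rewrite size_filter; have E : count (fun x => x != l) w = count (predC (pred1 l)) w by exact: eq_count.
  rewrite E; have := count_predC (pred1 l) w; move: lts lt => /=.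
  by rewrite mulSn; set c := count (pred1 l) w; set c' := count _ w => *; lia.
- move=> x; rewrite mem_filter => /andP[xl /sub]; rewrite inE => /orP[/eqP xl'|//].
  by rewrite xl' eqxx in xl.
Qed.

Section OneVector.
Variables (e : M) (he : vm_gr M 0%N e) (S : M -> Prop) (hS : subspace S).
Hypothesis big_good : forall i m y q, m <= - N%:Z -> vm_gr M q y -> S (YM (bv i) m y).
Hypothesis short_good : forall n w, (n < word_bound)%N ->
  w \in words mode_alphabet n -> S (wapp w e).

(** Letters are rewritten in the generators from left to right: one of degree 0 is a multiple of the
    vacuum because V is of CFT-type, and one of positive degree is a combination of generators
    modulo C_2(V), hence modulo lower weight. *)
Lemma words_good s w : okw G w -> (wt w <= s)%N -> S (wapp w e).
Proof.
elim/ltn_ind: s w => s IHs.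
have {}IHs : forall w, okw G w -> (wt w < s)%N -> S (wapp w e).
  by move=> w okw' lt; apply: (IHs (wt w)).
pose isB (l : nat * V * int) := [exists i, l.1 == (bd i, bv i)].
have Bcase w : all isB w -> (wt w <= s)%N -> S (wapp w e).
  move=> aB wtw.
  have okw' : okw G w.
    by move=> l /(allP aB) /existsP[i /eqP E]; rewrite /okl E; exact: bG.
  case: (boolP (all (mem mode_alphabet) w)) => [/allP sub|/allPn[l lw nl]]; last first.
    have /existsP[i /eqP Ei] := allP aB l lw.
    have Hl : l = bl i l.2 by rewrite -Ei; case: (l).
    have [m1|m1] := leP l.2 (- N%:Z).
      apply: (perm_good hS IHs (perm_to_rem lw)) => //=.
      have okr : okw G (rem l w) by move=> l' /mem_rem /okw'.
      have [q hq] := wapp_hom he okr; rewrite Ei /=; exact: big_good hq.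
    have [m2|m2] := leP (bd i)%:Z l.2.
      have pw : perm_eq w (rem l w ++ [:: l]).
        by rewrite perm_sym perm_catC perm_sym; exact: perm_to_rem.
      apply: (perm_good hS IHs pw) => //.
      rewrite wapp_cat /= Ei /= (neg_kill he (bG i)) //.
      by rewrite (lin0 (wapp_lin _)); case: hS.
    case/negP: nl; rewrite Hl inE.
    have -> : l.2 = `|(l.2 + N%:Z)%R|%N%:Z - N%:Z by lia.
    apply: (allpairs_f (fun i x => bl i (x%:Z - N%:Z))).
      by rewrite mem_enum.
    by rewrite mem_iota; have := bdle i; lia.
  case: (ltnP (size w) word_bound) => [lt|ge].
    by apply: (short_good lt); apply: words_mem.
  have [l lA cl] := pigeonhole sub ge.
  have /allpairsP[[i x] /= [_ xi El]] := lA; rewrite El in cl.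
  have xi' : (x < N + d0)%N by rewrite mem_iota in xi.
  apply: (@repeat_good _ _ _ M e he S hS s IHs (bv i) (bd i) (bG i) (bpos i) d0 C2d0 N%:Z _ (N + d0)%N (x%:Z - N%:Z)) => //.
    by move=> m y q; exact: big_good.
  by lia.
move=> w okw' wtw.
suff: forall v u, all isB u -> okw G u -> okw G v -> (wt u + wt v <= s)%N ->
    S (wapp (u ++ v) e).
  by move=> /(_ w [::]); apply => //; rewrite [wt [::]]big_nil.
elim=> [|[[d a] m] v IHv] u aB oku okv les.
  by rewrite cats0; apply: Bcase => //; rewrite [wt [::]]big_nil in les; lia.
have [/= okl' okv'] : okl G (d, a, m) /\ okw G v by apply/okw_cons.
rewrite /okl /= in okl'; rewrite wt_cons /= in les.
rewrite wapp_cat /=; case: (posnP d) => [d0'|dpos].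
  rewrite d0' in okl' les; have [c ->] := (cft a).1 okl'.
  rewrite (linZ (f := fun a => YM a m (wapp v e))) => [|*]; last exact: YM_linl.
  rewrite (linZ (wapp_lin u)) YM_vac; apply: subspaceZ => //.
  case: eqP => _; last by rewrite (lin0 (wapp_lin u)); case: hS.
  by rewrite -wapp_cat; apply: IHv => //; lia.
have [al [c2 [C2c ->]]] := bspan dpos okl'.
rewrite (linD (f := fun a => YM a m (wapp v e))) => [|*]; last exact: YM_linl.
rewrite (linD (wapp_lin u)); apply: subspaceD => //; last first.
  by apply: (low_C2 hS IHs m oku okv' C2c); lia.
rewrite (lin_sum (f := fun a => YM a m (wapp v e))) => [|*]; last exact: YM_linl.
rewrite (lin_sum (wapp_lin u)); apply: (subspace_sum hS) => i /eqP bi.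
rewrite (linZ (f := fun a => YM a m (wapp v e))) => [|*]; last exact: YM_linl.
rewrite (linZ (wapp_lin u)); apply: subspaceZ => //.
have := IHv (rcons u (bl i m)); rewrite cat_rcons wapp_cat; apply => //.
- by rewrite all_rcons aB andbT; apply/existsP; exists i.
- by apply: okw_rcons => //; exact: bG.
- by rewrite wt_rcons /= bi; lia.
Qed.

End OneVector.

Lemma generated_by_words (S : M -> Prop) m (e : 'I_m -> M) :
  (forall i, vm_gr M 0%N (e i)) ->
  (forall S : M -> Prop, S 0 -> (forall c x y, S x -> S y -> S (c *: x + y)) ->
      (forall a n x, S x -> S (YM a n x)) -> (forall i, S (e i)) ->
      forall x, S x) ->
  subspace S ->
  (forall i m y q, m <= - N%:Z -> vm_gr M q y -> S (YM (bv i) m y)) ->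
  (forall i n w, (n < word_bound)%N -> w \in words mode_alphabet n ->
     S (wapp w (e i))) ->
  forall x, S x.
Proof.
move=> eG egen hS hbig hshort x.
pose T (x : M) := in_span (fun y => exists i w, okw G w /\ y = wapp w (e i)) x.
suff [n [c [y [hy ->]]]] : T x.
  apply: (subspace_sum hS) => j _; apply: subspaceZ => //.
  have [i [w [okw' ->]]] := hy j.
  exact: (words_good (eG i) hS hbig (fun n w => hshort i n w) okw' (leqnn _)).
have subT : subspace T by apply: in_span_subspace.
apply: egen; [exact: subT.1 | exact: subT.2 | | ].
  move=> a n y; apply: (in_span_min (T := fun y => T (YM a n y))) => [|{}y [i [w [okw' ->]]]].
    split=> [|c z t hz ht]; first by rewrite YM_0r; exact: subT.1.
    by rewrite YM_linr; apply: subT.2.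
  have [r hr] := hom_part_sum G a; rewrite (hr r (leqnn r)).
  rewrite (lin_sum (f := fun a => YM a n (wapp w (e i)))) => [|*]; last exact: YM_linl.
  apply: (subspace_sum subT) => j _; apply: in_span_mem.
  exists i, ((j : nat, hom_part G j a, n) :: w); split=> //.
  by apply/okw_cons; split=> //; exact: hom_partP.
by move=> i; apply: in_span_mem; exists i, [::].
Qed.

End FiniteGeneration.

(** * Homogeneous generators modulo C_2(V) *)

Section C2Generators.
Variables (k : fieldType) (V : vertex_algebra k) (G : va_grading V).

(** C_2(V) is a graded subspace, being spanned by products of homogeneous vectors. *)
Lemma C2h_hom_part d x :
  in_span (fun v : V => exists (a b : V) (m : nat), (2 <= m)%N /\ v = Y a (- m%:Z) b) x ->
  C2h G d (hom_part G d x).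
Proof.
have sC : subspace (C2h G d) by apply: in_span_subspace.
apply: (in_span_min (T := fun y => C2h G d (hom_part G d y))).
  split=> [|c y z hy hz]; last by rewrite hom_part_lin; apply: sC.2.
  by rewrite (lin0 (hom_part_lin G d)); exact: sC.1.
move=> _ [a [b [m [le2m ->]]]].
have [r hr] := hom_part_sum G a; rewrite (hr r (leqnn r)).
rewrite (lin_sum (f := fun a => Y a (- m%:Z) b)) => [|*]; last exact: Y_linl.
rewrite (lin_sum (hom_part_lin G d)); apply: (subspace_sum sC) => i _.
have [q hq] := hom_part_sum G b; rewrite (hq q (leqnn q)).
rewrite (lin_sum (f := fun b => Y _ (- m%:Z) b)) => [|*]; last exact: Y_linr.
rewrite (lin_sum (hom_part_lin G d)); apply: (subspace_sum sC) => j _.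
rewrite (hom_part_grz _ (Y_gr _ (hom_partP G i a) (hom_partP G j b))).
case: eqP => [E|_]; last exact: sC.1.
apply: in_span_mem; exists i, (hom_part G i a), j, (hom_part G j b), m.
by split=> //; [exact: hom_partP|exact: hom_partP|lia].
Qed.

(** The bound d0 is one above which the spanning vectors e_i have no components, so that V_j lies in
    C_2(V) for j > d0. The generators are the components of the e_i in degrees 1 to d0. *)
Lemma C2_generators : C2_cofinite V ->
  exists (I : finType) (bd : I -> nat) (bv : I -> V) (d0 : nat),
    [/\ forall i, G (bd i) (bv i), forall i, (0 < bd i <= d0)%N,
        forall c j, (d0 < j)%N -> G j c -> C2h G j c
      & forall c d, (0 < d)%N -> G d c -> exists (a : I -> k) c2,
          C2h G d c2 /\ c = \sum_(i | bd i == d) a i *: bv i + c2].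
Proof.
move=> [m [e he]].
have [d0 hd0] : exists d0, forall i, below G d0.+1 (e i).
  have /boolp.choice[p hp] := fun i => below_exists G (e i).
  exists (\max_i p i)%N => i; apply: below_le (hp i).
  by apply: leqW; exact: (leq_bigmax_cond (F := p)).
have e0 i d : (d0 < d)%N -> hom_part G d (e i) = 0.
  by move=> lt; have [x [hx ->]] := hd0 i; rewrite hom_part_uniq // ltnS leqNgt lt.
have decomp c d : G d c -> exists (a : 'I_m -> k) c2,
    C2h G d c2 /\ c = \sum_i a i *: hom_part G d (e i) + c2.
  move=> Gc; have [a ha] := he c; exists a, (hom_part G d (c - \sum_i a i *: e i)).
  split; first exact: C2h_hom_part.
  rewrite (linB (hom_part_lin G d)) (hom_part_id _ Gc) eqxx.
  rewrite (lin_sum (hom_part_lin G d)) addrC.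
  under [X in _ - X]eq_bigr => i _ do rewrite (linZ (hom_part_lin G d)).
  by rewrite subrK.
have C2d c j : (d0 < j)%N -> G j c -> C2h G j c.
  move=> lt /decomp[a [c2 [h ->]]]; rewrite big1 ?add0r // => i _.
  by rewrite e0 ?scaler0.
exists ('I_m * 'I_d0)%type, (fun x : 'I_m * 'I_d0 => (x.2 : nat).+1),
  (fun x : 'I_m * 'I_d0 => hom_part G (x.2 : nat).+1 (e x.1)), d0.
split=> // [i|[i j]|c d dpos Gc]; first exact: hom_partP.
  by rewrite ltnS leq0n /=; exact: ltn_ord.
have [led|gtd] := leqP d d0; last first.
  exists (fun=> 0), c; split; first exact: C2d.
  by rewrite big1 ?add0r // => i _; rewrite scale0r.
have [a [c2 [hc2 ->]]] := decomp c d Gc.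
exists (fun x => a x.1), c2; split=> //; congr (_ + _).
have dlt : (d.-1 < d0)%N by rewrite prednK.
rewrite -(pair_big_dep xpredT (fun _ (j : 'I_d0) => j.+1 == d)
  (fun i j => a i *: hom_part G j.+1 (e i))) /=.
apply: eq_bigr => i _; rewrite (big_pred1 (Ordinal dlt)) /= ?prednK // => j.
by rewrite -[in LHS](prednK dpos) eqSS; exact: (val_eqE j (Ordinal dlt)).
Qed.

End C2Generators.

(* The generators [b] of V/C_2(V) come with their degrees, and [x] ranges over
   finitely many homogeneous vectors of [M]. *)
Lemma module_generators (k : fieldType) (V : vertex_algebra k) (G : va_grading V) :
  cft_type G -> C2_cofinite V ->
  exists (I : finType) (bd : I -> nat) (bv : I -> V),
    (forall i, G (bd i) (bv i)) /\
    forall (M : va_module G), generated_in_degree0 M -> forall N : nat,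
    exists (xs : seq M), (forall x, x \in xs -> exists q, vm_gr M q x) /\
      forall S : M -> Prop, subspace S ->
        (forall i m y q, m <= - N%:Z -> vm_gr M q y -> S (YM (bv i) m y)) ->
        (forall x, x \in xs -> S x) -> forall x, S x.
Proof.
move=> cft /C2_generators-/(_ G)[I [bd [bv [d0 [bG bb C2d bspan]]]]].
exists I, bd, bv; split=> // M [m [e [eG egen]]] N.
have bpos i : (0 < bd i)%N by case/andP: (bb i).
have ble i : (bd i <= d0)%N by case/andP: (bb i).
pose ws := flatten [seq words (mode_alphabet bd bv d0 N) n
                   | n <- iota 0 (word_bound bd bv d0 N)].
exists [seq wapp (M := M) w (e i) | i <- enum 'I_m, w <- ws]; split.
  move=> x /allpairsP[[i w] /= [_ /flatten_mapP[n _ wn] ->]].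
  apply: (wapp_hom (eG i)) => l lw.
  have : l \in mode_alphabet bd bv d0 N.
    elim: n w wn lw => [|n IHn] w /=; first by rewrite inE => /eqP ->.
    case/allpairsP=> -[l' w'] /= [l'A w'n ->]; rewrite inE => /orP[/eqP ->|] //.
    exact: IHn.
  by case/allpairsP=> -[j y] /= [_ _ ->]; exact: bG.
move=> S hS hbig hxs x.
apply: (generated_by_words cft bG bpos ble C2d bspan eG egen hS hbig) => i n w nlt wn.
apply: hxs; apply: (allpairs_f (fun i w => wapp (M := M) w (e i))); first by rewrite mem_enum.
by apply/flatten_mapP; exists n => //; rewrite mem_iota.
Qed.

(** * Local rings and valuations *)

Section RingRelations.
Variables (k A B : comNzRingType) (iA : {rmorphism k -> A}) (iB : {rmorphism k -> B}).

(** That is, R is a k-subalgebra of A x B; it may be partial and multivalued. *)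
Definition ring_rel (R : A -> B -> Prop) : Prop :=
  [/\ forall c, R (iA c) (iB c),
      forall x y x' y', R x x' -> R y y' -> R (x + y) (x' + y')
    & forall x y x' y', R x x' -> R y y' -> R (x * y) (x' * y')].

Variables (R : A -> B -> Prop) (hR : ring_rel R).

Lemma ring_rel_sum I (r : seq I) (F : I -> A) (F' : I -> B) :
  (forall i, R (F i) (F' i)) -> R (\sum_(i <- r) F i) (\sum_(i <- r) F' i).
Proof.
case: hR => hc hD _ h; elim: r => [|i r IHr].
  by rewrite !big_nil -(rmorph0 iA) -(rmorph0 iB).
by rewrite !big_cons; apply: hD.
Qed.

Lemma ring_rel_prod I (r : seq I) (F : I -> A) (F' : I -> B) :
  (forall i, R (F i) (F' i)) -> R (\prod_(i <- r) F i) (\prod_(i <- r) F' i).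
Proof.
case: hR => hc _ hM h; elim: r => [|i r IHr].
  by rewrite !big_nil -(rmorph1 iA) -(rmorph1 iB).
by rewrite !big_cons; apply: hM.
Qed.

Lemma ring_relX n x x' : R x x' -> R (x ^+ n) (x' ^+ n).
Proof.
case: hR => hc _ hM h; elim: n => [|n IHn].
  by rewrite !expr0 -(rmorph1 iA) -(rmorph1 iB).
by rewrite !exprS; apply: hM.
Qed.

Lemma ring_rel_mmap n (p : {mpoly k[n]}) x x' : (forall i, R (x i) (x' i)) ->
  R (mmap iA x p) (mmap iB x' p).
Proof.
move=> h; case: (hR) => hc _ hM; apply: ring_rel_sum => m; apply: hM => //.
by rewrite /mmap1; apply: ring_rel_prod => i; apply: ring_relX.
Qed.

End RingRelations.

Section TwoVariables.
Variables (k A : comNzRingType) (iA : {rmorphism k -> A}).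
Implicit Types (F G : {poly {poly k}}) (x y : A).

Definition ev1 x : {poly k} -> A := horner_eval x \o map_poly iA.
HB.instance Definition _ x := GRing.RMorphism.on (ev1 x).

(* The value F(x, y) of [F] in k[X][Y]. *)
Definition ev2 x y : {poly {poly k}} -> A := horner_eval y \o map_poly (ev1 x).
HB.instance Definition _ x y := GRing.RMorphism.on (ev2 x y).

Lemma ev1E x p : ev1 x p = \sum_(i < size p) iA p`_i * x ^+ i.
Proof.
rewrite /ev1 /= /horner_eval (horner_coef_wide _ (size_poly _ _)).
by apply: eq_bigr => i _; rewrite coef_map.
Qed.

Lemma ev2E x y F : ev2 x y F = \sum_(j < size F) ev1 x F`_j * y ^+ j.
Proof.
rewrite /ev2 /= /horner_eval (horner_coef_wide _ (size_poly _ _)).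
by apply: eq_bigr => i _; rewrite coef_map.
Qed.

Lemma ev1C x c : ev1 x c%:P = iA c.
Proof. by rewrite /ev1 /= /horner_eval map_polyC hornerC. Qed.
Lemma ev1X x : ev1 x 'X = x.
Proof. by rewrite /ev1 /= /horner_eval map_polyX hornerX. Qed.
Lemma ev2C x y p : ev2 x y p%:P = ev1 x p.
Proof. by rewrite /ev2 /= /horner_eval map_polyC hornerC. Qed.
Lemma ev2X x y : ev2 x y 'X = y.
Proof. by rewrite /ev2 /= /horner_eval map_polyX hornerX. Qed.

End TwoVariables.

Lemma ring_rel_ev2 (k A B : comNzRingType) (iA : {rmorphism k -> A})
    (iB : {rmorphism k -> B}) R (hR : ring_rel iA iB R) F x x' y y' :
  R x x' -> R y y' -> R (ev2 iA x y F) (ev2 iB x' y' F).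
Proof.
move=> hx hy; case: (hR) => hc _ hM; rewrite !ev2E.
apply: (ring_rel_sum hR) => j; apply: (hM); last exact: (ring_relX hR).
by rewrite !ev1E; apply: (ring_rel_sum hR) => i; apply: hM => //; exact: (ring_relX hR).
Qed.

(** * Algebraic relations, local rings and values *)

Section CurveAlgebra.
Variables (k : closedFieldType) (C : curve k).
Local Notation K := (ff C).
Local Notation iota := (cst C).
Local Notation gn := (@gen _ C).
Local Notation phi := (mmap iota gn).
Implicit Types (Q : point C) (f g x y : K).

(** The relation given by the transcendence degree is rewritten in k[X][Y], where the degree and the
    derivative in Y are at hand. *)
Lemma algdep x y : exists2 F : {poly {poly k}}, F != 0 & ev2 iota x y F = 0.
Proof.
pose v : 'I_2 -> K := fun i => if i == 0 then x else y.
have [q q0 hq] := trdeg_le1 v.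
pose F : {poly {poly k}} :=
  \sum_(m <- msupp q) (q@_m *: 'X^(m 0)) *: 'X^(m 1).
exists F.
  have [m mq] : exists m, m \in msupp q.
    case E: (msupp q) => [|m r]; last by exists m; rewrite inE eqxx.
    by move/eqP: E; rewrite msupp_eq0 (negPf q0).
  have E m' : (((q@_m' *: 'X^(m' 0)) *: 'X^(m' 1) : {poly {poly k}})`_(m 1))`_(m 0)
      = if m' == m then q@_m else 0.
    rewrite coefZ coefXn; case: (m' =P m) => [->|nm].
      by rewrite eqxx mulr1 coefZ coefXn eqxx mulr1.
    case: eqP => [e1|_]; last by rewrite mulr0 coef0.
    rewrite mulr1 coefZ coefXn; case: eqP => [e0|_]; last by rewrite mulr0.
    case: nm; apply/mnmP => i; case: (unliftP 0 i) => [j ->|-> //].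
    by rewrite (ord1 j) (_ : lift 0 0 = 1) //; apply: val_inj.
  apply/eqP => F0; have : F`_(m 1)`_(m 0) = q@_m.
    rewrite /F !coef_sum (bigD1_seq m mq (msupp_uniq q)) /= E eqxx big1 ?addr0 //.
    by move=> m' /negPf nm; rewrite E nm.
  by rewrite F0 !coef0 => /esym /eqP; apply/negP; rewrite -mcoeff_msupp.
rewrite -hq /F rmorph_sum /mmap; apply: eq_bigr => m _.
rewrite -mul_polyC rmorphM rmorphXn /= ev2C ev2X -mul_polyC rmorphM rmorphXn /= ev1C ev1X.
rewrite /mmap1 big_ord_recl big_ord1 mulrA /v /=.
by congr (_ * y ^+ m _); apply: val_inj.
Qed.

(** Factors Y cancel because x is nonzero. The resulting term F_0(y) is a multiple of x over
    k[x, y], so that zeros of x force F_0(y) to vanish. *)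
Lemma alg_relation x y : x != 0 ->
  exists2 F : {poly {poly k}}, F`_0 != 0 & ev2 iota y x F = 0.
Proof.
move=> x0; have [F] := algdep y x.
elim/poly_ind: F => [|F c IHF]; first by rewrite eqxx.
have [->|c0 _ h] := eqVneq c 0; last first.
  by exists (F * 'X + c%:P) => //; rewrite coefD coefMX coefC add0r.
rewrite addr0 => FX0; rewrite rmorphM /= ev2X => /eqP.
rewrite mulf_eq0 (negPf x0) orbF => /eqP; apply: IHF.
by apply: contraNneq FX0 => ->; rewrite mul0r.
Qed.

Lemma phi_neq0 Q d (A : {mpoly k[(pdim C).+1]}) :
  A \is d.-homog -> A.@[Q] != 0 -> phi A != 0.
Proof. by move=> hA; apply: contra_neq => /(on_curve Q hA). Qed.

Lemma max_local Q f : max_ideal Q f -> local_ring Q f.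
Proof. by case=> d [A [B [hA hB nB _ ->]]]; exists d, A, B. Qed.

Lemma local_cst Q c : local_ring Q (iota c).
Proof.
exists 0%N, c%:MP, 1; split; rewrite ?mevalC ?meval1 ?oner_neq0 //.
- by rewrite -[_%:MP_[_]]mulr1 mul_mpolyC dhomogZ ?dhomog1.
- exact: dhomog1.
- by rewrite rmorph1 mmapC divr1.
Qed.

Lemma local_add Q f g : local_ring Q f -> local_ring Q g -> local_ring Q (f + g).
Proof.
move=> [d [A [B [hA hB nB ->]]]] [d' [A' [B' [hA' hB' nB' ->]]]].
have n1 := phi_neq0 hB nB; have n2 := phi_neq0 hB' nB'.
exists (d + d')%N, (A * B' + A' * B), (B * B'); split.
- by apply: rpredD; [|rewrite addnC]; exact: dhomogM.
- exact: dhomogM.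
- by rewrite rmorphM mulf_neq0.
- by rewrite rmorphD !rmorphM /=; field; rewrite n1 n2.
Qed.

Lemma local_mul Q f g : local_ring Q f -> local_ring Q g -> local_ring Q (f * g).
Proof.
move=> [d [A [B [hA hB nB ->]]]] [d' [A' [B' [hA' hB' nB' ->]]]].
have n1 := phi_neq0 hB nB; have n2 := phi_neq0 hB' nB'.
exists (d + d')%N, (A * A'), (B * B'); split; try exact: dhomogM.
- by rewrite rmorphM mulf_neq0.
- by rewrite !rmorphM /=; field; rewrite n1 n2.
Qed.

Lemma local_opp Q f : local_ring Q f -> local_ring Q (- f).
Proof.
by move=> h; rewrite -mulN1r -(rmorphN1 iota); apply: local_mul => //; exact: local_cst.
Qed.

Lemma local_exp Q f n : local_ring Q f -> local_ring Q (f ^+ n).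
Proof.
move=> h; elim: n => [|n IHn]; rewrite ?exprS; last exact: local_mul.
by rewrite expr0 -(rmorph1 iota); exact: local_cst.
Qed.

Lemma max_add Q f g : max_ideal Q f -> max_ideal Q g -> max_ideal Q (f + g).
Proof.
move=> [d [A [B [hA hB nB zA ->]]]] [d' [A' [B' [hA' hB' nB' zA' ->]]]].
have n1 := phi_neq0 hB nB; have n2 := phi_neq0 hB' nB'.
exists (d + d')%N, (A * B' + A' * B), (B * B'); split.
- by apply: rpredD; [|rewrite addnC]; exact: dhomogM.
- exact: dhomogM.
- by rewrite rmorphM mulf_neq0.
- by rewrite rmorphD !rmorphM /= zA zA' !mul0r addr0.
- by rewrite rmorphD !rmorphM /=; field; rewrite n1 n2.
Qed.

Lemma max_mul Q f g : max_ideal Q f -> local_ring Q g -> max_ideal Q (f * g).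
Proof.
move=> [d [A [B [hA hB nB zA ->]]]] [d' [A' [B' [hA' hB' nB' ->]]]].
have n1 := phi_neq0 hB nB; have n2 := phi_neq0 hB' nB'.
exists (d + d')%N, (A * A'), (B * B'); split; try exact: dhomogM.
- by rewrite rmorphM mulf_neq0.
- by rewrite rmorphM /= zA mul0r.
- by rewrite !rmorphM /=; field; rewrite n1 n2.
Qed.

Lemma max_opp Q f : max_ideal Q f -> max_ideal Q (- f).
Proof.
by move=> h; rewrite -mulrN1 -(rmorphN1 iota); apply: max_mul => //; exact: local_cst.
Qed.

Lemma max_sub Q f g : max_ideal Q f -> max_ideal Q g -> max_ideal Q (f - g).
Proof. by move=> hf hg; apply: max_add => //; exact: max_opp. Qed.

Lemma max0 Q : max_ideal Q 0.
Proof.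
exists 0%N, 0, 1; split; rewrite ?dhomog0 ?dhomog1 ?meval0 ?meval1 ?oner_neq0 //.
by rewrite rmorph0 mul0r.
Qed.

(** If 1 = A/B, the form B - A vanishes on the curve, but at Q only A does. *)
Lemma max_not1 Q : ~ max_ideal Q 1.
Proof.
move=> [d [A [B [hA hB nB zA E]]]]; have n1 := phi_neq0 hB nB.
have := @on_curve _ _ Q d (B - A) _ _; rewrite !rmorphB /= zA subr0 => h.
move/eqP: nB; apply; apply: h; first by rewrite rpredB.
apply/eqP; rewrite subr_eq0; apply/eqP.
by rewrite -[RHS](divfK n1) -E mul1r.
Qed.

Lemma max_cst Q c : max_ideal Q (iota c) -> c = 0.
Proof.
move=> h; apply/eqP/negPn/negP => c0; apply: (@max_not1 Q).
rewrite -(rmorph1 iota) -(divff c0) rmorphM; apply: max_mul => //; exact: local_cst.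
Qed.

Definition has_value Q f c := local_ring Q f /\ max_ideal Q (f - iota c).

Lemma value_exists Q f : local_ring Q f -> exists c, has_value Q f c.
Proof.
move=> h; case: (h) => d [A [B [hA hB nB E]]]; have n1 := phi_neq0 hB nB.
exists (A.@[Q] / B.@[Q]); split=> //.
exists d, (A - (A.@[Q] / B.@[Q]) *: B), B; split=> //.
- by rewrite rpredB // dhomogZ.
- by rewrite mevalB mevalZ divfK ?subrr.
- by rewrite rmorphB /= mmapZ E mulrBl mulfK.
Qed.

Lemma value_uniq Q f c c' : has_value Q f c -> has_value Q f c' -> c = c'.
Proof.
move=> [_ h] [_ h']; apply/eqP; rewrite -subr_eq0; apply/eqP; apply: (@max_cst Q).
by rewrite rmorphB; rewrite (_ : _ - _ = (f - iota c') - (f - iota c)); [exact: max_sub | ring].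
Qed.

Lemma has_value_rel Q : ring_rel iota (idfun : {rmorphism k -> k}) (has_value Q).
Proof.
split=> [c|x y x' y' [ox mx] [oy my]|x y x' y' [ox mx] [oy my]].
- by split; [exact: local_cst | rewrite subrr; exact: max0].
- split; first exact: local_add.
  by rewrite rmorphD opprD addrACA; exact: max_add.
- split; first exact: local_mul.
  have -> : x * y - iota (x' * y') = (x - iota x') * y + (y - iota y') * iota x'.
    by rewrite rmorphM; ring.
  by apply: max_add; apply: max_mul => //; exact: local_cst.
Qed.

Lemma local_inv Q f : local_ring Q f -> ~ max_ideal Q f -> f != 0 /\ local_ring Q f^-1.
Proof.
move=> [d [A [B [hA hB nB ->]]]] nm; have n1 := phi_neq0 hB nB.
have nA : A.@[Q] != 0 by apply/eqP => zA; apply: nm; exists d, A, B.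
have n2 := phi_neq0 hA nA; split; first by rewrite mulf_neq0 ?invr_neq0.
by exists d, B, A; split=> //; rewrite invf_div.
Qed.

Lemma homog_X n (i : 'I_n) : ('X_i : {mpoly k[n]}) \is 1.-homog.
Proof. by rewrite dhomogX /=; apply/eqP; exact: mdeg1. Qed.

Lemma point_coord Q : exists2 i, Q i = 1 & gn i != 0.
Proof.
have [i Qi _] := pcoord_norm Q; exists i => //.
have := @phi_neq0 Q 1 'X_i _ _; rewrite mmapX mmap1U mevalXU Qi; apply.
  exact: homog_X.
exact: oner_neq0.
Qed.

Lemma local_frac Q f : exists a b, [/\ local_ring Q a, local_ring Q b, b != 0 & f = a / b].
Proof.
have [d [A [B [hA hB nB ->]]]] := gen_ff f; have [i Qi gi] := point_coord Q.
have h : ('X_i : {mpoly k[(pdim C).+1]}) ^+ d \is d.-homog.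
  by have := dhomogMn d (homog_X i); rewrite mul1n.
have nQ : (('X_i : {mpoly k[(pdim C).+1]}) ^+ d).@[Q] != 0.
  by rewrite rmorphXn /= mevalXU Qi expr1n oner_neq0.
have nP := phi_neq0 h nQ.
exists (phi A / phi ('X_i ^+ d)), (phi B / phi ('X_i ^+ d)); split.
- by exists d, A, ('X_i ^+ d).
- by exists d, B, ('X_i ^+ d).
- by rewrite mulf_neq0 ?invr_neq0.
- by field; rewrite nP nB.
Qed.

End CurveAlgebra.

(** * Orders of functions at a point *)

Section Valuations.
Variables (k : closedFieldType) (C : curve k) (hC : smooth C).
Local Notation K := (ff C).
Local Notation iota := (cst C).
Local Notation gn := (@gen _ C).
Implicit Types (Q : point C) (f g x y : K).

Definition unif Q : K := sval (boolp.cid (hC Q)).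

Lemma unifP Q : uniformizer Q (unif Q).
Proof. by rewrite /unif; case: boolp.cid. Qed.

Lemma uniformizer_neq0 Q u : uniformizer Q u -> u != 0.
Proof.
case=> mu hu; apply/eqP => u0.
have m0 f : max_ideal Q f -> f = 0 by case/hu=> g _ ->; rewrite u0 mul0r.
have lc f : local_ring Q f -> exists c, f = iota c.
  by case/value_exists=> c [_ /m0 /eqP]; rewrite subr_eq0 => /eqP; exists c.
have [f hf] := trdeg_ge1 C.
have [a [b [/lc[c ->] /lc[c' ->] _ E]]] := local_frac Q f.
have /hf : 'X - (c / c')%:P != 0 :> {poly k} by rewrite polyXsubC_eq0.
rewrite rmorphB /= map_polyX map_polyC hornerXsubC E.
by rewrite -fmorph_div subrr eqxx.
Qed.

Lemma unif_neq0 Q : unif Q != 0.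
Proof. exact: uniformizer_neq0 (unifP Q). Qed.

Definition lunit Q f := local_ring Q f /\ ~ max_ideal Q f.

Lemma lunit_neq0 Q f : lunit Q f -> f != 0.
Proof. by case=> h nm; case: (local_inv h nm). Qed.

Lemma lunitV Q f : lunit Q f -> lunit Q f^-1.
Proof.
move=> [h nm]; have [f0 hV] := local_inv h nm; split=> // mV.
by apply: (@max_not1 _ _ Q); rewrite -(mulVf f0); apply: max_mul.
Qed.

Lemma lunitM Q f g : lunit Q f -> lunit Q g -> lunit Q (f * g).
Proof.
move=> hf hg; split; first by apply: local_mul; [case: hf|case: hg].
move=> m; case: hf => _ []; rewrite -[f](mulfK (lunit_neq0 hg)).
by apply: max_mul => //; case: (lunitV hg).
Qed.

Lemma lunit_cst Q c : c != 0 -> lunit Q (iota c).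
Proof. by move=> c0; split; [exact: local_cst | move/max_cst/eqP; apply/negP]. Qed.

(** Once the powers of X are divided out, p has a nonzero constant term and p(t) is a unit. *)
Lemma ev1_order Q t (p : {poly k}) : max_ideal Q t -> p != 0 ->
  exists2 a : nat, (p`_0 != 0 -> a = 0%N) & exists2 w, lunit Q w & ev1 iota t p = t ^+ a * w.
Proof.
move=> mt; elim/poly_ind: p => [|p c IHp]; first by rewrite eqxx.
rewrite coefD coefMX coefC add0r /= => p0.
rewrite rmorphD rmorphM /= ev1X ev1C; have [c0|c0] := eqVneq c 0; last first.
  exists 0%N => //; exists (ev1 iota t p * t + iota c); last by rewrite expr0 mul1r.
  have mp : max_ideal Q (ev1 iota t p * t).
    rewrite mulrC; apply: max_mul => //; rewrite ev1E.
    apply: (big_ind (local_ring Q)) => [|? ?|i _].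
    - by rewrite -(rmorph0 iota); exact: local_cst.
    - exact: local_add.
    - by apply: local_mul; [exact: local_cst | apply: local_exp; exact: max_local].
  split; first by apply: local_add; [exact: max_local | exact: local_cst].
  move=> m; have := max_sub m mp; rewrite addrAC subrr add0r => /max_cst.
  by apply/eqP.
rewrite c0 rmorph0 !addr0 in p0 *.
have /IHp[a _ [w hw ->]] : p != 0 by apply: contraNneq p0 => ->; rewrite mul0r.
by exists a.+1 => //; exists w => //; rewrite exprS; ring.
Qed.

Lemma transc_param Q t (p : {poly k}) : max_ideal Q t -> t != 0 -> p != 0 -> ev1 iota t p != 0.
Proof.
move=> mt t0 /(ev1_order mt)[a _ [w /lunit_neq0 w0 ->]].
by rewrite mulf_neq0 ?expf_neq0.
Qed.

(** Order at least z, and then exactly z. As relations these need no conventional order of 0: it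
    satisfies every [vge] and no [vex]. *)
Definition vge Q (z : int) f := exists2 g, local_ring Q g & f = unif Q ^ z * g.
Definition vex Q (z : int) f := exists2 g, lunit Q g & f = unif Q ^ z * g.

Lemma vge0P Q f : vge Q 0 f <-> local_ring Q f.
Proof.
by split=> [[g h ->]|h]; [rewrite expr0z mul1r | exists f; rewrite ?expr0z ?mul1r].
Qed.

Lemma vge_add Q z f g : vge Q z f -> vge Q z g -> vge Q z (f + g).
Proof.
by move=> [a ha ->] [b hb ->]; exists (a + b); [exact: local_add | rewrite mulrDr].
Qed.

Lemma vge_mul Q z z' f g : vge Q z f -> vge Q z' g -> vge Q (z + z') (f * g).
Proof.
move=> [a ha ->] [b hb ->]; exists (a * b); first exact: local_mul.
by rewrite expfzDr ?unif_neq0 // mulrACA.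
Qed.

Lemma vge_le Q z z' f : z' <= z -> vge Q z f -> vge Q z' f.
Proof.
move=> le [a ha ->]; exists (unif Q ^+ `|(z - z')%R|%N * a).
  by apply: local_mul => //; apply: local_exp; apply: max_local; case: (unifP Q).
by rewrite mulrA (exprnP (unif Q)) -expfzDr ?unif_neq0 //; congr (_ ^ _ * _); lia.
Qed.

Lemma vge_0 Q z : vge Q z 0.
Proof. by exists 0; [exact/max_local/max0 | rewrite mulr0]. Qed.

Lemma vge_cst Q c : vge Q 0 (iota c).
Proof. exact/vge0P/local_cst. Qed.

Lemma vge_sum Q z I (r : seq I) (P : pred I) (F : I -> K) :
  (forall i, P i -> vge Q z (F i)) -> vge Q z (\sum_(i <- r | P i) F i).
Proof. by move=> h; apply: big_ind => //; [exact: vge_0 | move=> ? ?; exact: vge_add]. Qed.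

Lemma vgeZ Q z c f : vge Q z f -> vge Q z (iota c * f).
Proof. by move=> h; rewrite -[z]add0r; apply: vge_mul => //; exact: vge_cst. Qed.

Lemma vgeN Q z f : vge Q z f -> vge Q z (- f).
Proof. by move=> h; rewrite -mulN1r -(rmorphN1 iota); exact: vgeZ. Qed.

Lemma vgeB Q z f g : vge Q z f -> vge Q z g -> vge Q z (f - g).
Proof. by move=> hf hg; apply: vge_add => //; exact: vgeN. Qed.

Lemma vge1P Q f : vge Q 1 f <-> max_ideal Q f.
Proof.
have [mu hu] := unifP Q; split=> [[g h ->]|/hu[g h ->]].
  by rewrite expr1z; apply: max_mul.
by exists g; rewrite ?expr1z.
Qed.

Lemma vex_vge Q z f : vex Q z f -> vge Q z f.
Proof. by case=> g [hg _] ->; exists g. Qed.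

Lemma vex_neq0 Q z f : vex Q z f -> f != 0.
Proof.
by case=> g /lunit_neq0 g0 ->; rewrite mulf_neq0 // expfz_neq0 // unif_neq0.
Qed.

Lemma vex_mul Q z z' f g : vex Q z f -> vex Q z' g -> vex Q (z + z') (f * g).
Proof.
move=> [a ha ->] [b hb ->]; exists (a * b); first exact: lunitM.
by rewrite expfzDr ?unif_neq0 // mulrACA.
Qed.

Lemma vex_inv Q z f : vex Q z f -> vex Q (- z) f^-1.
Proof.
move=> [a ha ->]; exists a^-1; first exact: lunitV.
by rewrite invfM invr_expz.
Qed.

Lemma vex_exp Q z f n : vex Q z f -> vex Q (z * n%:Z) (f ^+ n).
Proof.
move=> h; elim: n => [|n IHn].
  rewrite mulr0 expr0; exists 1; last by rewrite mulr1.
  by rewrite -(rmorph1 iota); apply: lunit_cst; exact: oner_neq0.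
by rewrite exprS intS mulrDr mulr1; exact: vex_mul.
Qed.

Lemma vge_exp Q z f n : vge Q z f -> vge Q (z * n%:Z) (f ^+ n).
Proof.
move=> h; elim: n => [|n IHn].
  by rewrite mulr0 expr0 -(rmorph1 iota); exact: vge_cst.
by rewrite exprS intS mulrDr mulr1; exact: vge_mul.
Qed.

Lemma vex_lunit Q f : lunit Q f <-> vex Q 0 f.
Proof. by split=> [h|[g h ->]]; [exists f => //|]; rewrite expr0z mul1r. Qed.

Lemma vex_unif Q : vex Q 1 (unif Q).
Proof.
exists 1; last by rewrite mulr1 expr1z.
by rewrite -(rmorph1 iota); apply: lunit_cst; exact: oner_neq0.
Qed.

Lemma vex_not Q z f : vex Q z f -> ~ vge Q (z + 1) f.
Proof.
move=> [g [hg ng] ->] [h hh E]; apply: ng; apply/vge1P; exists h => //.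
rewrite expfzDr ?unif_neq0 // -mulrA in E.
exact: (mulfI (expfz_neq0 z (unif_neq0 Q)) E).
Qed.

Lemma vex_le Q z z' f : vex Q z f -> vge Q z' f -> z' <= z.
Proof.
move=> h h'; rewrite leNgt; apply/negP => lt; apply: (vex_not h).
by apply: vge_le h'; lia.
Qed.

Lemma vex_uniq Q z z' f : vex Q z f -> vex Q z' f -> z = z'.
Proof.
by move=> h h'; apply/eqP; rewrite eq_le !(vex_le h, vex_le h') //; exact: vex_vge.
Qed.

(** A relation F(u, f) = 0 with F_0 nonzero makes F_0(u) a multiple of f, and F_0(u) has finite
    order. This replaces Krull's intersection theorem. *)
Lemma krull Q f : local_ring Q f -> f != 0 -> exists n : nat, ~ vge Q n%:Z f.
Proof.
move=> hf f0; have [F F0 hF] := alg_relation (unif Q) f0.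
have [mu _] := unifP Q.
have lF p : local_ring Q (ev1 iota (unif Q) p).
  rewrite ev1E; apply: (big_ind (local_ring Q)) => [|? ?|i _].
  - by rewrite -(rmorph0 iota); exact: local_cst.
  - exact: local_add.
  - by apply: local_mul; [exact: local_cst | apply: local_exp; exact: max_local].
have [a _ [w [hw nw] Ew]] := ev1_order mu F0.
exists a.+1 => hfa.
have Fpos : (0 < size F)%N.
  by rewrite lt0n size_poly_eq0; apply: contraNneq F0 => ->; rewrite coef0.
have : vge Q a.+1%:Z (ev1 iota (unif Q) F`_0).
  move: hF; rewrite ev2E -(prednK Fpos) big_ord_recl /= expr0 mulr1 => /eqP.
  rewrite addr_eq0 => /eqP ->; apply: vgeN; apply: vge_sum => i _.
  rewrite /bump /= add1n exprS mulrCA -[a.+1%:Z]addr0; apply: vge_mul => //.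
  by apply/vge0P; apply: local_mul => //; exact: local_exp.
have : vex Q a%:Z (ev1 iota (unif Q) F`_0) by rewrite Ew; exists w.
by move/vex_not; rewrite -addn1 PoszD.
Qed.

Lemma vex_local Q f : local_ring Q f -> f != 0 -> exists n : nat, vex Q n%:Z f.
Proof.
move=> hf f0; have [n hn] := krull hf f0.
elim: n hn => [[]|n IHn]; first exact/vge0P.
have [[g hg E]|nh] := boolp.EM (vge Q n%:Z f); last by move=> _; apply: IHn.
move=> hn; exists n, g => //; split=> // /vge1P[g' hg' Eg]; apply: hn; exists g' => //.
by rewrite E Eg mulrA -expfzDr ?unif_neq0 // -addn1 PoszD.
Qed.

Lemma vex_exists Q f : f != 0 -> exists z, vex Q z f.
Proof.
move=> f0; have [a [b [ha hb b0 E]]] := local_frac Q f.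
have a0 : a != 0 by apply: contraNneq f0 => a0; rewrite E a0 mul0r.
have [n hn] := vex_local ha a0; have [n' hn'] := vex_local hb b0.
by exists (n%:Z - n'%:Z); rewrite E; apply: vex_mul => //; exact: vex_inv.
Qed.

Lemma vge_exists Q f : exists z, vge Q z f.
Proof.
have [->|/(vex_exists Q)[z h]] := eqVneq f 0; first by exists 0; exact: vge_0.
by exists z; exact: vex_vge.
Qed.

Lemma vex_uniformizer Q u : uniformizer Q u -> vex Q 1 u.
Proof.
move=> [mu hu]; have [g hg Eg] := hu _ (proj1 (unifP Q)).
have /vge1P[h hh Eh] := mu; exists h => //; split=> // mh.
have u0 := unif_neq0 Q; rewrite expr1z in Eh.
apply: (@max_not1 _ _ Q); rewrite (_ : 1 = h * g); first exact: max_mul.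
by apply: (mulfI u0); rewrite mulr1 mulrA -Eh.
Qed.

Lemma uniformizerP Q u : uniformizer Q u <-> vex Q 1 u.
Proof.
split; first exact: vex_uniformizer.
move=> [h hh E]; rewrite expr1z in E; have [mu hu] := unifP Q.
split; first by rewrite E; apply: max_mul => //; case: hh.
move=> f /hu[g hg ->]; exists (h^-1 * g).
  by apply: local_mul => //; case: (lunitV hh).
by rewrite E; field; exact: lunit_neq0 hh.
Qed.

Lemma vge_vanishes Q (n : nat) f : vge Q n%:Z f -> vanishes n Q f.
Proof. by case=> g hg E; exists (unif Q), g; split=> //; case: (unifP Q). Qed.

End Valuations.

Lemma mmap_homog_scale n (R : comNzRingType) (S : comNzRingType) (f : {rmorphism R -> S})
    (h : 'I_n -> S) (l : S) d (A : {mpoly R[n]}) : A \is d.-homog ->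
  mmap f (fun i => h i * l) A = mmap f h A * l ^+ d.
Proof.
move=> /dhomogP hA; rewrite /mmap mulr_suml !big_seq; apply: eq_bigr => m mA.
rewrite -mulrA; congr (_ * _); rewrite /mmap1.
under eq_bigr => i _ do rewrite exprMn.
rewrite big_split /=; congr (_ * _); rewrite prodrXr.
by rewrite -mdegE (hA m mA).
Qed.

Lemma closed_infinite (k : closedFieldType) (s : seq k) : exists c, c \notin s.
Proof.
case: s => [|a s]; first by exists 0.
pose p := \prod_(z <- a :: s) ('X - z%:P) + 1.
have [c p0] : exists c, root p c.
  apply/closed_rootP; rewrite /p size_polyDl size_prod_XsubC //=.
  by rewrite size_poly1.
exists c; apply/negP => cs; move/rootP: p0; rewrite hornerD hornerC.
have /rootP -> : root (\prod_(z <- a :: s) ('X - z%:P)) c by rewrite root_prod_XsubC.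
by rewrite add0r => /eqP; rewrite oner_eq0.
Qed.

Lemma poly_roots_list (k : closedFieldType) (p : {poly k}) :
  exists s : seq k, p = lead_coef p *: \prod_(z <- s) ('X - z%:P).
Proof. by have [s E] := closed_field_poly_normal p; exists s. Qed.

(** * Cofinite sets of points *)

Section Points.
Variables (k : closedFieldType) (C : curve k).
Local Notation K := (ff C).
Local Notation iota := (cst C).
Local Notation gn := (@gen _ C).
Local Notation phi := (mmap iota gn).

Lemma pcoord_inj : injective (@pcoord k C).
Proof.
move=> [x hx ox] [y hy oy] /= E; case: y / E hy oy => hy oy.
by f_equal; exact: boolp.Prop_irrelevance.
Qed.

HB.instance Definition _ := Equality.copy (point C) (inj_type pcoord_inj).

Implicit Types (Q : point C) (f g x y : K) (U : point C -> Prop).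

Definition almost U := exists s : seq (point C), forall Q, Q \notin s -> U Q.

Lemma almost_and U U' : almost U -> almost U' -> almost (fun Q => U Q /\ U' Q).
Proof.
move=> [s hs] [s' hs']; exists (s ++ s') => Q; rewrite mem_cat negb_or => /andP[h h'].
by split; [exact: hs | exact: hs'].
Qed.

Lemma almost_impl U U' : (forall Q, U Q -> U' Q) -> almost U -> almost U'.
Proof. by move=> h [s hs]; exists s => Q /hs /h. Qed.

Lemma almost_true U : (forall Q, U Q) -> almost U.
Proof. by move=> h; exists [::]. Qed.

Lemma almost_ord n (U : 'I_n -> point C -> Prop) : (forall i, almost (U i)) ->
  almost (fun Q => forall i, U i Q).
Proof.
move=> /boolp.choice[s hs]; exists (flatten [seq s i | i <- enum 'I_n]) => Q nQ i.
apply: (hs i); apply: contraNN nQ => Qs; apply/flatten_mapP; exists i => //.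
by rewrite mem_enum.
Qed.

Lemma points_of_coords (L : seq {ffun 'I_(pdim C).+1 -> k}) :
  exists s : seq (point C), forall Q, pcoord Q \in L -> Q \in s.
Proof.
elim: L => [|a L [s hs]]; first by exists [::].
have [[Q0 E]|nE] := boolp.EM (exists Q0 : point C, pcoord Q0 = a).
  exists (Q0 :: s) => Q; rewrite !inE -E => /orP[/eqP/pcoord_inj ->|/hs ->].
    by rewrite eqxx.
  by rewrite orbT.
exists s => Q; rewrite inE => /orP[/eqP E|/hs //]; by case: nE; exists Q.
Qed.

(** If all 2 x 2 minors vanish, the coordinate vectors are proportional, and the normalisation makes
    them equal. *)
Lemma linear_separation P Q : P <> Q -> exists l : {mpoly k[(pdim C).+1]},
  [/\ l \is 1.-homog, l.@[Q] = 0 & l.@[P] != 0].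
Proof.
move=> PQ; have [/existsP[i /existsP[j nz]]|] :=
    boolP [exists i, exists j, P i * Q j - P j * Q i != 0].
  exists (Q j *: 'X_i - Q i *: 'X_j); split.
  - by rewrite rpredB // dhomogZ // homog_X.
  - by rewrite mevalB !mevalZ !mevalXU mulrC subrr.
  - by rewrite mevalB !mevalZ !mevalXU mulrC [Q i * _]mulrC.
rewrite negb_exists => /forallP h.
have {}h i j : P i * Q j = P j * Q i.
  have := h i; rewrite negb_exists => /forallP/(_ j)/negPn.
  by rewrite subr_eq0 => /eqP.
case: PQ; apply: pcoord_inj; apply/ffunP => j.
have [i0 Pi0 hi0] := pcoord_norm P; have [i1 Qi1 hi1] := pcoord_norm Q.
have Ej j' : P j' = P i1 * Q j' by rewrite h Qi1 mulr1.
have Pi1 : P i1 != 0.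
  by apply/eqP => z; move: (Ej i0); rewrite z mul0r Pi0 => /eqP; rewrite oner_eq0.
have E01 : i0 = i1.
  apply/val_inj/eqP; rewrite eqn_leq; apply/andP; split; rewrite leqNgt; apply/negP => lt.
    by rewrite (hi0 _ lt) eqxx in Pi1.
  by move: (Ej i0); rewrite Pi0 (hi1 _ lt) mulr0 => /eqP; rewrite oner_eq0.
by rewrite Ej -E01 Pi0 mul1r.
Qed.

(** The excluded points other than P are cut off by a product of linear forms that do not vanish at
    P. *)
Lemma almost_zopen U : almost U -> zopen U.
Proof.
move=> [s hs] P UP.
have /boolp.choice[l hl] : forall Q, exists l : {mpoly k[(pdim C).+1]},
    P <> Q -> [/\ l \is 1.-homog, l.@[Q] = 0 & l.@[P] != 0].
  move=> Q; have [->|/linear_separation[l h]] := boolp.EM (P = Q).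
    by exists 0.
  by exists l.
pose A := \prod_(Q <- [seq Q <- s | Q != P]) l Q.
exists (size [seq Q <- s | Q != P]), A; split.
- rewrite /A; elim: s {hs A} => [|Q s IHs] /=; first by rewrite big_nil dhomog1.
  case: eqP => //= QP; rewrite big_cons.
  by have [h _ _] := hl Q (fun E => QP (esym E)); exact: dhomogM h IHs.
- rewrite /A rmorph_prod prodf_seq_neq0 /=; apply/allP => Q.
  rewrite mem_filter => /andP[/eqP QP _]; by case: (hl Q (fun E => QP (esym E))).
- move=> Q; have [Qs|/hs //] := boolP (Q \in s).
  have [-> //|QP] := eqVneq Q P.
  have Qs' : Q \in [seq Q <- s | Q != P] by rewrite mem_filter QP.
  rewrite /A rmorph_prod prodf_seq_neq0 /= => /allP/(_ Q Qs').
  by have [_ -> _] := hl Q (fun E => negP QP (introT eqP (esym E))); rewrite eqxx.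
Qed.

Lemma value_coord Q i j : Q i = 1 -> has_value Q (gn j / gn i) (Q j).
Proof.
move=> Qi; have X1 (j' : 'I_(pdim C).+1) := homog_X k j'.
split.
  exists 1%N, 'X_j, 'X_i; split=> //; first by rewrite mevalXU Qi oner_neq0.
  by rewrite !mmapX !mmap1U.
have gi : gn i != 0.
  by have := @phi_neq0 _ _ Q 1 'X_i (X1 i); rewrite mmapX mmap1U mevalXU Qi oner_neq0 => ->.
exists 1%N, ('X_j - Q j *: 'X_i), 'X_i; split=> //.
- by rewrite rpredB // dhomogZ.
- by rewrite mevalXU Qi oner_neq0.
- by rewrite mevalB mevalZ !mevalXU Qi mulr1 subrr.
- by rewrite rmorphB /= mmapZ !mmapX !mmap1U mulrBl mulfK.
Qed.

Lemma ev2_id0 (F : {poly {poly k}}) (y : k) :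
  ev2 (idfun : {rmorphism k -> k}) y 0 F = (F`_0).[y].
Proof.
rewrite /ev2 /= /horner_eval horner_coef0 coef_map /= /ev1 /= /horner_eval.
by rewrite map_poly_id.
Qed.

(** Where x_i = 1, a relation F(x_j / x_i, A / x_i^d) = 0 with F_0 nonzero becomes F_0(x_j) = 0 at a
    zero of A. So the coordinates of the zeros take finitely many values. *)
Lemma form_zeros_finite d (A : {mpoly k[(pdim C).+1]}) : A \is d.-homog ->
  phi A != 0 -> almost (fun Q => A.@[Q] != 0).
Proof.
move=> hA A0.
have /boolp.choice[r hr] : forall ij : 'I_(pdim C).+1 * 'I_(pdim C).+1,
    exists r : seq k, forall Q, A.@[Q] = 0 -> Q ij.1 = 1 -> Q ij.2 \in r.
  move=> -[i j] /=.
  have [gi|gi] := eqVneq (gn i) 0.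
    exists [::] => Q _ Qi; have := @phi_neq0 _ _ Q 1 'X_i (homog_X k i).
    by rewrite mmapX mmap1U mevalXU Qi oner_neq0 gi eqxx => /(_ isT).
  have g0 : phi A / gn i ^+ d != 0 by rewrite mulf_neq0 // invr_neq0 // expf_neq0.
  have [F F0 hF] := alg_relation (gn j / gn i) g0.
  have [s hs] := poly_roots_list F`_0; exists s => Q AQ Qi.
  have hy := value_coord j Qi.
  have hg : has_value Q (phi A / gn i ^+ d) 0.
    have hm : max_ideal Q (phi A / gn i ^+ d).
      exists d, A, ('X_i ^+ d); split=> //.
      - by have := dhomogMn d (homog_X k i); rewrite mul1n.
      - by rewrite rmorphXn /= mevalXU Qi expr1n oner_neq0.
      - by rewrite rmorphXn /= mmapX mmap1U.
    by split; [exact: max_local | rewrite rmorph0 subr0].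
  have := ring_rel_ev2 (has_value_rel Q) F hy hg; rewrite hF ev2_id0 => h0.
  have /(value_uniq h0)/eqP : has_value Q (0 : K) 0.
    by rewrite -(rmorph0 iota); split; [exact: local_cst | rewrite subrr; exact: max0].
  rewrite hs hornerZ mulf_eq0 lead_coef_eq0 (negPf F0) /= -/(root _ _).
  by rewrite root_prod_XsubC.
pose s := flatten [seq r ij | ij <- enum {: 'I_(pdim C).+1 * 'I_(pdim C).+1}].
pose L := [seq [ffun i => val (f i)] | f : {ffun 'I_(pdim C).+1 -> seq_sub s}].
have [t ht] := points_of_coords L; exists t => Q; apply: contraNneq => AQ.
apply: ht; have [i Qi _] := pcoord_norm Q.
have Qs j : Q j \in s.
  by apply/flatten_mapP; exists (i, j); [rewrite mem_enum | exact: (hr (i, j))].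
apply/imageP; exists [ffun j => SeqSub (Qs j)] => //.
by apply/ffunP => j; rewrite !ffunE.
Qed.

Lemma almost_lunit f : f != 0 -> almost (fun Q => lunit Q f).
Proof.
move=> f0; have [d [A [B [hA hB nB E]]]] := gen_ff f.
have nA : phi A != 0 by apply: contraNneq f0 => z; rewrite E z mul0r.
apply: almost_impl (almost_and (form_zeros_finite hA nA) (form_zeros_finite hB nB)).
move=> Q [AQ BQ]; split; first by exists d, A, B.
move=> m; have : local_ring Q f^-1 by exists d, B, A; rewrite E invf_div.
by move/(max_mul m); rewrite mulfV // => /max_not1.
Qed.

Lemma almost_local f : almost (fun Q => local_ring Q f).
Proof.
have [->|/almost_lunit] := eqVneq f 0.
  by apply: almost_true => Q; apply: max_local; exact: max0.
by apply: almost_impl => Q [].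
Qed.

End Points.

Lemma exprV_sub (F : fieldType) (x : F) m n : x != 0 -> (n <= m)%N ->
  x^-1 ^+ n * x ^+ m = x ^+ (m - n).
Proof.
move=> x0 le; rewrite -{1}(subnK le) exprD mulrCA exprVn mulVf ?mulr1 //.
by rewrite expf_neq0.
Qed.

(** * Zeros of nonconstant functions *)

Section Places.
Variables (k : closedFieldType) (C : curve k).
Local Notation K := (ff C).
Local Notation iota := (cst C).
Local Notation gn := (@gen _ C).
Local Notation phi := (mmap iota gn).
Implicit Types (x y f : K) (p q : {poly K}).

Lemma nonconstant_transc h (p : {poly k}) : (forall c, h <> iota c) -> p != 0 ->
  ev1 iota h p != 0.
Proof.
move=> hc p0; have [s Es] := poly_roots_list p.
rewrite Es -mul_polyC rmorphM /= ev1C mulf_neq0 //.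
  by rewrite fmorph_eq0 lead_coef_eq0.
rewrite rmorph_prod prodf_seq_neq0; apply/allP => z _ /=.
by rewrite rmorphB /= ev1X ev1C subr_eq0; apply/eqP.
Qed.

Section Maximal.
Variables (h : K) (hc : forall c, h <> iota c).

Lemma h_neq0 : h != 0.
Proof. by apply/eqP => h0; apply: (hc (c := 0)); rewrite rmorph0. Qed.

Definition subring_of (R : K -> Prop) : Prop :=
  [/\ forall c, R (iota c), forall x y, R x -> R y -> R (x + y),
      forall x y, R x -> R y -> R (x * y), R h & ~ R h^-1].

Lemma max_subring : exists R, subring_of R /\
  forall R', subring_of R' -> (forall x, R x -> R' x) -> forall x, R' x -> R x.
Proof.
pose R0 x := exists p : {poly k}, x = ev1 iota h p.
have hR0 : subring_of R0.
  split.
  - by move=> c; exists c%:P; rewrite ev1C.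
  - by move=> _ _ [p ->] [q ->]; exists (p + q); rewrite rmorphD.
  - by move=> _ _ [p ->] [q ->]; exists (p * q); rewrite rmorphM.
  - by exists 'X; rewrite ev1X.
  - move=> [p E]; have : p * 'X - 1 != 0.
      apply/eqP => /(congr1 (fun r : {poly k} => r`_0)).
      by rewrite coefB coefMX coef1 coef0 sub0r => /eqP; rewrite oppr_eq0 oner_eq0.
    move/(nonconstant_transc hc); rewrite rmorphB rmorphM /= ev1X -E rmorph1.
    by rewrite mulVf ?h_neq0 // subrr eqxx.
(* the empty set is allowed so that the union of the empty chain is *)
pose P (R : K -> Prop) := (forall x, ~ R x) \/ subring_of R.
have [F hF chain|A [PA maxA]] := @classical_sets.Zorn_bigcup K P.
  have [[R FR [cR aR mR iR nR]]|nex] :=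
      boolp.EM (exists2 R, F R & subring_of R); last first.
    left=> x [R FR Rx]; have [hE|sR] := hF R FR; first exact: (hE x).
    by apply: nex; exists R.
  right.
  have dir x y : (exists2 R, F R & R x) -> (exists2 R, F R & R y) ->
      exists2 R, F R & subring_of R /\ R x /\ R y.
    move=> [R1 F1 R1x] [R2 F2 R2y].
    have s1 : subring_of R1 by case: (hF R1 F1) => // /(_ x).
    have s2 : subring_of R2 by case: (hF R2 F2) => // /(_ y).
    by have [s12|s21] := chain R1 R2 F1 F2; [exists R2 | exists R1] => //;
       split=> //; split=> //; [apply: s12 | apply: s21].
  split.
  - by move=> c; exists R.
  - by move=> x y hx hy; have [R' F' [[_ D _ _ _] [? ?]]] := dir x y hx hy; exists R' => //; apply: D.
  - by move=> x y hx hy; have [R' F' [[_ _ D _ _] [? ?]]] := dir x y hx hy; exists R' => //; apply: D.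
  - by exists R.
  - by move=> [R' F' R'h]; case: (hF R' F') => [/(_ _ R'h)|[_ _ _ _ /(_ R'h)]].
have sA : subring_of A.
  case: PA => // eA; case: (maxA R0); last by right.
  split=> [x /eA //|/(_ h)]; case: hR0 => _ _ _ i _ /(_ i); exact: eA.
exists A; split=> // R' sR' AR' x R'x; apply: boolp.contrapT => nAx.
by apply: (maxA R'); [split=> // /(_ x R'x) | right].
Qed.

Variables (R : K -> Prop) (sR : subring_of R).
Hypothesis maxR : forall R', subring_of R' -> (forall x, R x -> R' x) ->
  forall x, R' x -> R x.

Let Rc c : R (iota c). Proof. by case: sR. Qed.
Let RD x y : R x -> R y -> R (x + y). Proof. by case: sR => _ D *; exact: D. Qed.
Let RM x y : R x -> R y -> R (x * y). Proof. by case: sR => _ _ D *; exact: D. Qed.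
Let Rh : R h. Proof. by case: sR. Qed.
Let nRhV : ~ R h^-1. Proof. by case: sR. Qed.
Let R0 : R 0. Proof. by rewrite -(rmorph0 iota). Qed.
Let R1 : R 1. Proof. by rewrite -(rmorph1 iota). Qed.
Let RN x : R x -> R (- x).
Proof. by move=> Rx; rewrite -mulN1r -(rmorphN1 iota); apply: RM. Qed.
Let RB x y : R x -> R y -> R (x - y). Proof. by move=> *; apply: RD => //; apply: RN. Qed.
Let RX x n : R x -> R (x ^+ n).
Proof. by move=> Rx; elim: n => [|n IHn]; rewrite ?exprS //; apply: RM. Qed.
Let Rsum I (r : seq I) (P : pred I) (F : I -> K) :
  (forall i, P i -> R (F i)) -> R (\sum_(i <- r | P i) F i).
Proof. by move=> hF; apply: (big_ind R). Qed.

Definition polyR p := forall i, R p`_i.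

(** By maximality R[x] must contain h^-1. *)
Lemma adjoin x : ~ R x -> exists2 p, polyR p & h * p.[x] = 1.
Proof.
move=> nRx; apply: boolp.contrapT => nex; apply: nRx.
pose R' y := exists2 p, polyR p & y = p.[x].
apply: (maxR (R' := R')).
- split.
  + by move=> c; exists (iota c)%:P; rewrite ?hornerC // => i; rewrite coefC; case: ifP.
  + by move=> _ _ [p hp ->] [q hq ->]; exists (p + q); rewrite ?hornerD // => i; rewrite coefD; apply: RD.
  + move=> _ _ [p hp ->] [q hq ->]; exists (p * q); rewrite ?hornerM // => i.
    by rewrite coefM; apply: Rsum => j _; apply: RM.
  + by exists h%:P; rewrite ?hornerC // => i; rewrite coefC; case: ifP.
  + by move=> [p hp E]; apply: nex; exists p; rewrite // -E divff ?h_neq0.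
- by move=> y Ry; exists y%:P; rewrite ?hornerC // => i; rewrite coefC; case: ifP.
- by exists 'X; rewrite ?hornerX // => i; rewrite coefX; case: (_ == _).
Qed.

(** This puts h into the Jacobson radical. If y = 1 - h b had no inverse in R, then h^-1 = p(y^-1);
    multiplied by a power of y, which is 1 modulo h, this would place h^-1 in R. *)
Lemma one_sub_unit b : R b -> 1 - h * b != 0 /\ R (1 - h * b)^-1.
Proof.
move=> Rb; have y0 : 1 - h * b != 0.
  rewrite subr_eq0; apply/eqP => E; apply: nRhV.
  by rewrite -[h^-1]mulr1 E mulKf ?h_neq0.
split=> //; apply: boolp.contrapT => /adjoin[p hp E]; apply: nRhV.
set y := 1 - h * b in y0 E.
have pow n : exists2 b', R b' & y ^+ n = 1 - h * b'.
  elim: n => [|n [b' Rb' En]]; first by exists 0; rewrite // mulr0 subr0.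
  exists (b + b' * y); last by rewrite exprSr En /y; ring.
  by apply: RD => //; apply: RM => //; apply: RB => //; apply: RM.
have [b' Rb' Eb'] := pow (size p).
have Ry : R y by apply: RB => //; apply: RM.
have E2 : y ^+ size p * p.[y^-1] = \sum_(i < size p) p`_i * y ^+ (size p - i).
  rewrite horner_coef mulr_sumr; apply: eq_bigr => i _.
  by rewrite mulrCA [_ ^+ size p * _]mulrC exprV_sub // ltnW.
have E3 : h * (b' + \sum_(i < size p) p`_i * y ^+ (size p - i)) = 1.
  have -> : \sum_(i < size p) p`_i * y ^+ (size p - i) = (1 - h * b') * h^-1.
    by rewrite -E2 Eb' -[h^-1]mulr1 -E mulKf ?h_neq0.
  by field; exact: h_neq0.
have -> : h^-1 = b' + \sum_(i < size p) p`_i * y ^+ (size p - i).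
  by rewrite -[LHS]mulr1 -E3 mulKf ?h_neq0.
by apply: RD => //; apply: Rsum => i _; apply: RM => //; apply: RX.
Qed.

(** With the degree of q at most that of p, the relation for x^-1, divided by the unit 1 - h q_0,
    expresses x^m through lower powers of x. Substituting it removes the leading term of p, so the
    total size drops. *)
Lemma val_aux n x p q : x != 0 -> polyR p -> polyR q ->
  h * p.[x] = 1 -> h * q.[x^-1] = 1 -> (size p + size q <= n)%N -> False.
Proof.
elim: n x p q => [|n IHn] x p q x0 hp hq Ep Eq les.
  have : size p = 0%N by lia.
  move=> /eqP; rewrite size_poly_eq0 => /eqP E; move: Ep; rewrite E horner0 mulr0.
  by move=> /eqP; rewrite eq_sym oner_eq0.
wlog lqp : x p q x0 hp hq Ep Eq les / (size q <= size p)%N.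
  move=> W; have [le|le] := leqP (size q) (size p); first exact: (W x p q).
  apply: (W x^-1 q p); rewrite ?invr_eq0 ?invrK //; last exact: ltnW.
  by rewrite addnC.
have [v0 Rv] := one_sub_unit (hq 0%N).
set v := (1 - h * q`_0)^-1 in Rv.
case Ep' : (size p) => [|m].
  move/eqP: Ep'; rewrite size_poly_eq0 => /eqP E; move: Ep; rewrite E horner0 mulr0.
  by move=> /eqP; rewrite eq_sym oner_eq0.
have sq : (size q <= m.+1)%N by rewrite -Ep'.
have sp : (size p <= m.+1)%N by rewrite Ep'.
pose c := p`_m * h * v.
pose p' := \poly_(i < m) (p`_i + c * q`_(m - i)).
have size_p' : (size p' <= m)%N by exact: size_poly.
apply: (IHn x p' q x0 _ hq _ Eq).
- move=> i; rewrite coef_poly; case: ifP => // _; apply: RD => //.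
  by apply: RM => //; apply: RM => //; apply: RM.
- have Eq1 : \sum_(i < m) q`_(m - i) * x ^+ i = (q.[x^-1] - q`_0) * x ^+ m.
    rewrite (horner_coef_wide _ sq) big_ord_recl expr0 mulr1.
    rewrite addrAC subrr add0r mulr_suml (reindex_inj rev_ord_inj) /=.
    apply: eq_bigr => i _; have lt := ltn_ord i.
    have -> : (m - (m - i.+1) = bump 0 i)%N by rewrite /bump; lia.
    rewrite -mulrA exprV_sub //.
  have Ev : (q.[x^-1] - q`_0) * (h * v) = 1.
    by rewrite mulrA mulrBl [q.[_] * h]mulrC Eq [q`_0 * h]mulrC mulfV.
  rewrite -Ep; congr (_ * _).
  rewrite (horner_coef_wide _ size_p') (horner_coef_wide _ sp).
  rewrite big_ord_recr /=.
  transitivity (\sum_(i < m) (p`_i * x ^+ i + c * (q`_(m - i) * x ^+ i))).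
    by apply: eq_bigr => i _; rewrite coef_poly ltn_ord mulrDl mulrA.
  rewrite big_split /= -mulr_sumr Eq1; congr (_ + _).
  by rewrite -[RHS]mulr1 -Ev /c; ring.
- by move: les; rewrite Ep'; lia.
Qed.

Lemma valuation_ring x : x != 0 -> R x \/ R x^-1.
Proof.
move=> x0; apply: boolp.contrapT => /boolp.not_orP[/adjoin[p hp Ep] /adjoin[q hq Eq]].
exact: (val_aux x0 hp hq Ep Eq (leqnn _)).
Qed.

Definition mR x := R x /\ (x != 0 -> ~ R x^-1).

Let mRD x y : mR x -> mR y -> mR (x + y).
Proof.
suff W x' y' : x' != 0 -> y' != 0 -> R (y' / x') -> mR x' -> mR y' -> mR (x' + y').
  move=> hx hy; have [->|x0] := eqVneq x 0; first by rewrite add0r.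
  have [->|y0] := eqVneq y 0; first by rewrite addr0.
  have [r|r] := valuation_ring (x := y / x) ltac:(by rewrite mulf_neq0 ?invr_eq0).
    exact: W.
  by rewrite addrC; apply: W => //; rewrite invf_div in r.
move=> x0 y0 r [Rx nx] [Ry ny]; split; first exact: RD.
move=> s0 Rs; apply: (nx x0).
have -> : x'^-1 = (1 + y' / x') * (x' + y')^-1 by field; rewrite s0 x0.
by apply: RM => //; apply: RD.
Qed.

Let mRM x y : mR x -> R y -> mR (x * y).
Proof.
move=> [Rx nx] Ry; split; first exact: RM.
rewrite mulf_eq0 negb_or => /andP[x0 y0] r; apply: (nx x0).
by rewrite (_ : x^-1 = y * (x * y)^-1); [apply: RM | field; rewrite x0 y0].
Qed.

Let mR0 : mR 0. Proof. by split=> //; rewrite eqxx. Qed.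

Let mRh : mR h. Proof. by split=> // _. Qed.

Let mR_cst c : mR (iota c) -> c = 0.
Proof.
move=> [_ n]; apply/eqP/negPn/negP => c0; apply: n; first by rewrite fmorph_eq0.
by rewrite -fmorphV.
Qed.

Lemma not_mR_unit x : R x -> ~ mR x -> x != 0 /\ R x^-1.
Proof.
move=> Rx nm; have x0 : x != 0 by apply/eqP => x0; apply: nm; rewrite x0.
by split=> //; apply: boolp.contrapT => n; apply: nm; split.
Qed.

Definition residue x c := R x /\ mR (x - iota c).

Lemma residue_rel : ring_rel iota (idfun : {rmorphism k -> k}) residue.
Proof.
split=> [c|x y x' y' [Rx mx] [Ry my]|x y x' y' [Rx mx] [Ry my]].
- by split; rewrite // subrr.
- by split; [exact: RD | rewrite rmorphD opprD addrACA; exact: mRD].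
- split; first exact: RM.
  have -> : x * y - iota (x' * y') = (x - iota x') * y + (y - iota y') * iota x'.
    by rewrite rmorphM; ring.
  by apply: mRD; apply: mRM.
Qed.

Lemma residue_neq0 x c : residue x c -> c != 0 -> x != 0 /\ R x^-1.
Proof.
move=> [Rx mx] c0; apply: not_mR_unit => // m; case/eqP: c0; apply: mR_cst.
have -> : iota c = x + (x - iota c) * (-1) by ring.
by apply: mRD => //; apply: mRM => //; apply: RN.
Qed.

(** The residue field is k: a relation F(x, h) = 0 with F_0 nonzero puts F_0(x) into the maximal
    ideal, and F_0 splits over k, so some factor x - z is not a unit. *)
Lemma residue_exists x : R x -> exists c, residue x c.
Proof.
move=> Rx; have [F F0 hF] := alg_relation x h_neq0.
have RF (p : {poly k}) : R (ev1 iota x p).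
  by rewrite ev1E; apply: Rsum => i _; apply: RM => //; apply: RX.
have m0 : mR (ev1 iota x F`_0).
  have Fpos : (0 < size F)%N.
    by rewrite lt0n size_poly_eq0; apply: contraNneq F0 => ->; rewrite coef0.
  move: hF; rewrite ev2E -(prednK Fpos) big_ord_recl /= expr0 mulr1 => /eqP.
  rewrite addr_eq0 => /eqP ->; rewrite -mulrN1; apply: mRM; last exact: RN.
  apply: (big_ind mR) => // i _; rewrite /bump /= add1n exprS mulrCA.
  by apply: mRM => //; apply: RM => //; apply: RX.
have [s Es] := poly_roots_list F`_0; rewrite Es -mul_polyC rmorphM /= ev1C in m0.
apply: boolp.contrapT => nex.
have : R (iota (lead_coef F`_0) * ev1 iota x (\prod_(z <- s) ('X - z%:P)))^-1 /\
    iota (lead_coef F`_0) * ev1 iota x (\prod_(z <- s) ('X - z%:P)) != 0.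
  rewrite invfM mulf_eq0 negb_or fmorph_eq0 lead_coef_eq0 F0 -fmorphV.
  rewrite rmorph_prod; elim: s {Es m0} => [|z s [IHs n0]]; first by rewrite big_nil invr1 mulr1 oner_neq0.
  have [z0 Rz] : x - iota z != 0 /\ R (x - iota z)^-1.
    apply: not_mR_unit; first exact: RB.
    by move=> m; apply: nex; exists z.
  rewrite big_cons rmorphB /= ev1X ev1C mulf_eq0 negb_or z0 invfM mulrCA; split=> //.
  exact: RM.
by case=> r n; case: m0 => _ /(_ n).
Qed.

(** The index i is that of a homogeneous coordinate of least value for the valuation ring R. *)
Lemma coord_pole : exists2 i, gn i != 0 & forall j, R (gn j / gn i).
Proof.
suff [i gi hi] : exists2 i, gn i != 0 & forall j, j \in enum 'I_(pdim C).+1 -> R (gn j / gn i).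
  by exists i => // j; apply: hi; rewrite mem_enum.
elim: (enum _) => [|l s [i gi hi]]; first by have [i gi] := gen_neq0 C; exists i.
have [gl|gl] := eqVneq (gn l) 0.
  by exists i => // j; rewrite inE => /orP[/eqP ->|/hi //]; rewrite gl mul0r.
have [r|r] := valuation_ring (x := gn l / gn i) ltac:(by rewrite mulf_neq0 ?invr_eq0).
  by exists i => // j; rewrite inE => /orP[/eqP ->|/hi].
exists l => // j; rewrite inE => /orP[/eqP ->|/hi hj]; first by rewrite divff.
rewrite (_ : gn j / gn l = gn j / gn i * (gn l / gn i)^-1); first exact: RM.
by field; rewrite gl gi.
Qed.

(** The residues of the x_j / x_i0 are homogeneous coordinates of the centre of R; [i1] is the first
    nonzero one, used to normalise them. *)
Lemma place_center : exists Q : point C, forall f, local_ring Q f -> R f.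
Proof.
have [i0 g0 hi0] := coord_pole.
have /boolp.choice[c hc'] : forall j, exists c, residue (gn j / gn i0) c.
  by move=> j; apply: residue_exists.
have form d (A : {mpoly k[(pdim C).+1]}) : A \is d.-homog ->
    residue (phi A / gn i0 ^+ d) A.@[c].
  move=> hA; rewrite -exprVn -(mmap_homog_scale _ _ _ hA).
  exact: (ring_rel_mmap residue_rel).
have c0 : c i0 = 1.
  have := hc' i0; rewrite divff // => -[_].
  by rewrite -(rmorph1 iota) -rmorphB => /mR_cst/eqP; rewrite subr_eq0 => /eqP.
have ex : exists j, (fun n => [exists j : 'I_(pdim C).+1, (j == n :> nat) && (c j != 0)]) j.
  by exists i0; apply/existsP; exists i0; rewrite eqxx c0 oner_neq0.
have [_ /existsP[i1 /andP[/eqP <- c1]] min] := ex_minnP ex.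
have scale d (A : {mpoly k[(pdim C).+1]}) : A \is d.-homog ->
    A.@[[ffun j => c j * (c i1)^-1]] = A.@[c] * (c i1)^-1 ^+ d.
  move=> hA; rewrite /meval -(mmap_homog_scale _ _ _ hA).
  by congr (mmap _ _ A); apply: boolp.funext => j; rewrite ffunE.
have hnorm : exists2 i, [ffun j => c j * (c i1)^-1] i = 1 &
    forall j : 'I_(pdim C).+1, (j < i)%N -> [ffun j => c j * (c i1)^-1] j = 0.
  exists i1; first by rewrite ffunE mulfV.
  move=> j lt; rewrite ffunE; apply/eqP; rewrite mulf_eq0; apply/orP; left.
  apply: contraTT lt => cj; rewrite -leqNgt; apply: min; apply/existsP; exists j.
  by rewrite eqxx.
have hon d (A : {mpoly k[(pdim C).+1]}) : A \is d.-homog -> phi A = 0 ->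
    A.@[[ffun j => c j * (c i1)^-1]] = 0.
  move=> hA A0; rewrite (scale d) //; have := form d A hA; rewrite A0 mul0r => -[_].
  by rewrite sub0r -rmorphN => /mR_cst/eqP; rewrite oppr_eq0 => /eqP ->; rewrite mul0r.
exists (Build_point hnorm hon) => f [d [A [B [hA hB nB ->]]]].
rewrite /= (scale d) // in nB.
have nBc : B.@[c] != 0 by apply: contraNneq nB => ->; rewrite mul0r.
have [b0 rb] := residue_neq0 (form d B hB) nBc.
have [ra _] := form d A hA.
have g0d : gn i0 ^+ d != 0 by rewrite expf_neq0.
have pB : phi B != 0 by apply: contraNneq b0 => ->; rewrite mul0r.
rewrite (_ : phi A / phi B = phi A / gn i0 ^+ d * (phi B / gn i0 ^+ d)^-1); first exact: RM.
by field; rewrite pB g0d.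
Qed.

End Maximal.

(** If h had order at most 0 at the centre Q of R, its inverse would lie in the local ring of Q and
    so in R. *)
Theorem nonconstant_zero (hC : smooth C) h : (forall c, h <> iota c) ->
  exists Q : point C, max_ideal Q h.
Proof.
move=> hc; have [R [sR maxR]] := max_subring hc.
have [Q hQ] := place_center hc sR maxR; exists Q.
have h0 := h_neq0 hc; have [z hz] := vex_exists hC Q h0.
have [zpos|zneg] := ltP 0 z.
  by apply/(vge1P hC); apply: vge_le (vex_vge hz); lia.
case: sR => _ _ _ _ []; apply: hQ; apply/(vge0P hC).
by apply: vge_le (vex_vge (vex_inv hz)); lia.
Qed.

Lemma nonconstant_exists : exists h : K, forall c, h <> iota c.
Proof.
have [f hf] := trdeg_ge1 C; exists f => c E; move: (hf ('X - c%:P)).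
by rewrite polyXsubC_eq0 rmorphB /= map_polyX map_polyC hornerXsubC E subrr eqxx => /(_ isT).
Qed.

Lemma regular_constant (hC : smooth C) f : (forall Q : point C, local_ring Q f) ->
  exists c, f = iota c.
Proof.
move=> hf; apply: boolp.contrapT => nex.
have nc c : f <> iota c by move=> E; apply: nex; exists c.
have f0 := h_neq0 nc; have [c E|Q m] := nonconstant_zero hC (h := f^-1).
  by apply: (nc c^-1); rewrite fmorphV -E invrK.
by apply: (@max_not1 _ _ Q); rewrite -(mulVf f0); apply: max_mul.
Qed.

(** Each h - c has a zero, and a point is a zero of at most one of these functions. *)
Lemma point_avoiding (hC : smooth C) (s : seq (point C)) : exists Q : point C, Q \notin s.
Proof.
have [h hc] := nonconstant_exists.
have /boolp.choice[v hv] : forall Q : point C, exists c, forall c', max_ideal Q (h - iota c') -> c' = c.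
  move=> Q; have [[c hQ]|n] := boolp.EM (exists c, max_ideal Q (h - iota c)); last first.
    by exists 0 => c' hc'; case: n; exists c'.
  exists c => c' hc'; apply/eqP; rewrite -subr_eq0; apply/eqP; apply: (@max_cst _ _ Q).
  rewrite (_ : iota _ = (h - iota c) - (h - iota c')); [exact: max_sub | rewrite rmorphB; ring].
have [c cs] := closed_infinite [seq v Q | Q <- s].
have [c' E|Q mQ] := nonconstant_zero hC (h := h - iota c).
  by apply: (hc (c' + c)); rewrite rmorphD -E subrK.
by exists Q; apply: contraNN cs => Qs; rewrite (hv Q c mQ); exact: map_f.
Qed.

End Places.

(** * Functions with prescribed poles *)

Section Riemann.
Variables (k : closedFieldType) (C : curve k) (hC : smooth C).
Local Notation K := (ff C).
Local Notation iota := (cst C).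
Implicit Types (P Q : point C) (f g x y : K) (W : K -> Prop).
Local Notation vge := (vge hC).
Local Notation vex := (vex hC).

Definition indep (I : finType) (x : I -> K) : Prop :=
  forall c : I -> k, \sum_i iota (c i) * x i = 0 -> forall i, c i = 0.

Definition dim_ge W n := exists2 x : 'I_n -> K, (forall i, W (x i)) & indep x.

(** Intersecting W with W' costs at most one dimension. *)
Definition codim1 W W' := forall f g, W f -> W g ->
  W' g \/ exists c, W' (f - iota c * g).

Lemma dim_ge_fin W (I : finType) (x : I -> K) :
  (forall i, W (x i)) -> indep x -> dim_ge W #|I|.
Proof.
move=> hW hx; exists (x \o enum_val) => [i|c]; first exact: hW.
rewrite (reindex enum_rank) /=; last exact/onW_bij/enum_rank_bij.
move=> E j; have := hx (c \o enum_rank) _ (enum_val j); rewrite /= enum_valK; apply.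
by rewrite -[RHS]E; apply: eq_bigr => i _; rewrite enum_rankK.
Qed.

Lemma dim_ge_impl W W' n : (forall f, W f -> W' f) -> dim_ge W n -> dim_ge W' n.
Proof. by move=> h [x hx ix]; exists x => // i; exact: h. Qed.

Lemma dim_ge_codim1 W W' n : codim1 W W' -> dim_ge W n.+1 -> dim_ge W' n.
Proof.
move=> cd [x hx ix].
have [[i0 ni0]|all] := boolp.EM (exists i, ~ W' (x i)); last first.
  exists (x \o lift ord0) => [i|c E i].
    by apply: boolp.contrapT => ni; apply: all; exists (lift ord0 i).
  have := ix (fun j => oapp c 0 (unlift ord0 j)) _ (lift ord0 i).
  rewrite liftK /=; apply; rewrite big_ord_recl unlift_none rmorph0 mul0r add0r.
  by rewrite -[RHS]E; apply: eq_bigr => j _; rewrite liftK.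
have /boolp.choice[d hd] : forall j, exists c, W' (x (lift i0 j) - iota c * x i0).
  by move=> j; have [|//] := cd (x (lift i0 j)) (x i0) (hx _) (hx _).
exists (fun j => x (lift i0 j) - iota (d j) * x i0) => [//|c E i].
have := ix (fun j => oapp c (- \sum_j c j * d j) (unlift i0 j)) _ (lift i0 i).
rewrite liftK /=; apply; rewrite (bigD1_ord i0) //= unlift_none /=.
rewrite [X in _ + X](eq_bigr (fun j => iota (c j) * x (lift i0 j))); last first.
  by move=> j _; rewrite liftK.
rewrite -[RHS]E rmorphN rmorph_sum /= mulNr mulr_suml addrC -sumrB.
by apply: eq_bigr => j _; rewrite rmorphM; ring.
Qed.

Lemma dim_ge_le W n m : (n <= m)%N -> dim_ge W m -> dim_ge W n.
Proof.
move/subnKC <-; elim: (m - n)%N => [|r IHr]; first by rewrite addn0.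
by rewrite addnS => h; apply: IHr; apply: dim_ge_codim1 h => f g hf hg; left.
Qed.

Definition Lsp (b : point C -> int) f : Prop := forall Q, vge Q (b Q) f.

Definition upd (b : point C -> int) Q0 (z : int) Q := if Q == Q0 then z else b Q.

Lemma vge_codim1 Q z f g : vge Q z f -> vge Q z g ->
  vge Q (z + 1) g \/ exists c, vge Q (z + 1) (f - iota c * g).
Proof.
move=> [f' hf ->] [g' hg ->]; have u0 := unif_neq0 hC Q.
have [a [_ ha]] := value_exists hf; have [b [_ hb]] := value_exists hg.
have lift' h : max_ideal Q h -> vge Q (z + 1) (unif hC Q ^ z * h).
  by move/(vge1P hC); apply: vge_mul; exists 1; rewrite ?mulr1 // -(rmorph1 iota); exact: local_cst.
have [b0|b0] := eqVneq b 0.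
  by left; apply: lift'; rewrite b0 rmorph0 subr0 in hb.
right; exists (a / b).
have -> : unif hC Q ^ z * f' - iota (a / b) * (unif hC Q ^ z * g') =
    unif hC Q ^ z * ((f' - iota a) - (g' - iota b) * iota (a / b)).
  rewrite (_ : iota a = iota b * iota (a / b)); first by ring.
  by rewrite -rmorphM mulrC divfK.
by apply: lift'; apply: max_sub => //; apply: max_mul => //; exact: local_cst.
Qed.

Lemma Lsp_codim1 b Q0 : codim1 (Lsp b) (Lsp (upd b Q0 (b Q0 + 1))).
Proof.
move=> f g hf hg; have [h|[c h]] := vge_codim1 (hf Q0) (hg Q0).
  by left=> Q; rewrite /upd; case: eqP => [->|].
right; exists c => Q; rewrite /upd; case: eqP => [-> //|_].
by apply: vgeB => //; apply: vgeZ.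
Qed.

Lemma Lsp_raise b Q0 n r : dim_ge (Lsp b) (n + r) ->
  dim_ge (Lsp (upd b Q0 (b Q0 + r%:Z))) n.
Proof.
elim: r b => [|r IHr] b h.
  rewrite addn0 in h; apply: dim_ge_impl h => f hf Q.
  by rewrite /upd addr0; case: eqP => [->|].
rewrite addnS in h; have := IHr _ (dim_ge_codim1 (@Lsp_codim1 b Q0) h).
apply: dim_ge_impl => f hf Q; have := hf Q; rewrite /upd eqxx.
by case: eqP => // _; apply: vge_le; lia.
Qed.

Lemma Lsp_raise_seq (s : seq (point C)) (r : point C -> nat) b n : uniq s ->
  dim_ge (Lsp b) (n + \sum_(Q <- s) r Q) ->
  dim_ge (Lsp (fun Q => if Q \in s then b Q + (r Q)%:Z else b Q)) n.
Proof.
elim: s b n => [|Q0 s IHs] b n /=; first by rewrite big_nil addn0.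
case/andP=> nQ0 us; rewrite big_cons addnA => h.
have := Lsp_raise Q0 (IHs b _ us h); apply: dim_ge_impl => f hf Q.
have := hf Q; rewrite /upd inE (negPf nQ0); case: eqP => [->|] //=.
Qed.

(** The form A_Q vanishes at the points of s other than Q. It is divided by the sum of all A_Q1, a
    form of the same degree with no zero in s. *)
Lemma separating_function (s : seq (point C)) Q : uniq s -> Q \in s ->
  exists g, lunit Q g /\ forall Q', Q' \in s -> Q' != Q -> max_ideal Q' g.
Proof.
move=> us Qs.
have /boolp.choice[l hl] : forall QQ : point C * point C, exists l : {mpoly k[(pdim C).+1]},
    QQ.1 <> QQ.2 -> [/\ l \is 1.-homog, l.@[QQ.2] = 0 & l.@[QQ.1] != 0].
  move=> [Q1 Q2] /=; have [->|/linear_separation[l h]] := boolp.EM (Q1 = Q2).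
    by exists 0.
  by exists l.
pose A Q1 := \prod_(Q2 <- [seq Q2 <- s | Q2 != Q1]) l (Q1, Q2).
have Ah Q1 : Q1 \in s -> A Q1 \is (size s).-1.-homog.
  move=> Q1s; have -> : (size s).-1 = size [seq Q2 <- s | Q2 != Q1].
    rewrite size_filter -(count_predC (pred1 Q1) s) count_uniq_mem // Q1s add1n.
    exact: eq_count.
  rewrite /A; move: {us Qs Q1s A} s; elim=> [|Q2 s' IHs] /=; first by rewrite big_nil dhomog1.
  case: eqP => //= QP; rewrite big_cons.
  have [h _ _] := hl (Q1, Q2) (fun E => QP (esym E)); exact: dhomogM h IHs.
have An Q1 : (A Q1).@[Q1] != 0.
  rewrite /A rmorph_prod prodf_seq_neq0 /=; apply/allP => Q2.
  by rewrite mem_filter => /andP[/eqP QP _]; case: (hl (Q1, Q2) (fun E => QP (esym E))).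
have Az Q1 Q2 : Q2 \in s -> Q2 != Q1 -> (A Q1).@[Q2] = 0.
  move=> Q2s Q21; apply/eqP; rewrite /A rmorph_prod /= prodf_seq_eq0.
  apply/hasP; exists Q2; first by rewrite mem_filter Q21.
  have /hl[_ /= -> _] : (Q1, Q2).1 <> (Q1, Q2).2; last by rewrite eqxx.
  by move=> /= E; rewrite E eqxx in Q21.
pose B := \sum_(Q1 <- s) A Q1.
have Bh : B \is (size s).-1.-homog.
  by rewrite /B big_seq; apply: rpred_sum => Q1; exact: Ah.
have Bn Q1 : Q1 \in s -> B.@[Q1] != 0.
  move=> Q1s; rewrite /B rmorph_sum /= (bigD1_seq Q1) //= big_seq_cond big1 ?addr0 //.
  by move=> Q2 /andP[Q2s Q21]; rewrite Az // eq_sym.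
exists (mmap iota (@gen _ C) (A Q) / mmap iota (@gen _ C) B); split.
  split; first by exists (size s).-1, (A Q), B; split=> //; [exact: Ah | exact: Bn].
  move=> m; have nB := phi_neq0 Bh (Bn Q Qs); have nA := phi_neq0 (Ah Q Qs) (An Q).
  have : local_ring Q (mmap iota (@gen _ C) B / mmap iota (@gen _ C) (A Q)).
    by exists (size s).-1, B, (A Q); split=> //; exact: Ah.
  by move/(max_mul m); rewrite mulrA divfK // divff // => /max_not1.
move=> Q' Q's Q'Q; exists (size s).-1, (A Q), B; split=> //; [exact: Ah|exact: Bn|exact: Az].
Qed.

Lemma weak_approximation (s : seq (point C)) Q (j E : nat) : uniq s -> Q \in s ->
  exists g, vex Q j%:Z g /\ forall Q', Q' \in s -> Q' != Q -> vge Q' E%:Z g.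
Proof.
move=> us Qs; have [g [ug hg]] := separating_function us Qs.
have /boolp.choice[z hz] : forall Q', exists z, vge Q' z (unif hC Q ^+ j).
  by move=> Q'; exact: vge_exists.
(* E zeros at each other point, and enough more to cancel the pole of the power of the local
   parameter there. *)
pose N := (E + \sum_(Q' <- s) `|z Q'|)%N.
exists (g ^+ N * unif hC Q ^+ j); split.
  have := vex_mul (vex_exp N (proj1 (vex_lunit hC Q g) ug)) (vex_exp j (vex_unif hC Q)).
  by rewrite mul0r add0r mul1r.
move=> Q' Q's Q'Q; have /(vge1P hC)/(vge_exp N) := hg Q' Q's Q'Q.
move/(vge_mul)/(_ (hz Q')); apply: vge_le; rewrite mul1r.
have : (`|z Q'| <= \sum_(Q' <- s) `|z Q'|)%N by rewrite (bigD1_seq Q') //= leq_addr.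
by rewrite /N; lia.
Qed.

Lemma finite_of_count (p : pred nat) c :
  (forall m, (count p (seq.iota 0 m) <= c)%N) -> exists N, forall n, (N <= n)%N -> ~~ p n.
Proof.
move=> hc; apply: boolp.contrapT => nex.
have inf N : exists2 n, (N <= n)%N & p n.
  apply: boolp.contrapT => n; apply: nex; exists N => m Nm; apply/negP => pm.
  by apply: n; exists m.
have [m] : exists m, (c < count p (seq.iota 0 m))%N; last by rewrite ltnNge hc.
elim: (c) => [|c' [m hm]].
  have [n _ pn] := inf 0%N; exists n.+1; rewrite -has_count; apply/hasP; exists n => //.
  by rewrite mem_iota /= add0n.
have [n mn pn] := inf m; exists n.+1.
rewrite -[n.+1]addn1 iotaD count_cat /= add0n pn addn0 addn1 ltnS.
by rewrite -(subnKC mn) iotaD count_cat; apply: leq_trans hm _; exact: leq_addr.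
Qed.

Section PoleFunctions.
Variables (P : point C) (bad : seq (point C)) (Kv : nat).
Local Notation tau := (unif hC P).

Definition attained (n : nat) : bool := boolp.asbool (exists f,
  [/\ vex P (- n%:Z) f, forall Q, Q != P -> vge Q 0 f
    & forall Q, Q \in bad -> Q != P -> vge Q Kv%:Z f]).

Variables (S : seq (point C)).
Hypothesis badS : {subset bad <= S}.

Definition level (z : int) f := vge P z f /\
  forall Q, Q != P -> vge Q (if Q \in S then Kv%:Z else 0) f.

Lemma level_codim1 z : codim1 (level z) (level (z + 1)).
Proof.
move=> f g [hf hf'] [hg hg']; have [h|[c h]] := vge_codim1 hf hg; first by left.
by right; exists c; split=> // Q QP; apply: vgeB; [exact: hf' | apply: vgeZ; exact: hg'].
Qed.

Lemma level_gap (n : nat) f : ~~ attained n -> level (- n%:Z) f -> level (- n%:Z + 1) f.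
Proof.
move=> /boolp.asboolP ng [hf hf']; split=> //.
have [->|f0] := eqVneq f 0; first exact: vge_0.
have [z hz] := vex_exists hC P f0; have le := vex_le hz hf.
have [E|ne] := eqVneq z (- n%:Z); last by apply: vge_le (vex_vge hz); lia.
case: ng; exists f; split=> [|Q QP|Q Qb QP]; first by rewrite -E.
  by apply: vge_le (hf' Q QP); case: ifP.
by have := hf' Q QP; rewrite (badS Qb).
Qed.

(** From level -n to level 1 at most one dimension is lost at each attained pole order and none at
    the others. As level 1 is trivial, dimensions bound the number of attained orders from below. *)
Lemma level_chain n (x : nat) : dim_ge (level (- n%:Z)) (x + count attained (seq.iota 0 n.+1)) ->
  dim_ge (level 1) x.
Proof.
have step m (y : nat) : dim_ge (level (- m%:Z)) (y + attained m) -> dim_ge (level (- m%:Z + 1)) y.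
  have [am|nam] := boolP (attained m).
    by rewrite addn1; apply: dim_ge_codim1; exact: level_codim1.
  by rewrite addn0; apply: dim_ge_impl => f; exact: level_gap.
elim: n x => [|n IHn] x; first by rewrite /= addn0 => /step; rewrite oppr0 add0r.
rewrite -[n.+2]addn1 iotaD count_cat /= addn0 addnA => /step h; apply: IHn.
by apply: dim_ge_impl h => f [h1 h2]; split=> //; apply: vge_le h1; lia.
Qed.

Lemma level1_trivial : ~ dim_ge (level 1) 1.
Proof.
move=> [x hx ix]; have [h1 h2] := hx ord0.
have [c E] : exists c, x ord0 = iota c.
  apply: (regular_constant hC) => Q; apply/(vge0P hC).
  have [->|QP] := eqVneq Q P; first by apply: vge_le h1.
  by apply: vge_le (h2 Q QP); case: ifP.
have := ix (fun=> 1) _ ord0; rewrite big_ord1 E.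
have -> : c = 0 by apply: (@max_cst _ _ P); rewrite -E; apply/(vge1P hC).
by rewrite rmorph0 mulr0 => /(_ erefl)/eqP; rewrite oner_eq0.
Qed.

End PoleFunctions.

(** Let t be a local parameter at P, e(Q) the orders of its zeros and M their sum. Multiplying M
    functions independent over k[1/t] by the powers t^-a, a <= m, gives (m + 1) M independent
    functions with poles of order at most m e(Q) + N. Removing the poles away from P costs m (M - 1)
    up to a constant, because e(P) = 1. So m dimensions survive up to a constant among pole orders
    at most m + N at P, and the number of missed orders is bounded independently of m. *)
Theorem pole_functions P (bad : seq (point C)) (Kv : nat) :
  exists N, forall n : nat, (N <= n)%N -> exists f,
  [/\ vex P (- n%:Z) f, forall Q, Q != P -> vge Q 0 f
    & forall Q, Q \in bad -> Q != P -> vge Q Kv%:Z f].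
Proof.
pose t := unif hC P; have t0 : t != 0 := unif_neq0 hC P.
have /boolp.choice[e he] : forall Q, exists e : nat, [/\ vge Q (- e%:Z) t^-1,
    max_ideal Q t -> vex Q e%:Z t & ~ max_ideal Q t -> e = 0%N].
  move=> Q; have [z hz] := vex_exists hC Q t0.
  have [m|nm] := boolp.EM (max_ideal Q t).
    have zpos : 1 <= z by apply: (vex_le hz); apply/(vge1P hC).
    exists `|z|%N; have -> : `|z|%N%:Z = z by lia.
    by split=> //; exact: (vex_vge (vex_inv hz)).
  exists 0%N; split=> //; apply: vge_le (vex_vge (vex_inv hz)).
  rewrite oppr0 oppr_ge0 leNgt; apply/negP => zpos; apply: nm; apply/(vge1P hC).
  by apply: vge_le (vex_vge hz); lia.
have [s hs] := almost_lunit t0.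
pose zs := undup [seq Q <- s | boolp.asbool (max_ideal Q t)].
have zsP Q : (Q \in zs) <-> max_ideal Q t.
  rewrite mem_undup mem_filter; split=> [/andP[/boolp.asboolP]//|m].
  apply/andP; split; first exact/boolp.asboolP.
  by apply: boolp.contrapT => /negP /hs [_].
have uzs : uniq zs := undup_uniq _.
have mP : max_ideal P t by case: (unifP hC P).
have Pzs : P \in zs by apply/zsP.
have eP : e P = 1%N.
  have [_ /(_ mP) h _] := he P; have := vex_uniq h (vex_unif hC P); lia.
have ezs Q : Q \notin zs -> e Q = 0%N.
  by move=> nQ; have [_ _] := he Q; apply; move/zsP; apply/negP.
(* For j < e(Q) the function G(Q, j) has order j at Q and is divisible by t at the other zeros of t:
   M functions in all. *)
have /boolp.choice[G hG] : forall w : point C * nat, exists g, w.1 \in zs ->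
    vex w.1 w.2%:Z g /\ forall Q', Q' \in zs -> Q' != w.1 -> vge Q' (e Q')%:Z g.
  move=> [Q j] /=; have [Qz|_] := boolP (Q \in zs); last by exists 0.
  have [g [hg hg']] := weak_approximation j (\sum_(Q' <- zs) e Q') uzs Qz.
  exists g => _; split=> // Q' Q'z Q'Q; apply: vge_le (hg' Q' Q'z Q'Q).
  by rewrite lez_nat (bigD1_seq Q') //= leq_addr.
pose z i := tnth (in_tuple zs) i.
have zz i : z i \in zs by exact: mem_tnth.
pose I : finType := {i : 'I_(size zs) & 'I_(e (z i))}.
pose g (w : I) := G (z (tag w), nat_of_ord (tagged w)).
pose M := #|I|.
have ME : M = (\sum_(Q <- zs) e Q)%N.
  rewrite /M card_tagged sumnE big_map big_enum (big_tnth _ _ zs) /=.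
  by apply: eq_bigr => i _; rewrite card_ord.
have gzs Q w : Q \in zs -> vge Q 0 (g w).
  move=> Qz; have [h1 h2] := hG (z (tag w), nat_of_ord (tagged w)) (zz _).
  have [->|ne] := eqVneq Q (z (tag w)); first by apply: vge_le (vex_vge h1).
  by apply: vge_le (h2 Q Qz ne).
(* In a relation take the largest a occurring and, at one zero of t, the least j among the terms
   with t^-a. After multiplication by t^a all other terms have order above j at that zero. *)
have indepx m : indep (fun aw : 'I_m.+1 * I => t^-1 ^+ aw.1 * g aw.2).
  move=> c E; apply: boolp.contrapT => nz.
  have ex : exists n, [exists a : 'I_m.+1, exists w : I, (a == n :> nat) && (c (a, w) != 0)].
    have /boolp.existsNP[[a w] caw] := nz; exists a; apply/existsP; exists a.
    by apply/existsP; exists w; rewrite eqxx; apply/eqP.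
  have bd n : [exists a : 'I_m.+1, exists w : I, (a == n :> nat) && (c (a, w) != 0)] -> (n <= m)%N.
    by case/existsP=> a /existsP[w /andP[/eqP <- _]]; rewrite -ltnS.
  have [_ /existsP[a /existsP[w0 /andP[/eqP <- cw0]]] amax] := ex_maxnP ex bd.
  have {}amax (b : 'I_m.+1) w : (a < b)%N -> c (b, w) = 0.
    move=> ab; apply/eqP; apply: contraTT ab => cb; rewrite -leqNgt; apply: amax.
    by apply/existsP; exists b; apply/existsP; exists w; rewrite eqxx.
  have ex2 : exists j, [exists w : I,
      [&& tag w == tag w0, (tagged w == j :> nat) & c (a, w) != 0]].
    by exists (tagged w0); apply/existsP; exists w0; rewrite !eqxx.
  have [_ /existsP[w /and3P[/eqP wi /eqP <- cw]]] := ex_minnP ex2.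
  rewrite -wi => jmin.
  have jlt : (tagged w < e (z (tag w)))%N by [].
  have [h1 _] := hG (z (tag w), nat_of_ord (tagged w)) (zz _); rewrite /= in h1.
  have tz : vex (z (tag w)) (e (z (tag w)))%:Z t.
    by have [_ + _] := he (z (tag w)); apply; apply/zsP.
  have h2 : vge (z (tag w)) ((tagged w)%:Z + 1) (iota (c (a, w)) * g w).
    have -> : iota (c (a, w)) * g w =
        - \sum_(bw | bw != (a, w)) iota (c bw) * (t^-1 ^+ bw.1 * g bw.2) * t ^+ a.
      apply/eqP; rewrite -subr_eq0 opprK -mulr_suml; apply/eqP.
      have -> : iota (c (a, w)) * g w = iota (c (a, w)) * (t^-1 ^+ a * g w) * t ^+ a.
        by rewrite exprVn; field; rewrite expf_neq0.
      by rewrite -mulrDl; move: E; rewrite (bigD1 (a, w)) //= => ->; rewrite mul0r.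
    apply: vgeN; apply: vge_sum => -[b w'] ne /=; have [ab|ba|/val_inj ab] := ltngtP a b.
    - by rewrite amax // rmorph0 !mul0r; exact: vge_0.
    - rewrite -mulrA; apply: vgeZ; rewrite mulrAC exprV_sub ?(ltnW ba) //.
      have := vge_mul (vge_exp (a - b) (vex_vge tz)) (gzs _ w' (zz (tag w))).
      apply: vge_le; rewrite addr0 -PoszM -(PoszD _ 1) lez_nat addn1.
      by apply: leq_trans jlt (leq_pmulr _ _); rewrite subn_gt0.
    rewrite -ab in ne *; rewrite -mulrA.
    have -> : t^-1 ^+ a * g w' * t ^+ a = g w' by rewrite mulrAC exprV_sub // subnn mul1r.
    have [h1' h2'] := hG (z (tag w'), nat_of_ord (tagged w')) (zz _); rewrite /= in h1' h2'.
    have [Et|Et] := eqVneq (tag w') (tag w); last first.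
      apply: vgeZ; have := h2' (z (tag w)) (zz _); rewrite -/(g w') => h.
      have : z (tag w) != z (tag w').
        rewrite /z !(tnth_nth P) /= nth_uniq // eq_sym; exact: Et.
      by move/h; apply: vge_le; rewrite -(PoszD _ 1) lez_nat addn1.
    have [cw'|cw'] := eqVneq (c (a, w')) 0; first by rewrite cw' rmorph0 mul0r; exact: vge_0.
    have jle : (tagged w <= tagged w')%N.
      by apply: jmin; apply/existsP; exists w'; apply/and3P; split=> //; exact/eqP.
    have h3 : vge (z (tag w)) (tagged w')%:Z (g w').
      by rewrite -(congr1 z Et); exact: vex_vge h1'.
    apply: vgeZ; apply: vge_le h3.
    have : nat_of_ord (tagged w') <> nat_of_ord (tagged w); last first.
      by move=> ne'; rewrite -(PoszD _ 1) lez_nat addn1 ltn_neqAle jle andbT eq_sym; apply/eqP.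
    move=> Ej; case/eqP: ne; congr (_, _).
    move: (w) (w') Et Ej => [i1 j1] [i2 j2] /= Et; case: i1 / Et j1 => j1 Ej.
    by congr existT; exact: val_inj.
  apply: (vex_not h1); rewrite -/(g w).
  have -> : g w = iota (c (a, w))^-1 * (iota (c (a, w)) * g w).
    by rewrite mulrA -rmorphM mulVf // rmorph1 mul1r.
  exact: vgeZ.
have [s1 hs1] : almost (fun Q => forall i : 'I_#|I|, local_ring Q (g (enum_val i))).
  by apply: almost_ord => i; exact: almost_local.
(* S contains the zeros of t, the points where some g is not regular, and the bad points. *)
pose S := zs ++ [seq Q <- undup (s1 ++ bad) | Q \notin zs].
have uS : uniq S.
  rewrite cat_uniq uzs filter_uniq ?undup_uniq // andbT /=.
  by apply/hasPn => Q; rewrite mem_filter => /andP[].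
have SP Q : (Q \in S) = [|| Q \in zs, Q \in s1 | Q \in bad].
  by rewrite mem_cat mem_filter mem_undup mem_cat; case: (Q \in zs).
have PS : P \in S by rewrite SP Pzs.
have badS : {subset bad <= S} by move=> Q Qb; rewrite SP Qb !orbT.
have eS : (\sum_(Q <- S) e Q = M)%N.
  rewrite big_cat /= -ME big_filter big1 => [|Q]; [exact: addn0 | exact: ezs].
have /boolp.choice[zg hzg] : forall Qw : point C * I, exists z, vge Qw.1 z (g Qw.2).
  by move=> Qw; exact: vge_exists.
pose N := (\sum_(Q <- S) \sum_w `|zg (Q, w)|)%N.
have gN Q w : Q \in S -> vge Q (- N%:Z) (g w).
  move=> QS; apply: vge_le (hzg (Q, w)).
  have : (`|zg (Q, w)| <= N)%N.
    rewrite /N (bigD1_seq Q) //= (bigD1 w) //=; lia.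
  lia.
pose S' := rem P S.
have S'P Q : (Q \in S') = (Q != P) && (Q \in S) by rewrite mem_rem_uniq // inE.
(* The part of the cost that does not depend on m: at each point of S other than P, N for the poles
   of the g and Kv for the prescribed zero. *)
pose c1 := (size S' * (N + Kv))%N.
have eS' : (\sum_(Q <- S') e Q = M.-1)%N.
  by rewrite -eS (big_rem P PS) eP.
have Mpos : (0 < M)%N by rewrite ME (bigD1_seq P) //= eP.
have key m : (m + M <= c1 + count (attained P bad Kv) (seq.iota 0 (m + N).+1))%N.
  rewrite leqNgt; apply/negP => lt.
  pose b Q := if Q \in S then - (m * e Q + N)%N%:Z else 0.
  have d0 : dim_ge (Lsp b) #|{: 'I_m.+1 * I}|.
    apply: dim_ge_fin (indepx m) => -[a w] Q /=; rewrite /b.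
    have [QS|QS] := boolP (Q \in S).
      have [h _ _] := he Q; have := vge_mul (vge_exp a h) (gN Q w QS).
      apply: vge_le; have := ltn_ord a; nia.
    have [h _] := he Q; rewrite ezs => [_|]; last by move: QS; rewrite SP negb_or => /andP[].
    rewrite ezs in h; last by move: QS; rewrite SP negb_or => /andP[].
    have lg : vge Q 0 (g w).
      apply/vge0P; rewrite -(enum_rankK w); apply: hs1.
      by move: QS; rewrite SP !negb_or => /and3P[].
    by have := vge_mul (vge_exp a h) lg; rewrite oppr0 mul0r.
  rewrite card_prod card_ord -/M in d0.
  pose r Q := (m * e Q + (N + Kv))%N.
  have Er : (\sum_(Q <- S') r Q = m * M.-1 + c1)%N.
    by rewrite big_split /= -big_distrr /= eS' big_const_seq count_predT iter_addn_0 /c1 [(size _ * _)%N]mulnC.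
  have d1 : dim_ge (Lsp b) ((m + M - c1) + \sum_(Q <- S') r Q)%N.
    apply: dim_ge_le d0; rewrite Er; case: (M) Mpos lt => // M' _ lt; rewrite /=; nia.
  have d2 := Lsp_raise_seq (rem_uniq _ uS) d1.
  have d3 : dim_ge (level P Kv S (- (m + N)%N%:Z)) (m + M - c1)%N.
    apply: dim_ge_impl d2 => f hf; split=> [|Q QP]; have := hf; rewrite /b.
      by move=> /(_ P); rewrite -/S' S'P eqxx /= PS eP muln1.
    move=> /(_ Q); rewrite -/S' S'P QP /=; case: (Q \in S) => //.
    by apply: vge_le; rewrite /r; lia.
  have : dim_ge (level P Kv S (- (m + N)%N%:Z)) (1 + count (attained P bad Kv) (seq.iota 0 (m + N).+1))%N.
    by apply: dim_ge_le d3; lia.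
  by move/(level_chain badS)/level1_trivial.
have [|N0 hN0] := @finite_of_count (predC (attained P bad Kv)) (N + 1 + c1); last first.
  exists N0 => n nN; have /negPn/boolp.asboolP[f hf] := hN0 n nN; by exists f.
move=> m; have h := key m.
have hc := count_predC (attained P bad Kv) (seq.iota 0 (m + N).+1); rewrite size_iota in hc.
have : (count (predC (attained P bad Kv)) (seq.iota 0 m) <=
    count (predC (attained P bad Kv)) (seq.iota 0 (m + N).+1))%N.
  by rewrite -addnS iotaD count_cat leq_addr.
by lia.
Qed.

End Riemann.

(** * Coordinates and Taylor coefficients *)

Section TaylorCoefficient.
Variable k : comNzRingType.
Local Notation pC := (@polyC k : {rmorphism k -> {poly k}}).
Local Notation idk := (idfun : {rmorphism k -> k}).

Lemma coef0_rel : ring_rel pC idk (fun p c => p`_0 = c).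
Proof.
by split=> [c|p q a b <- <-|p q a b <- <-]; rewrite ?coefC ?coefD ?coef0M.
Qed.

(** A Newton step: modulo X^(n+1) only the linear term of the expansion of F in h X^n survives, so a
    new coefficient h enters linearly. *)
Lemma ev2_taylor_coef (F : {poly {poly k}}) (x y : {poly k}) h n : (0 < n)%N ->
  (ev2 pC x (y + h *: 'X^n) F)`_n =
  (ev2 pC x y F)`_n + h * ev2 idk x`_0 y`_0 F^`().
Proof.
move=> npos; rewrite -(ring_rel_ev2 coef0_rel F^`() (erefl x`_0) (erefl y`_0)).
rewrite /ev2 /= /horner_eval; rewrite -deriv_map; set P := map_poly _ F.
have comm_yh : GRing.comm y (h *: 'X^n) by exact: mulrC.
rewrite (nderiv_taylor_wide (n := (size P).+2) comm_yh); first last.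
  exact/ltnW/ltnW.
  rewrite 2!big_ord_recl /bump /= expr0 mulr1 poly.nderivn0.
  have -> : bump 0 0 = 1%N by [].
  rewrite expr1 poly.nderivn1 !coefD.
  rewrite coef_sum big1 ?addr0 => [|i _].
    congr (_ + _); rewrite -scalerAr coefZ coefMXn ltnn subnn //.
  rewrite /bump /= exprZn -exprM -scalerAr coefZ coefMXn.
  by rewrite (_ : (n < _)%N = true) ?mulr0 //; nia.
Qed.

End TaylorCoefficient.

Lemma sum_blocks (V : nmodType) (G : nat -> V) n p :
  \sum_(l < n * p) G l = \sum_(l < n) \sum_(i < p) G (l * p + i)%N.
Proof.
elim: n => [|n IHn]; first by rewrite mul0n !big_ord0.
rewrite big_ord_recr /= -IHn -(big_mkord xpredT G) mulSn addnC.
rewrite (big_cat_nat (leq0n (n * p)) (leq_addr p _)) /= big_mkord; congr (_ + _).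
by rewrite -{1}[(n * p)%N]add0n big_addn addKn big_mkord; apply: eq_bigr => i _; rewrite addnC.
Qed.

Section EvWide.
Variables (k A : comNzRingType) (i : {rmorphism k -> A}).

Lemma ev1_wide x (p : {poly k}) n : (size p <= n)%N ->
  ev1 i x p = \sum_(j < n) i p`_j * x ^+ j.
Proof.
move=> h; rewrite /ev1 /= /horner_eval (horner_coef_wide (n := n)).
  by apply: eq_bigr => j _; rewrite coef_map.
by apply: leq_trans h; exact: size_poly.
Qed.

Lemma ev2_wide x y (F : {poly {poly k}}) n : (size F <= n)%N ->
  ev2 i x y F = \sum_(j < n) ev1 i x F`_j * y ^+ j.
Proof.
move=> h; rewrite /ev2 /= /horner_eval (horner_coef_wide (n := n)).
  by apply: eq_bigr => j _; rewrite coef_map.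
by apply: leq_trans h; exact: size_poly.
Qed.

End EvWide.

(** * Separability and etale coordinates *)

Section Separability.
Variables (k : closedFieldType) (C : curve k) (hC : smooth C).
Local Notation K := (ff C).
Local Notation iota := (cst C).
Local Notation gn := (@gen _ C).
Local Notation phi := (mmap iota gn).
Implicit Types (P Q R : point C) (f g x y : K).
Local Notation vge := (vge hC).
Local Notation vex := (vex hC).

(** The orders i + p v(y_i) of the nonzero terms are distinct modulo p, so the terms cannot
    cancel. *)
Lemma frobenius_independence R t p (y : 'I_p -> K) : vex R 1 t ->
  \sum_(i < p) t ^+ i * y i ^+ p = 0 -> forall i, y i = 0.
Proof.
move=> ht E i1; apply/eqP/negPn/negP => n1.
have /boolp.choice[v hv] : forall i, exists v : int, y i != 0 -> vex R v (y i).
  move=> i; have [_|y0] := eqVneq (y i) 0; first by exists 0.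
  by have [v hv] := vex_exists hC R y0; exists v.
pose w (i : 'I_p) : int := i%:Z + v i * p%:Z.
have [i0 n0 min] := @Order.TotalTheory.arg_minP _ _ _ i1 (fun i => y i != 0) w n1.
have hw i : y i != 0 -> vex R (w i) (t ^+ i * y i ^+ p).
  move=> yi; have := vex_mul (vex_exp i ht) (vex_exp p (hv i yi)).
  by rewrite mul1r.
apply: (vex_not (hw i0 n0)).
have -> : t ^+ i0 * y i0 ^+ p = - \sum_(i | i != i0) t ^+ i * y i ^+ p.
  by move: E; rewrite (bigD1 i0) //= => /eqP; rewrite addr_eq0 => /eqP.
apply: vgeN; apply: vge_sum => i ne; have [z|yi] := eqVneq (y i) 0.
  rewrite z expr0n (_ : (p == 0)%N = false) ?mulr0; first exact: vge_0.
  by apply/negbTE; rewrite -lt0n; apply: leq_ltn_trans (ltn_ord i).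
apply: vge_le (vex_vge (hw i yi)).
have := min i yi; have [lt|gt|e] := ltgtP (w i0) (w i); [lia | lia | move=> _].
case/eqP: ne; apply: val_inj => /=; move: e; rewrite /w.
have := ltn_ord i; have := ltn_ord i0; move: (v i) (v i0) => a b h1 h2 e.
have [lt|gt|ab] := ltgtP a b; [nia | nia | by rewrite ab in e; lia].
Qed.

(** Take F of least degree in Y. If F_Y(t, g) = 0, then F_Y = 0 by minimality, the characteristic is
    some p > 0 and F is a polynomial in Y^p. Since k is perfect, F(t, g) is a sum of t^i H_i(t, g)^p
    with i < p. As t has order 1 at R, each H_i(t, g) is 0, so H_i = 0 by minimality, and F = 0. *)
Lemma separable_relation R t g : vex R 1 t ->
  exists2 F : {poly {poly k}}, ev2 iota t g F = 0 & ev2 iota t g F^`() != 0.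
Proof.
move=> ht; have mt : max_ideal R t by apply/(vge1P hC); exact: vex_vge.
have t0 : t != 0 := vex_neq0 ht.
have ex : exists n, boolp.asbool (exists F : {poly {poly k}},
    [/\ F != 0, ev2 iota t g F = 0 & size F = n]).
  have [F F0 hF] := algdep t g; exists (size F); apply/boolp.asboolP; by exists F.
have [n /boolp.asboolP[F [F0 hF sF]] min] := ex_minnP ex.
have {}min G : ev2 iota t g G = 0 -> (size G < size F)%N -> G = 0.
  move=> hG lt; apply/eqP/negPn/negP => G0.
  have : (n <= size G)%N by apply: min; apply/boolp.asboolP; exists G.
  by rewrite -sF leqNgt lt.
exists F => //; apply/eqP => hF'.
have dF0 : F^`() = 0 by apply: min => //; exact: lt_size_deriv.
have s1 : (1 < size F)%N.
  rewrite ltnNge; apply/negP => /size1_polyC E.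
  have c0 : F`_0 != 0 by move: F0; rewrite {1}E polyC_eq0.
  by have := transc_param mt t0 c0; rewrite -(ev2C _ _ g) -E hF eqxx.
have coefF j : F`_j *+ j = 0.
  by case: j => [|j]; [rewrite mulr0n | rewrite -coef_deriv dF0 coef0].
have [p chp] : exists p, p \in [pchar k].
  apply: (@natf0_pchar _ (size F).-1); first by rewrite -subn1 subn_gt0.
  have /eqP := coefF (size F).-1; rewrite -scaler_nat scaler_eq0 -lead_coefE.
  by rewrite lead_coef_eq0 (negPf F0) orbF.
have pp : prime p := pcharf_prime chp; have p0 := prime_gt0 pp.
have chK : p \in [pchar K] by rewrite (rmorph_pchar iota).
have coefp j : ~~ (p %| j)%N -> F`_j = 0.
  move=> nj; have /eqP := coefF j; rewrite -scaler_nat.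
  by rewrite scaler_eq0 -(dvdn_pcharf chp) (negPf nj) => /eqP.
have /boolp.choice[rt hrt] : forall c : k, exists r, r ^+ p = c.
  move=> c; have [r] : exists r, root ('X^p - c%:P) r.
    by apply/closed_rootP; rewrite size_XnsubC // eqSS -lt0n.
  by rewrite /root !hornerE subr_eq0 => /eqP; exists r.
(* B i q takes the p-th roots of the coefficients of q at exponents congruent to i modulo p, so that
   q(t) is the sum of the t^i (B i q)(t)^p. *)
pose B i (q : {poly k}) := \poly_(l < size q) rt q`_(l * p + i).
pose n0 := ((size F).-1 %/ p).+1.
pose H (i : 'I_p) : {poly {poly k}} := \poly_(j < n0) B i F`_(j * p).
have frob I (r : seq I) (G : I -> K) : (\sum_(j <- r) G j) ^+ p = \sum_(j <- r) G j ^+ p.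
  by have := rmorph_sum (pFrobenius_aut chK) r xpredT G.
have evB q : ev1 iota t q = \sum_(i < p) t ^+ i * ev1 iota t (B i q) ^+ p.
  rewrite (@ev1_wide _ _ _ _ _ (size q * p)%N) ?leq_pmulr //.
  rewrite (sum_blocks (fun l => iota q`_l * t ^+ l)) exchange_big /=.
  apply: eq_bigr => i _; rewrite (ev1_wide _ _ (size_poly _ _)) frob mulr_sumr.
  apply: eq_bigr => l _; rewrite coef_poly ltn_ord exprMn -rmorphXn /= hrt.
  by rewrite -exprM exprD; ring.
have evH : ev2 iota t g F = \sum_(i < p) t ^+ i * ev2 iota t g (H i) ^+ p.
  have sFn : (size F <= n0 * p)%N.
    by rewrite -(prednK (ltnW s1)) /n0; exact: ltn_ceil.
  rewrite (ev2_wide _ _ _ sFn) (sum_blocks (fun j => ev1 iota t F`_j * g ^+ j)).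
  transitivity (\sum_(j < n0) ev1 iota t F`_(j * p) * g ^+ (j * p)).
    apply: eq_bigr => j _; rewrite (bigD1 (Ordinal p0)) //= addn0 big1 ?addr0 // => i ni.
    rewrite coefp ?rmorph0 ?mul0r // dvdn_addr ?dvdn_mull //.
    by rewrite gtnNdvd // lt0n; apply: contra ni => /eqP i0; apply/eqP/val_inj.
  transitivity (\sum_(j < n0) \sum_(i < p) t ^+ i * (ev1 iota t (B i F`_(j * p)) * g ^+ j) ^+ p).
    apply: eq_bigr => j _; rewrite {1}evB mulr_suml; apply: eq_bigr => i _.
    by rewrite exprMn -exprM mulrA.
  rewrite exchange_big /=; apply: eq_bigr => i _.
  rewrite (ev2_wide _ _ _ (size_poly _ _)) frob mulr_sumr.
  by apply: eq_bigr => j _; rewrite coef_poly ltn_ord.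
have H0 i : H i = 0.
  apply: min; last first.
    apply: leq_ltn_trans (size_poly _ _) _; rewrite -[size F in X in (_ < X)%N](prednK (ltnW s1)).
    rewrite ltnS; apply: ltn_Pdiv; first exact: prime_gt1.
    by rewrite -subn1 subn_gt0.
  by apply: (frobenius_independence (y := fun i => ev2 iota t g (H i)) ht); rewrite -evH.
case/eqP: F0; apply/polyP => j; rewrite coef0.
have [/dvdnP[j' ->]|/coefp //] := boolP (p %| j)%N.
have [jn|jn] := ltnP j' n0; last first.
  rewrite nth_default // -(prednK (ltnW s1)); apply: leq_trans (ltn_ceil _ p0) _.
  by rewrite leq_mul2r jn orbT.
apply/polyP => l; rewrite coef0.
have [ll|ll] := ltnP l (size F`_(j' * p)); last by rewrite nth_default.
have := congr1 (fun G : {poly {poly k}} => G`_j'`_(l %/ p)) (H0 (Ordinal (ltn_pmod l p0))).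
rewrite !coef0 coef_poly jn coef_poly /= (leq_ltn_trans (leq_div _ _) ll) -divn_eq.
by move=> e; rewrite -[LHS]hrt e expr0n eqn0Ngt p0.
Qed.

Definition etale g Q := exists c, uniformizer Q (g - iota c).

(** Congruence modulo the square of the maximal ideal; only p_0 and p_1 are determined by x. *)
Definition first_order Q x (p : {poly k}) := vge Q 2 (x - ev1 iota (unif hC Q) p).

Lemma ev1_local Q t (p : {poly k}) : local_ring Q t -> local_ring Q (ev1 iota t p).
Proof.
move=> ht; rewrite ev1E; apply: (big_ind (local_ring Q)) => [|? ?|i _].
- by rewrite -(rmorph0 iota); exact: local_cst.
- exact: local_add.
- by apply: local_mul; [exact: local_cst | exact: local_exp].
Qed.

Lemma unif_local Q : local_ring Q (unif hC Q).
Proof. by apply: max_local; case: (unifP hC Q). Qed.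

Lemma first_order_rel Q :
  ring_rel iota (@polyC k : {rmorphism k -> {poly k}}) (first_order Q).
Proof.
split=> [c|x y p q hx hy|x y p q hx hy].
- by rewrite /first_order ev1C subrr; exact: vge_0.
- by rewrite /first_order rmorphD opprD addrACA; exact: vge_add.
- rewrite /first_order rmorphM /=; set a := ev1 _ _ p in hx *; set b := ev1 _ _ q in hy *.
  have la : vge Q 0 a by apply/vge0P/ev1_local/unif_local.
  have lb : vge Q 0 b by apply/vge0P/ev1_local/unif_local.
  have ly : vge Q 0 y by rewrite -[y](subrK b); apply: vge_add => //; apply: vge_le hy.
  rewrite (_ : _ - _ = (x - a) * y + a * (y - b)); last by ring.
  by apply: vge_add; rewrite -[2]addr0; [|rewrite addrC]; exact: vge_mul.
Qed.

Lemma first_order0 Q (p : {poly k}) : first_order Q 0 p -> p`_0 = 0 /\ p`_1 = 0.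
Proof.
set u := unif hC Q; rewrite /first_order sub0r => /vgeN; rewrite opprK => h.
have mu : max_ideal Q u by case: (unifP hC Q).
have [->|p0] := eqVneq p 0; first by rewrite !coef0.
have [q Eq] : exists q, p = q * 'X + (p`_0)%:P.
  elim/poly_ind: (p) => [|q c _]; first by exists 0; rewrite mul0r coef0 add0r.
  by exists q; rewrite coefD coefMX coefC add0r.
have c0 : p`_0 = 0.
  apply: (@max_cst _ _ Q).
  have -> : iota p`_0 = ev1 iota u p - u * ev1 iota u q.
    by rewrite {2}Eq rmorphD rmorphM /= ev1X ev1C; ring.
  apply: max_sub; first by apply/(vge1P hC); apply: vge_le h.
  by apply: max_mul => //; exact: ev1_local (unif_local Q).
split=> //; rewrite Eq coefD coefMX coefC addr0 /=.
have [r Er] : exists r, q = r * 'X + (q`_0)%:P.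
  elim/poly_ind: (q) => [|r c _]; first by exists 0; rewrite mul0r coef0 add0r.
  by exists r; rewrite coefD coefMX coefC add0r.
have h' : vge Q 1 (ev1 iota u q).
  have := vge_mul (vex_vge (vex_inv (vex_unif hC Q))) h.
  rewrite Eq c0 addr0 rmorphM /= ev1X -/u mulrCA mulVf ?mulr1 //.
  exact: unif_neq0.
apply: (@max_cst _ _ Q).
have -> : iota q`_0 = ev1 iota u q - u * ev1 iota u r.
  by rewrite {2}Er rmorphD rmorphM /= ev1X ev1C; ring.
apply: max_sub; first exact/(vge1P hC).
by apply: max_mul => //; exact: ev1_local (unif_local Q).
Qed.

Lemma first_order_exists Q x : local_ring Q x ->
  exists a b, has_value Q x a /\ first_order Q x (a%:P + b *: 'X).
Proof.
move=> hx; have [a [_ ha]] := value_exists hx; have [_ hu] := unifP hC Q.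
have [y hy Ey] := hu _ ha; have [b [_ hb]] := value_exists hy.
exists a, b; split=> //; rewrite /first_order -mul_polyC rmorphD rmorphM /= !ev1C ev1X.
rewrite (_ : _ - _ = unif hC Q * (y - iota b)).
  by rewrite -[2]/(1 + 1); apply: vge_mul; [exact: vex_vge (vex_unif hC Q) | exact/vge1P].
by rewrite mulrBr -Ey; ring.
Qed.

(** At almost every Q each affine coordinate y_j satisfies a relation F_j(s, y_j) = 0 whose
    derivative in y_j is a unit. If s were constant to first order at Q, so would be all y_j, and
    then the local parameter at Q, a quotient of forms in them, would have order at least 2. *)
Theorem etale_open P s : uniformizer P s -> almost (etale s).
Proof.
move=> /(uniformizerP hC) hs; have [i0 Pi0 g0] := point_coord P.
have /boolp.choice[F hF] : forall j, exists F : {poly {poly k}},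
    ev2 iota s (gn j / gn i0) F = 0 /\ ev2 iota s (gn j / gn i0) F^`() != 0.
  by move=> j; have [F h1 h2] := separable_relation (gn j / gn i0) hs; exists F.
have hX : phi 'X_i0 != 0 by rewrite mmapX mmap1U.
have aX := form_zeros_finite (homog_X k i0) hX.
have aD := almost_ord (fun j => almost_lunit (proj2 (hF j))).
have aY := almost_ord (fun j => almost_local (gn j / gn i0)).
apply: almost_impl (almost_and (almost_and aX (almost_local s)) (almost_and aD aY)).
move=> Q [[QX ls] [D ly]]; rewrite mevalXU in QX.
have [c [_ hc]] := value_exists ls; exists c; apply/(uniformizerP hC).
have [t2|nt2] := boolp.EM (vge Q 2 (s - iota c)); last first.
  have t0 : s - iota c != 0 by apply/eqP => z; apply: nt2; rewrite z; exact: vge_0.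
  have [z hz] := vex_exists hC Q t0.
  have zpos : 1 <= z by apply: (vex_le hz); exact/vge1P.
  have [E|ne] := eqVneq z 1; first by rewrite -E.
  by case: nt2; apply: vge_le (vex_vge hz); lia.
have /boolp.choice[a ha] : forall j, exists a, has_value Q (gn j / gn i0) a /\
    first_order Q (gn j / gn i0) a%:P.
  move=> j; have [a [b [va fo]]] := first_order_exists (ly j); exists a; split=> //.
  have fs : first_order Q s c%:P by rewrite /first_order ev1C.
  have [hF0 hF1] := hF j.
  have := ring_rel_ev2 (first_order_rel Q) (F j) fs fo; rewrite hF0.
  case/first_order0=> _; rewrite -['X]expr1 ev2_taylor_coef // !coefC eqxx.
  have rc : ring_rel (idfun : {rmorphism k -> k}) (@polyC k : {rmorphism k -> {poly k}})
      (fun a p => p = a%:P).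
    by split=> [//|? ? ? ? -> ->|? ? ? ? -> ->]; rewrite ?rmorphD ?rmorphM.
  rewrite (ring_rel_ev2 rc (F j) (erefl c%:P) (erefl a%:P)) coefC add0r /=.
  have vD := ring_rel_ev2 (has_value_rel Q) (F j)^`() (conj ls hc : has_value Q s c) va.
  move/eqP; rewrite mulf_eq0 => /orP[/eqP b0|/eqP z].
    by rewrite b0 scale0r addr0 in fo.
  by case: (D j) vD => _ nm [_]; rewrite z rmorph0 subr0.
exfalso; have [[d [A [B [hA hB nB zA Eu]]]] _] := unifP hC Q.
have gd : gn i0 ^+ d != 0 by rewrite expf_neq0.
have pB := phi_neq0 hB nB.
have hXd : ('X_i0 : {mpoly k[(pdim C).+1]}) ^+ d \is d.-homog.
  by have := dhomogMn d (homog_X k i0); rewrite mul1n.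
have XdQ : (('X_i0 : {mpoly k[(pdim C).+1]}) ^+ d).@[Q] != 0.
  by rewrite rmorphXn /= mevalXU expf_neq0.
have pX : phi ('X_i0 ^+ d) = gn i0 ^+ d by rewrite rmorphXn /= mmapX mmap1U.
have EA : phi A / gn i0 ^+ d = mmap iota (fun j => gn j / gn i0) A.
  by rewrite -exprVn -(mmap_homog_scale _ _ _ hA).
have Aa : A.@[a] = 0.
  have v1 := ring_rel_mmap (has_value_rel Q) A (fun j => proj1 (ha j)).
  rewrite -EA in v1; apply: (value_uniq v1).
  have m : max_ideal Q (phi A / gn i0 ^+ d) by exists d, A, ('X_i0 ^+ d); rewrite pX.
  by split; [exact: max_local | rewrite rmorph0 subr0].
have h2 : vge Q 2 (phi A / gn i0 ^+ d).
  have := ring_rel_mmap (first_order_rel Q) A (fun j => proj2 (ha j)).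
  rewrite -EA; have -> : mmap (@polyC k) (fun j => (a j)%:P) A = 0.
    rewrite -polyC0 -Aa /meval /mmap rmorph_sum; apply: eq_bigr => m _.
    rewrite rmorphM /= /mmap1 rmorph_prod; congr (_ * _).
    by apply: eq_bigr => j _; rewrite rmorphXn.
  by rewrite /first_order rmorph0 subr0.
apply: (vex_not (vex_unif hC Q)).
rewrite Eu (_ : phi A / phi B = phi A / gn i0 ^+ d * (gn i0 ^+ d / phi B)); last first.
  by field; rewrite gd pB.
rewrite -[1 + 1]addr0; apply: vge_mul => //; apply/vge0P.
by exists d, ('X_i0 ^+ d), B; rewrite pX.
Qed.

End Separability.

Lemma has_sum_seq (I : eqType) (W : nmodType) (u : I -> W) w (r : seq I) :
  uniq r -> (forall i, i \notin r -> u i = 0) -> has_sum u w -> w = \sum_(i <- r) u i.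
Proof.
move=> ur hr [s [us hs] ->].
have sub (a b : seq I) : uniq a -> uniq b -> (forall i, i \notin b -> u i = 0) ->
    \sum_(i <- a) u i = \sum_(i <- a | i \in b) u i.
  move=> ua ub hb; rewrite [LHS](bigID (mem b)) /= [X in _ + X]big1 ?addr0 //.
rewrite (sub s r) // [RHS](sub r s) // -[LHS]big_filter -[RHS]big_filter; apply: perm_big.
by apply: uniq_perm; rewrite ?filter_uniq // => i; rewrite !mem_filter andbC.
Qed.

(** * Expansions in a formal coordinate *)

Section FormalCoordinates.
Variables (k : closedFieldType) (C : curve k) (hC : smooth C).
Local Notation K := (ff C).
Local Notation iota := (cst C).
Implicit Types (f g x y : K).
Local Notation vge := (vge hC).
Local Notation vex := (vex hC).

Section AtPoint.
Variables (R : point C) (e : formal_coord R).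

Lemma ex0 n : e 0 n = 0.
Proof. by rewrite -(rmorph0 iota) ex_cst; case: eqP. Qed.

Lemma exN f n : e (- f) n = - e f n.
Proof. by apply/eqP; rewrite -addr_eq0 -ex_add addNr ex0. Qed.

Lemma ex_value f c : has_value R f c -> e f 0 = c.
Proof.
move=> [_ /(ex_max e)]; rewrite ex_add exN ex_cst eqxx => /eqP.
by rewrite subr_eq0 => /eqP.
Qed.

Lemma ex_has_value f : local_ring R f -> has_value R f (e f 0).
Proof. by case/value_exists=> c h; rewrite (ex_value h). Qed.

Definition eord f (N : int) := e f N != 0 /\ forall n, n < N -> e f n = 0.

Lemma eord_mul f g N M : eord f N -> eord g M -> eord (f * g) (N + M).
Proof.
move=> [f0 fl] [g0 gl]; split.
  have -> : e (f * g) (N + M) = e f N * e g M.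
    rewrite (has_sum_seq (r := [:: N]) _ _ (ex_mul e f g (N + M))) //.
      by rewrite big_seq1 addrC addKr.
    move=> i; rewrite inE => iN; have [lt|gt|E] := ltgtP i N.
    - by rewrite fl // mul0r.
    - by rewrite (gl (N + M - i)) ?mulr0 //; lia.
    - by rewrite E eqxx in iN.
  exact: mulf_neq0.
move=> n lt; rewrite (has_sum_seq (r := [::]) _ _ (ex_mul e f g n)) ?big_nil //.
move=> i _; have [lti|gei] := ltP i N; first by rewrite fl // mul0r.
by rewrite (gl (n - i)) ?mulr0 //; lia.
Qed.

Lemma eord_uniq f N M : eord f N -> eord f M -> N = M.
Proof.
move=> [f0 fl] [g0 gl]; have [lt|gt|//] := ltgtP N M.
  by rewrite gl ?eqxx in f0.
by rewrite fl ?eqxx in g0.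
Qed.

Lemma eord1 : eord 1 0.
Proof.
rewrite /eord -(rmorph1 iota) ex_cst eqxx oner_neq0; split=> // n.
by rewrite ex_cst; case: eqP => // ->.
Qed.

(** The expansion of f is not zero because f times its inverse expands to 1. *)
Lemma eord_exists f : f != 0 -> exists N, eord f N.
Proof.
move=> f0; have [n0 hn0] : exists n, e f n != 0.
  apply: boolp.contrapT => nex; have [o _] := eord1.
  have z n : e f n = 0 by apply/eqP/negPn/negP => h; apply: nex; exists n.
  case/eqP: o; rewrite -(mulfV f0).
  rewrite (has_sum_seq (r := [::]) _ _ (ex_mul e f f^-1 0)) ?big_nil // => i _.
  by rewrite z mul0r.
have [L hL] := ex_low e f.
have Ln : L <= n0 by rewrite leNgt; apply/negP => /hL /eqP; rewrite (negPf hn0).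
have ex : exists m : nat, e f (L + m%:Z) != 0.
  by exists `|(n0 - L)%R|%N; rewrite (_ : L + _ = n0) //; lia.
have [m hm min] := ex_minnP ex; exists (L + m%:Z); split=> // n lt.
have [/hL //|Lle] := ltP n L.
apply/eqP/negPn/negP => h; have := min `|(n - L)%R|%N.
rewrite (_ : L + _ = n) ?h; last by lia.
by move=> /(_ isT); lia.
Qed.

Lemma eordV f N : f != 0 -> eord f N -> eord f^-1 (- N).
Proof.
move=> f0 h; have [M hM] : exists M, eord f^-1 M by apply: eord_exists; rewrite invr_eq0.
have := eord_mul h hM; rewrite mulfV // => /eord_uniq /(_ eord1).
by move=> E; rewrite (_ : - N = M) //; lia.
Qed.

Lemma eord_lunit f : lunit R f -> eord f 0.
Proof.
move=> [hf nm]; split; last by move=> n; exact: ex_local.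
have [lf mf] := ex_has_value hf; apply/eqP => z; apply: nm.
by rewrite z rmorph0 subr0 in mf.
Qed.

(** Some f in the maximal ideal has a nonzero linear coefficient, and f is a multiple of u. *)
Lemma eord_uniformizer u : uniformizer R u -> eord u 1.
Proof.
move=> [mu hu]; have lu := max_local mu.
have low n : n < 1 -> e u n = 0.
  move=> lt; have [n0|nn] := ltP n 0; first exact: ex_local.
  by rewrite (_ : n = 0); [exact: ex_max | lia].
split=> //; have [f mf f1] := ex_param e; have [g lg Eg] := hu f mf.
apply: contraNneq f1 => u1; rewrite Eg.
rewrite (has_sum_seq (r := [::]) _ _ (ex_mul e u g 1)) ?big_nil // => i _.
have [lt|ge] := ltP i 1; first by rewrite low // mul0r.
have [E|ne] := eqVneq i 1; first by rewrite E u1 mul0r.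
have -> : e g (1 - i) = 0 by apply: ex_local => //; lia.
by rewrite mulr0.
Qed.

Lemma vex_eord z f : vex R z f -> eord f z.
Proof.
have hu := eord_uniformizer (unifP hC R); have u0 := unif_neq0 hC R.
have hX n : eord (unif hC R ^+ n) n%:Z.
  elim: n => [|n IHn]; first by rewrite expr0; exact: eord1.
  by rewrite exprS intS; exact: eord_mul.
move=> [g /eord_lunit hg ->].
suff hz : eord (unif hC R ^ z) z by have := eord_mul hz hg; rewrite addr0.
case: z => n; first exact: hX.
by apply: (@eordV (unif hC R ^+ n.+1) n.+1%:Z); [rewrite expf_neq0 | exact: hX].
Qed.

Lemma vge_low z f n : vge R z f -> n < z -> e f n = 0.
Proof.
have [->|f0] := eqVneq f 0; first by rewrite ex0.
have [w hw] := vex_exists hC R f0 => h lt.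
by have [_] := vex_eord hw; apply; apply: (lt_le_trans lt); exact: vex_le h.
Qed.

Lemma ex_mul_local f g n : local_ring R f -> local_ring R g ->
  e (f * g) n%:Z = \sum_(i < n.+1) e f i%:Z * e g (n - i)%N%:Z.
Proof.
move=> hf hg.
rewrite (has_sum_seq (r := [seq i%:Z | i <- seq.iota 0 n.+1]) _ _ (ex_mul e f g n%:Z)).
- rewrite big_map.
  rewrite -[RHS](big_mkord xpredT (fun i : nat => e f i%:Z * e g (n - i)%N%:Z)).
  rewrite /index_iota subn0 !big_seq; apply: eq_bigr => i; rewrite mem_iota => h.
  by congr (_ * e g _); lia.
- by rewrite map_inj_uniq ?iota_uniq // => i j [].
- move=> i ni; have [lt|ge] := ltP i 0.
    by have -> : e f i = 0 by [apply: ex_local]; rewrite mul0r.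
  have -> : e g (n%:Z - i) = 0; last by rewrite mulr0.
  apply: ex_local => //; rewrite subr_lt0 ltNge; apply: contra ni => le.
  by apply/mapP; exists `|i|%N; [rewrite mem_iota; lia | lia].
Qed.

Definition truncated n f (p : {poly k}) :=
  local_ring R f /\ forall i : nat, (i <= n)%N -> e f i%:Z = p`_i.

Lemma truncated_rel n :
  ring_rel iota (@polyC k : {rmorphism k -> {poly k}}) (truncated n).
Proof.
split=> [c|x y p q [lx hx] [ly hy]|x y p q [lx hx] [ly hy]].
- split; first exact: local_cst.
  by move=> i _; rewrite ex_cst coefC; case: i.
- split; first exact: local_add.
  by move=> i le; rewrite ex_add coefD hx // hy.
- split; first exact: local_mul.
  move=> i le; rewrite ex_mul_local // coefM; apply: eq_bigr => j _.
  by rewrite hx ?hy //; have := ltn_ord j; lia.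
Qed.

End AtPoint.

Lemma has_value_inv R f c : has_value R f c -> c != 0 -> has_value R f^-1 c^-1.
Proof.
move=> h c0; have [lf mf] := h.
have nm : ~ max_ideal R f.
  move=> m; case/eqP: c0; apply: (value_uniq h); split=> //.
  by rewrite rmorph0 subr0.
have [f0 lV] := local_inv lf nm; split=> //.
have i0 : iota c != 0 by rewrite fmorph_eq0.
have -> : f^-1 - iota c^-1 = (f - iota c) * (- (f^-1 * iota c^-1)).
  by rewrite fmorphV; field; rewrite f0 i0.
apply: max_mul => //; apply: local_opp; apply: local_mul => //; exact: local_cst.
Qed.

Lemma has_valueM R f c g d : has_value R f c -> has_value R g d -> has_value R (f * g) (c * d).
Proof. by case: (has_value_rel R) => _ _ h hf hg; exact: h. Qed.

Definition coef_value R (p : {poly K}) (q : {poly k}) := forall i, has_value R p`_i q`_i.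

Lemma has_value0 (R : point C) : has_value R 0 0.
Proof. by rewrite -(rmorph0 iota); split; [exact: local_cst | rewrite rmorph0 subrr; exact: max0]. Qed.

Lemma coef_value_rel R : ring_rel (@polyC K \o iota : {rmorphism k -> {poly K}})
  (@polyC k : {rmorphism k -> {poly k}}) (coef_value R).
Proof.
have hR := has_value_rel R; case: (hR) => hc hD hM.
split=> [c|p q p' q' hp hq|p q p' q' hp hq] i.
- by rewrite !coefC; case: ifP => _; [exact: hc | exact: has_value0].
- by rewrite !coefD; apply: hD.
- by rewrite !coefM; apply: (ring_rel_sum hR) => j; apply: hM.
Qed.

(* The Taylor coefficients of [g] in the coordinate [s] are the values of rational
   functions: [g_n] is found from [g_0,...,g_(n-1)] by solving [F(s, g) = 0]. *)
Theorem taylor_coefficients Q s g : uniformizer Q s -> forall n, exists D : nat -> K,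
  D 0%N = g /\ almost (fun R => forall (e : formal_coord R), coord_of s e ->
    forall j, (j <= n)%N -> has_value R (D j) (e g j%:Z)).
Proof.
move=> /(uniformizerP hC) hs; have [F hF hF'] := separable_relation g hs.
set Delta := ev2 _ _ _ _ in hF'.
elim=> [|n [D [D0 hD]]].
  exists (fun=> g); split=> //; apply: almost_impl (almost_local g) => R lg e _ j.
  by rewrite leqn0 => /eqP ->; exact: ex_has_value.
pose iK := (@polyC K \o iota : {rmorphism k -> {poly K}}).
(* The coefficient of X^(n+1) in F(s + X, D_0 + ... + D_n X^n) over K. By the Newton step the next
   Taylor coefficient is -cn / F_Y(s, g). *)
pose cn := (ev2 iK (s%:P + 'X) (\poly_(j < n.+1) D j) F)`_n.+1.
pose D' j := if (j <= n)%N then D j else - cn * Delta^-1.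
exists D'; split; first by rewrite /D'.
apply: almost_impl (almost_and (almost_and (almost_local g) (almost_local s))
  (almost_and hD (almost_lunit hF'))) => R [[lg ls] [hDR uD]] e es.
have {}hDR := hDR e es.
move=> j; rewrite leq_eqVlt => /orP[/eqP ->|jn]; last by rewrite /D' -ltnS jn; exact: hDR.
rewrite /D' ltnn.
pose Yn : {poly k} := \poly_(j < n.+1) e g j%:Z.
pose x : {poly k} := (e s 0)%:P + 'X.
have tx : truncated e n.+1 s x.
  split=> // i _; rewrite coefD coefC coefX; case: i => [|i]; first by rewrite addr0.
  by rewrite add0r es.
have ty : truncated e n.+1 g (Yn + e g n.+1%:Z *: 'X^(n.+1)).
  split=> // i le; rewrite coefD coef_poly coefZ coefXn ltnS.
  have [->|ne] := eqVneq i n.+1; first by rewrite ltnn add0r mulr1.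
  by rewrite mulr0 addr0 (_ : (i <= n)%N = true) //; lia.
have [_ /(_ n.+1 (leqnn _))] := ring_rel_ev2 (truncated_rel e n.+1) F tx ty.
rewrite hF ex0 ev2_taylor_coef // => /esym E.
have x0 : x`_0 = e s 0 by rewrite coefD coefC coefX addr0.
have y0 : Yn`_0 = e g 0 by rewrite coef_poly.
have vD : has_value R Delta (ev2 (idfun : {rmorphism k -> k}) (e s 0) (e g 0) F^`()).
  by apply: (ring_rel_ev2 (has_value_rel R)); exact: ex_has_value.
have nD : ev2 (idfun : {rmorphism k -> k}) (e s 0) (e g 0) F^`() != 0.
  apply/eqP => z; case: uD => _; apply; case: vD => _; by rewrite z rmorph0 subr0.
have vc : has_value R cn (ev2 (@polyC k : {rmorphism k -> {poly k}}) x Yn F)`_n.+1.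
  apply: (ring_rel_ev2 (coef_value_rel R)) => i.
    rewrite !coefD !coefC !coefX; case: (has_value_rel R) => hc hA _; apply: hA.
      by case: i => [|i] /=; [exact: ex_has_value | exact: has_value0].
    by rewrite -(rmorph_nat iota); exact: hc.
  rewrite !coef_poly; case: ifP => [lt|_]; last exact: has_value0.
  by apply: hDR; rewrite -ltnS.
rewrite x0 y0 in E.
have -> : e g n.+1%:Z = - (ev2 (@polyC k : {rmorphism k -> {poly k}}) x Yn F)`_n.+1 *
    (ev2 (idfun : {rmorphism k -> k}) (e s 0) (e g 0) F^`())^-1.
  by apply: (mulIf nD); rewrite divfK //; apply/eqP; rewrite -addr_eq0 addrC E.
apply: has_valueM; last exact: has_value_inv.
have m1 : has_value R (-1) (-1).
  by have [hc _ _] := has_value_rel R; have := hc (-1); rewrite /= rmorphN1.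
by have := has_valueM m1 vc; rewrite !mulN1r.
Qed.

End FormalCoordinates.

(** * Sections of the sheaf *)

Section PowerSeriesLemmas.
Variable k : fieldType.
Implicit Types f g : nat -> k.

Lemma fexp0 f j : fexp f j 0%N = f 0%N ^+ j.
Proof.
elim: j => [|j IHj]; first by rewrite expr0.
by rewrite /fexp iterS -/(fexp f j) /fmul big_ord1 /= exprS IHj.
Qed.

Lemma fexp1 f n : fexp f 1 n = f n.
Proof.
rewrite /fexp /= /fmul big_ord_recr /= subnn /fone eqxx mulr1 big1 ?add0r // => i _.
by rewrite subn_eq0 leqNgt ltn_ord mulr0.
Qed.

Lemma fexpzN_neq0 f d : f 0%N != 0 -> fexpz f (- d%:Z) 0%N != 0.
Proof.
move=> f0; case: d => [|d]; first exact: oner_neq0.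
have -> : fexpz f (- d.+1%:Z) = fexp (Defs.finv f) d.+1 by [].
rewrite fexp0 expf_neq0 // /Defs.finv big_ord1 /= mulf_neq0 ?invr_neq0 //.
exact: oner_neq0.
Qed.

(* A vanishing linear coefficient (junk) is replaced by 1. *)
Definition aut_coef g (n : nat) : k :=
  if n == 0%N then 0 else if (n == 1%N) && (g 1%N == 0) then 1 else g n.

Lemma aut_coef1 g : aut_coef g 1%N != 0.
Proof. by rewrite /aut_coef /=; case: (eqVneq (g 1%N) 0) => [_|//]; exact: oner_neq0. Qed.

Definition aut_of g : autO k := @AutO k (aut_coef g) erefl (aut_coef1 g).

Lemma aut_ofE g n : g 1%N != 0 -> (0 < n)%N -> aut_of g n = g n.
Proof. by case: n => // n g1 _; rewrite /= /aut_coef /= (negPf g1) andbF. Qed.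

End PowerSeriesLemmas.

Section Sections.
Variables (k : closedFieldType) (V : vertex_algebra k) (G : va_grading V).
Variables (Pi : autO_action G) (C : curve k) (hC : smooth C).
Local Notation K := (ff C).
Local Notation iota := (cst C).
Implicit Types (Q R : point C) (f g s : K) (a : V).
Local Notation vge := (vge hC).
Local Notation vex := (vex hC).

(** By [act_alg] the action is a formula in the coefficients of positive index. *)
Lemma act_ext (r r' : autO k) a : (forall n, (0 < n)%N -> r n = r' n) ->
  Pi r a = Pi r' a.
Proof.
move=> h; have [m [N [l [q [w hw]]]]] := act_alg Pi a.
rewrite !hw; apply: eq_bigr => j _; rewrite h //; congr (_ * _.@[_] *: _).
by apply: boolp.funext => i; rewrite h.
Qed.

(** The series expressing s - s(R) in e, when s is etale at R; [aut_of] discards the constant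
    term. *)
Definition rho_at R (e : formal_coord R) s : autO k := aut_of (fun n => e s n%:Z).

Lemma etale_ex1 R (e : formal_coord R) s : etale s R -> e s 1 != 0.
Proof.
case=> c /(eord_uniformizer e)[]; rewrite ex_add exN ex_cst /= subr0.
by [].
Qed.

Lemma etale_local R s : etale s R -> local_ring R s.
Proof.
case=> c [/max_local h _]; rewrite -[s](subrK (iota c)).
by apply: local_add => //; exact: local_cst.
Qed.

(* The section [a (x) f ds], extended by 0 to the points of [B]. *)
Definition sec (B : point C -> Prop) s f a : tfun C V := fun Q e =>
  if boolp.asbool (B Q) then 0 else (e f 0 * e s 1) *: Pi (rho_at e s) a.

Lemma sec_equivariant (U B : point C -> Prop) s f a :
  (forall Q, U Q -> ~ B Q -> etale s Q /\ local_ring Q f) ->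
  equivariant Pi U (sec B s f a).
Proof.
move=> hB Q r e e' UQ ch; rewrite /sec; case: boolp.asboolP => [_|nB].
  by rewrite linear0 scaler0.
have [es lf] := hB Q UQ nB; have ls := etale_local es.
have e1 := etale_ex1 e es; have e'1 := etale_ex1 e' es.
have Ef : e f 0 = e' f 0.
  by rewrite (ch f lf 0%N) /fcomp big_ord1 fexp0 expr0 mulr1.
have Es1 : e s 1 = e' s 1 * r 1%N.
  rewrite (ch s ls 1%N) /fcomp big_ord_recl big_ord1 fexp1 /=.
  by rewrite /fone /= mulr0 add0r.
(* If s - s(Q) = rho'(e') and e' = r(e), the series of s in e is rho' composed with r, which is
   [aut_mul r rho']. *)
have -> : Pi (rho_at e s) a = Pi r (Pi (rho_at e' s) a).
  rewrite -act_mul; apply: act_ext => n npos.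
  rewrite aut_ofE // (ch s ls n) /= /fcomp !big_ord_recl.
  rewrite [in LHS]/fexp /= /fone (gtn_eqF npos) !mulr0; congr (_ + _).
  by apply: eq_bigr => j _; rewrite -[aut_coef _ _]/(rho_at e' s _) aut_ofE.
have r1 := aut_ser1 r.
rewrite linearZ gl_funK scalerA; congr (_ *: _).
by rewrite Ef Es1; field.
Qed.

Lemma sec_trivial (U B : point C -> Prop) s f d a : G d a ->
  (forall Q, U Q -> [/\ ~ B Q, etale s Q & local_ring Q f]) ->
  trivialized U s (sec B s f a) (fun _ : 'I_1 => a) (fun _ : 'I_1 => f).
Proof.
move=> Ga hU; split=> [j Q /hU[]//|Q e UQ es]; rewrite big_ord1 /sec.
have [nB et lf] := hU Q UQ; case: boolp.asboolP => // _.
have -> : e s 1 = 1 by rewrite es.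
rewrite mulr1; congr (_ *: _).
have o1 : (1 : k) != 0 := oner_neq0 _.
have -> : Pi (rho_at e s) a = Pi (aut_scale o1) a.
  apply: act_ext => n npos; rewrite aut_ofE ?etale_ex1 //= es ?mulr1 //.
  by case: (n) npos.
by rewrite (act_scale Pi o1 Ga) expr1n invr1 scale1r.
Qed.

(* Near [Q], in terms of a coordinate [s'] there, [a (x) ds] has rational
   coefficients, since [Pi] is algebraic. *)
Lemma sec_coefficients Q s a : exists l (w : 'I_l -> V) (g : 'I_l -> K),
  almost (fun R => (forall j, local_ring R (g j)) /\
    forall e : formal_coord R, coord_of (unif hC Q) e -> etale s R ->
      e s 1 *: Pi (rho_at e s) a = \sum_j e (g j) 0 *: w j).
Proof.
have [m [N [l [q [w hw]]]]] := act_alg Pi a.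
have [D [D0 hD]] := taylor_coefficients hC s (unifP hC Q) m.+1.
(* The formula of [act_alg], times the factor s' of ds, with the coefficients of the series replaced
   by the functions D_i whose values they are. *)
pose g (j : 'I_l) := D 1%N * (D 1%N)^-1 ^+ N * mmap iota (fun i : 'I_m => D i.+1) (q j).
exists l, w, g; apply: almost_impl (almost_and hD (almost_ord (fun j => almost_local (g j)))).
move=> R [hR lg]; split=> // e es et.
have {}hR := hR e es; have e1 := etale_ex1 e et.
rewrite hw scaler_sumr; apply: eq_bigr => j _; rewrite scalerA; congr (_ *: _).
apply/esym; apply: ex_value; rewrite mulrA; apply: has_valueM.
  apply: has_valueM; first by rewrite -[1]/(1%N%:Z); exact: hR.
  rewrite aut_ofE // -exprVn; apply: (ring_relX (has_value_rel R)).
  by apply: has_value_inv => //; exact: hR.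
apply: (ring_rel_mmap (has_value_rel R)) => i.
by rewrite aut_ofE //; apply: hR; have := ltn_ord i; lia.
Qed.

(** In degree z only the constant terms of r' and of Pi(r_z) meet the lowest coefficients of the
    f_j, which gives the formula for v z; the bound by E is preserved by [act_filt]. *)
Lemma expansion_exists (W : point C -> Prop) phi P (e : formal_coord P) U s l
    (w : 'I_l -> V) (f : 'I_l -> K) (z : int) (E : nat) :
  chart U s -> U P -> trivialized (fun Q => U Q /\ W Q) s phi w f ->
  (forall j, vge P z (f j)) -> (forall j, below G E (w j)) ->
  exists v (r : autO k), [/\ expansion Pi W phi e v,
    forall m, m < z -> v m = 0, forall m, below G E (v m)
    & v z = \sum_j (r 1%N * e (f j) z) *: rho_z (Pi r) r 0%N (w j)].
Proof.
move=> ch UP tr hf hw.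
have et : etale s P by case: ch => _ /(_ P UP).
pose r := rho_at e s.
pose u m (ln : nat * nat) := \sum_j (fderiv r ln.1 * e (f j) (m - ln.1%:Z - ln.2%:Z)) *:
  rho_z (Pi r) r ln.2 (w j).
have u0 m ln : m - ln.1%:Z - ln.2%:Z < z -> u m ln = 0.
  by move=> lt; rewrite /u big1 // => j _; rewrite (vge_low e (hf j) lt) mulr0 scale0r.
pose sq m := [seq (l1, l2) | l1 <- seq.iota 0 `|(m - z)%R|.+1, l2 <- seq.iota 0 `|(m - z)%R|.+1].
have sqP m : uniq (sq m) /\ forall ln, ln \notin sq m -> u m ln = 0.
  split; first by apply: allpairs_uniq; rewrite ?iota_uniq // => -[? ?] [].
  move=> [l1 l2] nin; apply: u0 => /=; rewrite ltNge; apply: contra nin => le.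
  by apply: allpairs_f; rewrite mem_iota; lia.
pose v m := \sum_(ln <- sq m) u m ln.
have hv m : has_sum (u m) (v m) by exists (sq m).
exists v, r; split.
- exists U, s, l, w, f, r; split=> // n npos.
  by rewrite aut_ofE // etale_ex1.
- by move=> m lt; rewrite /v big1 // => -[l1 l2] _; apply: u0 => /=; lia.
- move=> m; apply: (subspace_sum (below_subspace G E)) => ln _.
  apply: (subspace_sum (below_subspace G E)) => j _.
  apply: (subspaceZ (below_subspace G E)); exact: act_filt.
- rewrite (has_sum_seq (r := [:: (0%N, 0%N)]) _ _ (hv z)) //.
    rewrite big_seq1 /u /=; apply: eq_bigr => j _.
    by rewrite !subr0 /fderiv mul1r.
  by move=> [l1 l2]; rewrite inE => ne; apply: u0 => /=; case: l1 l2 ne => [|l1] [|l2] //; lia.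
Qed.

(** * Sections with a prescribed pole *)

Section Existence.
Variables (np : nat) (P : 'I_np -> point C) (injP : injective P) (D : point C -> nat).
Hypothesis hDfin : exists s : seq {ffun 'I_(pdim C).+1 -> k},
     forall Q : point C, D Q <> 0%N -> pcoord Q \in s.
Variable (i0 : 'I_np).
Local Notation P0 := (P i0).
Local Notation s0 := (unif hC P0).

Lemma etale0 : etale s0 P0.
Proof. by exists 0; rewrite rmorph0 subr0; exact: unifP. Qed.

Lemma bad_points : exists bd : seq (point C), [/\ P0 \notin bd,
  forall j, j != i0 -> P j \in bd
  & forall Q, Q \notin bd -> Q != P0 -> [/\ etale s0 Q, D Q = 0%N & punctured P Q]].
Proof.
have [s1 h1] := etale_open hC (unifP hC P0).
have [sD hD] := hDfin; have [s2 h2] := points_of_coords sD.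
exists [seq Q <- s1 ++ s2 ++ [seq P j | j <- enum 'I_np] | Q != P0]; split.
- by rewrite mem_filter eqxx.
- move=> j ji; rewrite mem_filter (inj_eq injP) ji !mem_cat map_f ?orbT //.
  by rewrite mem_enum.
- move=> Q; rewrite mem_filter negb_and negbK => /orP[->//|nQ] QP0.
  move: nQ; rewrite !mem_cat !negb_or => /and3P[n1 n2 n3]; split; first exact: h1.
    by apply/eqP/negPn/negP => /eqP /hD /h2; apply/negP.
  by move=> j E; move: n3; rewrite E map_f // mem_enum.
Qed.

Variables (bd : seq (point C)).
Hypothesis bd0 : P0 \notin bd.
Hypothesis bdP : forall j, j != i0 -> P j \in bd.
Hypothesis bdN : forall Q, Q \notin bd -> Q != P0 ->
  [/\ etale s0 Q, D Q = 0%N & punctured P Q].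
Local Notation B := (fun Q => Q \in bd : Prop).

(** The shape of the section near a bad point Q. One number E bounds both the degrees of the vectors
    and, from below, the order of their coefficients at Q, so that at a marked point every mode that
    occurs lowers the degree. *)
Definition local_lift Q a f := exists U s l (w : 'I_l -> V) (h : 'I_l -> K) (E : nat),
  [/\ chart U s, U Q, forall R, U R -> R != Q -> R \notin bd /\ R != P0,
      trivialized U s (sec B s0 f a) w h
    & [/\ forall j R, U R -> vanishes (D R) R (h j),
          forall j, vge Q E%:Z (h j) & forall j, below G E (w j)]].

Lemma local_lift_exists Q a : Q \in bd -> exists Kq : nat, forall f,
  vge Q Kq%:Z f -> (forall R, R != P0 -> vge R 0 f) -> local_lift Q a f.
Proof.
move=> Qbd; have [l [w [g hg]]] := sec_coefficients Q s0 a.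
have QP0 : Q != P0 by apply: contraTneq Qbd => ->.
have /boolp.choice[z hz] : forall j, exists z, vge Q z (g j) by move=> j; exact: vge_exists.
have /boolp.choice[b hb] : forall j, exists b, below G b (w j) by move=> j; exact: below_exists.
pose E := (\sum_j b j)%N.
have hE j : below G E (w j).
  by apply: below_le (hb j); rewrite /E (bigD1 j) //= leq_addr.
(* D Q for the divisor, 1 so that the section is 0 at Q as [sec] prescribes, E for the bound in
   [local_lift], and the sum for the poles of the g_j at Q. *)
exists (D Q + 1 + E + \sum_j `|z j|)%N => f fQ freg.
pose U R := R = Q \/ [/\ R \notin bd, R != P0, etale (unif hC Q) R,
    forall j, local_ring R (g j)
    & forall e : formal_coord R, coord_of (unif hC Q) e -> etale s0 R ->
      e s0 1 *: Pi (rho_at e s0) a = \sum_j e (g j) 0 *: w j].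
have aU : almost U.
  have [s1 h1] := etale_open hC (unifP hC Q); have [s2 h2] := hg.
  exists (bd ++ P0 :: s1 ++ s2) => R; rewrite mem_cat inE mem_cat !negb_or.
  move=> /and4P[n1 n2 n3 n4]; right.
  by have [hl he] := h2 R n4; split=> //; exact: h1.
have fgQ j : vge Q (D Q + 1 + E)%N%:Z (f * g j).
  apply: vge_le (vge_mul fQ (hz j)).
  have : (`|z j| <= \sum_j `|z j|)%N by rewrite (bigD1 j) //= leq_addr.
  lia.
have lf R : R != P0 -> local_ring R f by move/freg/vge0P.
exists U, (unif hC Q), l, w, (fun j => f * g j), E; split.
- split; first exact: almost_zopen.
  move=> R [->|[_ _ //]]; exists 0; rewrite rmorph0 subr0; exact: unifP.
- by left.
- by move=> R [->|[? ? _ _ _]]; rewrite ?eqxx.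
- split=> [j R [->|[_ RP _ lg _]]|R e [E1|[nb RP et lg hR]] ce].
  + by apply/(vge0P hC); apply: vge_le (fgQ j).
  + by apply: local_mul; [exact: lf | exact: lg].
  + subst R; rewrite /sec; case: boolp.asboolP => // _; rewrite big1 // => j _.
    by rewrite (vge_low e (fgQ j)) ?scale0r //; lia.
  + have [et0 _ _] := bdN nb RP.
    rewrite /sec; case: boolp.asboolP => [/(negP nb)//|_].
    rewrite -scalerA (hR e ce et0) scaler_sumr; apply: eq_bigr => j _.
    rewrite scalerA; congr (_ *: _); apply/esym/ex_value; apply: has_valueM.
      by apply: ex_has_value; exact: lf.
    exact: ex_has_value (lg j).
- split=> [j R [->|[nb RP _ lg _]]|j|//].
  + by apply: (vge_vanishes (hC := hC)); apply: vge_le (fgQ j); lia.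
  + have [_ -> _] := bdN nb RP; apply: (vge_vanishes (hC := hC)); apply/vge0P.
    by apply: local_mul; [exact: lf | exact: lg].
  + by apply: vge_le (fgQ j); lia.
Qed.

Lemma sec_omega d a f : G d a -> (forall R, R != P0 -> vge R 0 f) ->
  (forall Q, Q \in bd -> local_lift Q a f) ->
  omega_section Pi D (punctured P) (sec B s0 f a).
Proof.
move=> Ga freg hl.
have pP0 Q : punctured P Q -> Q != P0 by move=> h; apply/eqP; exact: h.
have lf R : R != P0 -> local_ring R f by move/freg/vge0P.
split.
  apply: sec_equivariant => Q /pP0 QP0 /negP nb; split; last exact: lf.
  by case: (bdN nb QP0).
move=> Q pQ; have QP0 := pP0 Q pQ.
have [Qb|Qnb] := boolP (Q \in bd).
  have [U [s [l [w [h [E [ch UQ Un tr [va _ _]]]]]]]] := hl Q Qb.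
  exists U, s, l, w, h; split=> // R UR.
  have [->//|RQ] := eqVneq R Q; have [nb RP0] := Un R UR RQ.
  by case: (bdN nb RP0).
exists (fun R => R \notin bd /\ R != P0), s0, 1%N, (fun=> a), (fun=> f); split=> //.
- split.
    by apply: almost_zopen; exists (P0 :: bd) => R; rewrite inE negb_or => /andP[].
  by move=> R [nb RP0]; case: (bdN nb RP0).
- by move=> R [nb RP0]; case: (bdN nb RP0).
- apply: (sec_trivial Ga) => R [nb RP0]; have [et _ _] := bdN nb RP0.
  by split=> //; [exact/negP | exact: lf].
- move=> j R [nb RP0]; have [_ -> _] := bdN nb RP0.
  by apply: (vge_vanishes (hC := hC)); exact: freg.
Qed.

End Existence.

Theorem sections_exist (np : nat) (P : 'I_np -> point C) (injP : injective P)
    (D : point C -> nat)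
    (hDfin : exists s : seq {ffun 'I_(pdim C).+1 -> k},
       forall Q : point C, D Q <> 0%N -> pcoord Q \in s)
    (t : forall i, formal_coord (P i)) (i0 : 'I_np) d a : G d a ->
  exists N, forall n : nat, (N <= n)%N -> exists phi,
    [/\ omega_section Pi D (punctured P) phi,
        exists v c, [/\ expansion Pi (punctured P) phi (t i0) v, c != 0,
          below G d (v (- n%:Z) - c *: a), forall m, below G d.+1 (v m)
          & forall m, m < - n%:Z -> v m = 0]
      & forall j, j != i0 -> exists v (E : nat),
          [/\ expansion Pi (punctured P) phi (t j) v, forall m, below G E (v m)
            & forall m, m < E%:Z -> v m = 0]].
Proof.
move=> Ga; have [bd [bd0 bdP bdN]] := bad_points injP hDfin i0.
have /boolp.choice[Kq hK] : forall Q, exists Kq : nat, Q \in bd -> forall f,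
    vge Q Kq%:Z f -> (forall R, R != P i0 -> vge R 0 f) -> local_lift P D i0 bd Q a f.
  move=> Q; have [Qb|_] := boolP (Q \in bd); last by exists 0%N.
  by have [Kq h] := local_lift_exists bd0 bdN a Qb; exists Kq.
have [N hN] := pole_functions hC (P i0) bd (\sum_(Q <- undup bd) Kq Q)%N.
exists N => n /hN[f [fP freg fbd]].
have lift' Q : Q \in bd -> local_lift P D i0 bd Q a f.
  move=> Qb; apply: hK => //; have QP0 : Q != P i0 by apply: contraTneq Qb => ->.
  apply: vge_le (fbd Q Qb QP0); rewrite lez_nat (bigD1_seq Q) ?mem_undup ?undup_uniq //=.
  exact: leq_addr.
exists (sec (fun Q => Q \in bd) (unif hC (P i0)) f a); split.
- exact: (sec_omega bdN Ga freg lift').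
- have ch : chart (fun R => R \notin bd) (unif hC (P i0)).
    split; first by apply: almost_zopen; exists bd.
    move=> R nb; have [->|RP0] := eqVneq R (P i0); first exact: etale0.
    by case: (bdN R nb RP0).
  have tr : trivialized (fun Q => Q \notin bd /\ punctured P Q) (unif hC (P i0))
      (sec (fun Q => Q \in bd) (unif hC (P i0)) f a) (fun _ : 'I_1 => a) (fun=> f).
    apply: (sec_trivial Ga) => R [nb pR]; have RP0 : R != P i0 by apply/eqP; exact: pR.
    have [et _ _] := bdN R nb RP0; split=> //; first exact/negP.
    by apply/(vge0P hC); exact: freg.
  have [v [r [ex1 low bel lead]]] := @expansion_exists (punctured P) _ _ (t i0) _ _ _ _ _
    (- n%:Z) d.+1 ch bd0 tr (fun=> vex_vge fP) (fun=> gr_below Ga (leqnn _)).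
  have r1 : fderiv r 0%N != 0 by rewrite /fderiv mul1r; exact: aut_ser1.
  (* The factors come from ds, from the leading coefficient of f, and from r' to the power -d in
     [act_lead]. *)
  exists v, (r 1%N * t i0 f (- n%:Z) * fexpz (fderiv r) (- d%:Z) 0%N); split=> //.
    rewrite !mulf_neq0 ?aut_ser1 ?fexpzN_neq0 //.
    by case: (vex_eord (t i0) fP).
  rewrite lead big_ord1 -[(_ * fexpz _ _ _) *: a]scalerA -scalerBr.
  by apply: (subspaceZ (below_subspace G d)); exact: act_lead.
- move=> j ji; have [U [s [l [w [h [E [ch UQ Un tr [va hE wE]]]]]]]] := lift' _ (bdP j ji).
  have tr' : trivialized (fun Q => U Q /\ punctured P Q) s
      (sec (fun Q => Q \in bd) (unif hC (P i0)) f a) w h.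
    by case: tr => reg tv; split=> [i Q []|Q e []] *; [exact: reg | exact: tv].
  have [v [r [ex1 low bel _]]] := expansion_exists (t j) ch UQ tr' hE wE.
  by exists v, E.
Qed.

End Sections.

(** * Coinvariants *)

Lemma choice_dep (A : Type) (B : A -> Type) (R : forall a, B a -> Prop) :
  (forall a, exists b, R a b) -> exists f : forall a, B a, forall a, R a (f a).
Proof. by move=> h; exists (fun a => sval (boolp.cid (h a))) => a; case: boolp.cid. Qed.

(* [subspace_pred] takes the proof as an argument so that canonical structures
   can recover it. *)
Definition subspace_pred (k : fieldType) (W : lmodType k) (S : W -> Prop)
  (_ : subspace S) : {pred W} := fun x => boolp.asbool (S x).

Section TensorSpan.
Variables (k : fieldType) (W : lmodType k) (S : W -> Prop) (hS : subspace S).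

Lemma subspace_pred_closed : submod_closed (subspace_pred hS).
Proof.
by split=> [|c x y /boolp.asboolP hx /boolp.asboolP hy]; apply/boolp.asboolP;
  [exact: hS.1 | exact: hS.2].
Qed.

HB.instance Definition _ :=
  GRing.isSubmodClosed.Build k W (subspace_pred hS) subspace_pred_closed.

Record subspace_type := SubspaceType { subspace_val : W; _ : subspace_val \in subspace_pred hS }.

HB.instance Definition _ := [isSub for subspace_val].
HB.instance Definition _ := [Choice of subspace_type by <:].
HB.instance Definition _ := [SubChoice_isSubLmodule of subspace_type by <:].

End TensorSpan.

(* The pure tensors span: the universal property maps the tensor product to
   any subspace containing them. *)
Lemma pure_span (k : fieldType) n (M : 'I_n -> lmodType k) (T : tensor_product M)
    (S : T -> Prop) : subspace S -> (forall u, S (pure T u)) -> forall x : T, S x.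
Proof.
move=> hS hp x.
have hp' u : pure T u \in subspace_pred hS by apply/boolp.asboolP.
pose f u : subspace_type hS := SubspaceType (hp' u).
have mf : multilinear f.
  by move=> u i c y z; apply: val_inj; rewrite /= (pure_multilinear T).
have [g [hg _]] := pure_universal T mf.
have [g0 [_ uniq]] := pure_universal T (pure_multilinear T).
have e1 := uniq (idfun : {linear T -> T}) (fun u => erefl) x.
have e2 := uniq (((\val : subspace_type hS -> T) \o g) : {linear T -> T}) (fun u => congr1 _ (hg u)) x.
rewrite [x]e1 -e2 /=; exact/boolp.asboolP/(valP (g x)).
Qed.

Section MultilinearMaps.
Variables (k : fieldType) (n : nat) (M : 'I_n -> lmodType k) (T : tensor_product M).
Implicit Types u : forall i, M i.

Lemma dfwith_id u i : dfwith u (u i) = u.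
Proof.
by apply: boolp.functional_extensionality_dep => j; case: dfwithP.
Qed.

Lemma dfwith_twice u i (x y : M i) : dfwith (dfwith u x) y = dfwith u y.
Proof.
apply: boolp.functional_extensionality_dep => j.
have [<-|ij] := eqVneq i j; first by rewrite !dfwith_in.
by rewrite !dfwith_out.
Qed.

Lemma pure_lin u i c (x y : M i) :
  pure T (dfwith u (c *: x + y)) = c *: pure T (dfwith u x) + pure T (dfwith u y).
Proof. exact: pure_multilinear. Qed.

Lemma pure0 u i : pure T (dfwith u (0 : M i)) = 0.
Proof. by have := pure_lin u (-1) (0 : M i) 0; rewrite scaler0 addr0 scaleN1r addNr. Qed.

Lemma pure_subspace (S : T -> Prop) u i : subspace S ->
  subspace (fun x : M i => S (pure T (dfwith u x))).
Proof.
by move=> hS; split=> [|c x y hx hy]; rewrite ?pure0 ?pure_lin; [exact: hS.1 | exact: hS.2].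
Qed.

End MultilinearMaps.

(** * Action of a series of modes on a homogeneous vector *)

Section ModeDegrees.
Variables (k : closedFieldType) (V : vertex_algebra k) (G : va_grading V) (M : va_module G).

Lemma modes_below (E q B : nat) c (y : M) m : below G E c -> vm_gr M q y ->
  E%:Z + q%:Z - 1 - m <= B%:Z -> below (vm_gr M) B (YM c m y).
Proof.
move=> hc hy le.
have sB := below_subspace (vm_gr M) B.
apply: (below_ind (G := G) (S := fun c => below (vm_gr M) B (YM c m y)) (p := E)) hc.
  split=> [|c' x z hx hz]; first by rewrite YM_0l; exact: sB.1.
  by rewrite YM_linl; exact: sB.2.
move=> s x lt Gx; have := YM_gr m Gx hy.
case E1: (_ - m) => [r|r] /= h; last by rewrite h; exact: sB.1.
by apply: gr_below h _; lia.
Qed.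

Lemma below0 (y : M) : below (vm_gr M) 0 y -> y = 0.
Proof. by case=> x [_ ->]; rewrite big_ord0. Qed.

(** The sum is finite: v m vanishes below z, and large modes would lead to negative degree. The mode
    z, which raises the degree most, is singled out. *)
Lemma acts_exists (v : int -> V) (E q : nat) (z : int) (y : M) :
  (forall m, below G E (v m)) -> (forall m, m < z -> v m = 0) -> vm_gr M q y ->
  exists2 w, acts v y w & forall S : M -> Prop, subspace S ->
    (forall m, z < m -> S (YM (v m) m y)) -> S (w - YM (v z) z y).
Proof.
move=> vE vz yq; pose L := `|(E%:Z + q%:Z - z)%R|.+1.
pose s := [seq z + i%:Z | i <- seq.iota 0 L].
have h : has_sum (fun m => YM (v m) m y) (\sum_(m <- s) YM (v m) m y).
  exists s => //; split; first by rewrite map_inj_uniq ?iota_uniq // => i j /addrI [].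
  move=> m nm; have [/vz ->|ge] := ltP m z; first by rewrite YM_0l.
  apply: below0; apply: (modes_below (vE m) yq); rewrite leNgt.
  apply: contra nm => lt; apply/mapP; exists `|(m - z)%R|%N; last lia.
  by rewrite mem_iota /L; lia.
exists (\sum_(m <- s) YM (v m) m y) => // S hS hm.
apply: (has_sum_subspace1 (u := fun m => YM (v m) m y) hS) h => m ne.
have [lt|gt|E1] := ltgtP m z; first by rewrite vz // YM_0l; case: hS.
  exact: hm.
by rewrite E1 eqxx in ne.
Qed.

End ModeDegrees.

Section Coinvariants.
Variables (k : closedFieldType) (V : vertex_algebra k) (G : va_grading V).
Variables (Pi : autO_action G) (C : curve k) (hC : smooth C).
Variables (n : nat) (P : 'I_n -> point C) (injP : injective P) (D : point C -> nat).
Variable (t : forall i, formal_coord (P i)).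
Variables (M : 'I_n -> va_module G) (T : tensor_product (fun i => vm (M i))).

(** A global section serves as its own lift at every point, so lifts differ by an empty sum of nabla
    images. [L_image] names the lift by a point outside P, which [point_avoiding] supplies. *)
Lemma L_image_section phi (u w : forall i, vm (M i)) :
  omega_section Pi D (punctured P) phi ->
  (forall i, exists v, expansion Pi (punctured P) phi (t i) v /\ acts v (u i) (w i)) ->
  L_image Pi t D (\sum_i pure T (dfwith u (w i))).
Proof.
move=> om hw.
have zo : zopen (punctured P).
  apply: almost_zopen; exists [seq P i | i <- enum 'I_n] => Q nQ i E.
  by move: nQ; rewrite E map_f // mem_enum.
have agree : im_nabla Pi (fun R => punctured P R /\ punctured P R)
    (fun R e => phi R e - phi R e).
  move=> R UR; exists (fun R => punctured P R /\ punctured P R), 0%N, (fun=> phi).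
  split=> //; [|by case|by move=> Q e _; rewrite subrr big_ord0].
  by move=> Q [h _]; have [d [A [hA AQ h']]] := zo Q h; exists d, A; split=> // Q' /h'.
pose sigma : L_section Pi D (punctured P) :=
  @Build_L_section _ _ _ _ _ _ _ (fun=> punctured P) (fun=> phi)
    (fun Q pQ => And3 zo pQ (fun R h => h)) (fun _ _ => om) (fun _ _ _ _ => agree).
have [Q nQ] := point_avoiding hC [seq P i | i <- enum 'I_n].
exists sigma, u, w; split=> // i; have [v [h1 h2]] := hw i; exists Q, v; split=> //.
by move=> j E; move: nQ; rewrite E map_f // mem_enum.
Qed.

Lemma fin_dim_span (W : lmodType k) (S : W -> Prop) (F : finType) (e : F -> W) :
  (forall x, in_span (fun y => S y \/ exists j, y = e j) x) -> fin_dim_quotient S.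
Proof.
move=> h; exists #|F|, (e \o enum_val) => x.
have sS := in_span_subspace S.
suff [c hc] : exists c : F -> k, in_span S (x - \sum_j c j *: e j).
  exists (c \o enum_val); rewrite (reindex enum_rank) /=; last exact/onW_bij/enum_rank_bij.
  by under eq_bigr => j _ do rewrite enum_rankK.
apply: (in_span_min (T := fun x => exists c : F -> k, in_span S (x - \sum_j c j *: e j))) (h x).
  split=> [|c y z [cy hy] [cz hz]].
    exists (fun=> 0); rewrite big1 ?subr0; first exact: sS.1.
    by move=> j _; rewrite scale0r.
  exists (fun j => c * cy j + cz j).
  have -> : c *: y + z - \sum_j (c * cy j + cz j) *: e j =
      c *: (y - \sum_j cy j *: e j) + (z - \sum_j cz j *: e j).
    rewrite scalerBr scaler_sumr addrACA -opprD -big_split /=; congr (_ - _).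
    by apply: eq_bigr => j _; rewrite scalerDl scalerA.
  exact: sS.2.
move=> y [Sy|[j ->]].
  exists (fun=> 0); rewrite big1 ?subr0; first exact: in_span_mem.
  by move=> j _; rewrite scale0r.
exists (fun i => (i == j)%:R); rewrite (bigD1 j) //= eqxx scale1r big1 ?addr0 ?subrr.
  exact: sS.1.
by move=> i /negPf ->; rewrite scale0r.
Qed.

Lemma good_below (Good : T -> Prop) (sG : subspace Good) (u : forall i, vm (M i)) (r : 'I_n -> nat) i (B N : nat) x :
  (forall j, j != i -> vm_gr (M j) (r j) (u j)) -> below (vm_gr (M i)) B x ->
  (B + \sum_(j | j != i) r j <= N)%N ->
  (forall (u' : forall i, vm (M i)) (r : 'I_n -> nat), (forall i, vm_gr (M i) (r i) (u' i)) ->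
       (\sum_i r i < N)%N -> Good (pure T u')) ->
  Good (pure T (dfwith u x)).
Proof.
move=> hu hx le IH.
apply: (below_ind (G := vm_gr (M i)) (S := fun x => Good (pure T (dfwith u x)))) hx.
  exact: pure_subspace.
move=> s y lt hy; apply: (IH _ (fun j => if j == i then s else r j)) => [j|].
  have [<-|ne] := eqVneq i j; first by rewrite dfwith_in ?eqxx.
  by rewrite dfwith_out //; apply: hu; rewrite eq_sym.
rewrite (bigD1 i) //= eqxx; apply: leq_trans le; rewrite -addSn leq_add //.
by apply: leq_sum => j /negPf ->.
Qed.

(* [a_(-m)] acting on the [i0]-th factor is, up to terms of lower degree, the
   action of an element of the Lie algebra. *)
Lemma mode_reduction i0 d a :
  (exists s : seq {ffun 'I_(pdim C).+1 -> k},
     forall Q : point C, D Q <> 0%N -> pcoord Q \in s) ->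
  G d a -> exists N, forall m : nat, (N <= m)%N -> (0 < m)%N ->
  forall Good : T -> Prop, subspace Good -> (forall x, L_image Pi t D x -> Good x) ->
  forall (u : forall i, vm (M i)) (q : 'I_n -> nat) (q' : nat) (y : M i0),
    (forall i, i != i0 -> vm_gr (M i) (q i) (u i)) -> vm_gr (M i0) q' y ->
    (q i0)%:Z = d%:Z + q'%:Z - 1 + m%:Z ->
    (forall (u' : forall i, vm (M i)) (r : 'I_n -> nat), (forall i, vm_gr (M i) (r i) (u' i)) ->
       (\sum_i r i < \sum_i q i)%N -> Good (pure T u')) ->
    Good (pure T (dfwith u (YM a (- m%:Z) y))).
Proof.
move=> hDfin Ga; have [N hN] := sections_exist Pi hC injP hDfin t i0 Ga.
exists N => m Nm mpos Good sG goodL u q q' y hu hy Eq IH.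
have [phi [om [v0 [c [ex0 c0 lead bel0 low0]]] hj]] := hN m Nm.
pose u1 := dfwith u y : forall i, vm (M i).
pose q1 i := if i == i0 then q' else q i.
have u1q i : vm_gr (M i) (q1 i) (u1 i).
  rewrite /q1 /u1; have [<-|ne] := eqVneq i0 i; first by rewrite dfwith_in ?eqxx.
  by rewrite dfwith_out //; apply: hu; rewrite eq_sym.
have [w0 aw0 hw0] := acts_exists bel0 low0 hy.
(* The tensor with w in place i is good for i != i0, and for i = i0 it is c times the target up to a
   good vector. The sum over i lies in the image of L(V, D), so the target is good. *)
have exw i : exists w : M i,
    (exists v, expansion Pi (punctured P) phi (t i) v /\ acts v (u1 i) w) /\
    Good (pure T (dfwith u1 w) - (i == i0)%:R *: (c *: pure T (dfwith u (YM a (- m%:Z) y)))).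
  have [E1|ne] := eqVneq i i0; last first.
    have [v [E [exv bel low]]] := hj i ne.
    have [w aw hw] := acts_exists bel low (u1q i).
    exists w; split; first by exists v.
    rewrite scale0r subr0.
    have qi : q1 i = q i by rewrite /q1 (negPf ne).
    have sB := below_subspace (vm_gr (M i)) (q i).
    have mb m' : E%:Z <= m' -> below (vm_gr (M i)) (q i) (YM (v m') m' (u1 i)).
      by move=> le; apply: (modes_below (bel m') (u1q i)); rewrite qi; lia.
    have wb : below (vm_gr (M i)) (q i) w.
      rewrite -(subrK (YM (v E%:Z) E%:Z (u1 i)) w); apply: (subspaceD sB).
        by apply: hw => // m' lt; apply: mb; lia.
      exact: mb.
    apply: (good_below sG (r := q1) (N := \sum_i q i) _ wb _ IH) => [j _|]; first exact: u1q.
    (* At i0 the inequality is q' <= q i0, which holds because m > 0. *)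
    rewrite [leqRHS](bigD1 i) //= leq_add2l; apply: leq_sum => j _; rewrite /q1.
    by case: eqP => // ->; lia.
  subst i; exists w0; rewrite scale1r; split.
    by exists v0; rewrite /u1 dfwith_in.
  have sB := below_subspace (vm_gr (M i0)) (q i0).
  have wb : below (vm_gr (M i0)) (q i0) (w0 - c *: YM a (- m%:Z) y).
    have -> : w0 - c *: YM a (- m%:Z) y = (w0 - YM (v0 (- m%:Z)) (- m%:Z) y) +
        YM (v0 (- m%:Z) - c *: a) (- m%:Z) y.
      have -> : v0 (- m%:Z) - c *: a = (- c) *: a + v0 (- m%:Z) by rewrite addrC scaleNr.
      by rewrite YM_linl scaleNr addrA addrAC subrK.
    apply: (subspaceD sB).
      by apply: hw0 => // m' lt; apply: (modes_below (bel0 m') hy); rewrite Eq; lia.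
    by apply: (modes_below lead hy); rewrite Eq; lia.
  have -> : pure T (dfwith u1 w0) - c *: pure T (dfwith u (YM a (- m%:Z) y)) =
      pure T (dfwith u (w0 - c *: YM a (- m%:Z) y)).
    have -> : w0 - c *: YM a (- m%:Z) y = (- c) *: YM a (- m%:Z) y + w0.
      by rewrite scaleNr addrC.
    by rewrite /u1 dfwith_twice pure_lin scaleNr addrC.
  apply: (good_below sG (r := q) (N := \sum_i q i) hu wb _ IH).
  by rewrite [leqRHS](bigD1 i0).
have [w hw] := choice_dep exw.
have GL := goodL _ (L_image_section om (fun i => (hw i).1)).
have GS : Good (c *: pure T (dfwith u (YM a (- m%:Z) y))).
  have := subspaceB sG GL (subspace_sum sG (index_enum 'I_n) (P := xpredT) (fun i _ => (hw i).2)).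
  rewrite sumrB opprB addrCA subrr addr0 (bigD1 i0) //= eqxx scale1r big1 ?addr0 //.
  by move=> i /negPf ->; rewrite scale0r.
rewrite -[pure _ _](scalerK c0); exact: subspaceZ.
Qed.

Lemma good_pure (I : finType) (bd : I -> nat) (bv : I -> V) (N : nat)
    (xs : forall i, seq (M i)) (Good : T -> Prop) :
  (forall b, G (bd b) (bv b)) -> subspace Good ->
  (forall i x, x \in xs i -> exists q, vm_gr (M i) q x) ->
  (forall i S, subspace S ->
     (forall b m y q, m <= - N%:Z -> vm_gr (M i) q y -> S (YM (bv b) m y)) ->
     (forall x, x \in xs i -> S x) -> forall x, S x) ->
  (forall i b (m : nat), (N <= m)%N ->
   forall (u : forall i, vm (M i)) (q : 'I_n -> nat) (q' : nat) (y : M i),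
    (forall j, j != i -> vm_gr (M j) (q j) (u j)) -> vm_gr (M i) q' y ->
    (q i)%:Z = (bd b)%:Z + q'%:Z - 1 + m%:Z ->
    (forall (u' : forall i, vm (M i)) (r : 'I_n -> nat), (forall i, vm_gr (M i) (r i) (u' i)) ->
       (\sum_i r i < \sum_i q i)%N -> Good (pure T u')) ->
    Good (pure T (dfwith u (YM (bv b) (- m%:Z) y)))) ->
  (forall u, (forall i, u i \in xs i) -> Good (pure T u)) ->
  forall u, Good (pure T u).
Proof.
move=> Gb sG hx gen red base.
have hom p : forall (u : forall i, vm (M i)) (q : 'I_n -> nat),
    (forall i, vm_gr (M i) (q i) (u i)) -> (\sum_i q i < p)%N -> Good (pure T u).
  elim: p => [//|p IH] u0 q hu0 lt.
  (* the first [n - e] factors already lie in the finite sets [xs] *)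
  have step e : forall u : forall i, vm (M i), (forall i, vm_gr (M i) (q i) (u i)) ->
      (forall i : 'I_n, (i < n - e)%N -> u i \in xs i) -> Good (pure T u).
    elim: e => [|e IHe] u hu mem.
      by apply: base => i; apply: mem; rewrite subn0.
    have [le|en] := leqP n e; first by apply: IHe => // i; lia.
    have i0p : (n - e.+1 < n)%N by lia.
    pose i0 := Ordinal i0p.
    (* [gen] applies to subspaces of the whole module; projecting to degree q i0 keeps the tensor
       homogeneous of the same total degree. *)
    suff: Good (pure T (dfwith u (hom_part (vm_gr (M i0)) (q i0) (u i0)))).
      by rewrite (hom_part_id _ (hu i0)) eqxx dfwith_id.
    apply: (gen i0 (fun y => Good (pure T (dfwith u (hom_part (vm_gr (M i0)) (q i0) y))))).
    - split=> [|c x y h1 h2].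
        by rewrite (hom_part_id _ (gr0 _ 0)) if_same pure0; exact: sG.1.
      by rewrite hom_part_lin pure_lin; exact: sG.2.
    - move=> b m y q' le hy; rewrite (hom_part_grz _ (YM_gr m (Gb b) hy)).
      case: eqP => [E|_]; last by rewrite pure0; exact: sG.1.
      have Em : m = - `|m|%N%:Z by lia.
      rewrite Em; apply: (red i0 b `|m|%N _ u q q') => //; try lia.
      by move=> u' r hu' lt'; apply: IH hu' _; lia.
    - move=> x xx; have [qx hqx] := hx _ _ xx; rewrite (hom_part_id _ hqx).
      case: eqP => [E|_]; last by rewrite pure0; exact: sG.1.
      apply: IHe => i; have [<-|ne] := eqVneq i0 i.
      + by rewrite dfwith_in E.
      + by rewrite dfwith_out.
      + by rewrite dfwith_in.
      + rewrite dfwith_out // => lti; apply: mem.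
        by move/eqP: ne => ne; have : val i0 <> val i by [move/val_inj]; rewrite /=; lia.
  by apply: (step n u0 hu0) => i; rewrite subnn.
(* General factors are split into homogeneous components one at a time; those of index at least j
   are already homogeneous. *)
suff h j : forall u : forall i, vm (M i),
    (forall i : 'I_n, (j <= i)%N -> exists q, vm_gr (M i) q (u i)) -> Good (pure T u).
  by move=> u; apply: (h n) => i; rewrite leqNgt ltn_ord.
elim: j => [|j IHj] u hu.
  have [q hq] := boolp.choice (fun i => hu i (leq0n _)).
  exact: (hom (\sum_i q i).+1 u q).
have [le|jn] := leqP n j; first by apply: IHj => i; have := ltn_ord i; lia.
pose i0 := Ordinal jn; have sS := pure_subspace (T := T) u i0 sG.
have [m0 /(_ m0 (leqnn _)) E] := hom_part_sum (vm_gr (M i0)) (u i0).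
rewrite -(dfwith_id u i0) E; apply: (subspace_sum sS) => s _.
apply: IHj => i; have [<-|ne] := eqVneq i0 i.
  by rewrite dfwith_in => _; exists s; exact: hom_partP.
rewrite dfwith_out // => le; apply: hu.
by move/eqP: ne => ne; have : val i0 <> val i by [move/val_inj]; rewrite /=; lia.
Qed.

End Coinvariants.

Theorem proposition9p1
  (k : closedFieldType) (V : vertex_algebra k) (G : va_grading V)
  (Pi : autO_action G)
  (C : curve k) (hC : smooth C)
  (n : nat) (P : 'I_n -> point C) (hP : injective P)
  (D : point C -> nat)
  (hDfin : exists s : seq {ffun 'I_(pdim C).+1 -> k},
     forall Q : point C, D Q <> 0%N -> pcoord Q \in s)
  (hDP : forall i, D (P i) = 0%N)
  (t : forall i, formal_coord (P i))
  (hcft : cft_type G) (hC2 : C2_cofinite V)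
  (M : 'I_n -> va_module G)
  (hM : forall i, generated_in_degree0 (M i))
  (T : tensor_product (fun i => vm (M i))) :
  fin_dim_quotient (L_image Pi t D (T := T)).
Proof.
have [I [bd [bv [Gb gen]]]] := module_generators hcft hC2.
have /boolp.choice[N0 hN0] : forall ib : 'I_n * I, _ :=
  fun ib => mode_reduction Pi hC hP t T ib.1 hDfin (Gb ib.2).
(* The successor makes every m >= N positive, as [mode_reduction] requires. *)
pose N := (\max_ib N0 ib).+1.
have /choice_dep[xs hxs] := fun i => gen (M i) (hM i) N.
pose F := {dffun forall i, 'I_(size (xs i))}.
apply: (fin_dim_span (e := fun g : F => pure T (fun i => (xs i)`_(g i)))) => x.
apply: pure_span => [|u]; first exact: in_span_subspace.
apply: (good_pure (xs := xs) (N := N) Gb); first exact: in_span_subspace.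
- by move=> i; case: (hxs i).
- by move=> i; case: (hxs i).
- move=> i b m le u' q q' y hu hy E IH.
  apply: (hN0 (i, b) m _ _ _ _ _ u' q q') => //.
  + by apply: leq_trans (leq_bigmax (i, b)) _; exact: ltnW.
  + exact: leq_ltn_trans le.
  + exact: in_span_subspace.
  + by move=> z hz; apply: in_span_mem; left.
- move=> u' hu; apply: in_span_mem; right.
  exists [ffun i => Ordinal (etrans (index_mem _ _) (hu i))]; congr (pure T _).
  by apply: boolp.functional_extensionality_dep => i; rewrite ffunE /= nth_index.
Qed.
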